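(* Let $E,E'$ be real Banach spaces of dimension at least $2$, and let $D\subsetneq E$ and $D'\subsetneq E'$ be $c$-uniform domains. Let $L\ge 1$ and let $\varphi:[0,\infty)\to[0,\infty)$ be a homeomorphism with $\varphi(t)\ge t$. If $f\in QC^L_\varphi(D,D')$, that is, if $f:\overline{D}\to\overline{D'}$ is a homeomorphism such that $f|_D$ is a $\varphi$-FQC map (of $D$ onto $D'$) and $f|_{\partial D}$ is $L$-bilipschitz, then $f$ is $\eta$-quasisymmetric in $\overline{D}$ with $\eta$ depending on $c$, $L$ and $\varphi$ only.
   Context: The norm of $E$ or $E'$ is written $|\cdot|$. A domain is a nonempty open connected set. The one-point extension $\dot E=E\cup\{\infty\}$ is the Hausdorff space in which the neighborhoods of $\infty$ are the complements of closed bounded sets of $E$; the boundary $\partial A$ and the closure $\overline{A}$ of a set $A\subset E$ are taken in $\dot E$ (similarly for $E'$). For a domain $D\subsetneq E$, $d_D(z)$ is the distance from $z\in D$ to the boundary of $D$, and $k_D(z_1,z_2)=\inf_\alpha\int_\alpha |dz|/d_D(z)$ is the quasihyperbolic distance, the infimum being over all rectifiable arcs $\alpha$ in $D$ joining $z_1$ to $z_2$. $D$ is $c$-uniform if each pair of points $z_1,z_2\in D$ can be joined by a rectifiable arc $\alpha$ in $D$ with $\min_{j=1,2}\ell(\alpha[z_j,z])\le c\,d_D(z)$ for all $z\in\alpha$ and $\ell(\alpha)\le c|z_1-z_2|$, where $\ell$ is norm length and $\alpha[z_j,z]$ is the part of $\alpha$ between $z_j$ and $z$. A homeomorphism $f:G\to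 G'$ between domains $G\subsetneq E$, $G'\subsetneq E'$ is $\varphi$-solid if $k_{G'}(f(x),f(y))\le\varphi(k_G(x,y))$ for all $x,y\in G$ and $f^{-1}$ satisfies the analogous inequality. It is $\varphi$-FQC (freely $\varphi$-quasiconformal, or fully $\varphi$-solid) if for every subdomain $G_1\subset G$ the map $f|_{G_1}:G_1\to f(G_1)$ is $\varphi$-solid. A homeomorphism $f$ of a set $A$ onto its image is $L$-bilipschitz if $|x-y|/L\le|f(x)-f(y)|\le L|x-y|$ for all $x,y\in A$. For a homeomorphism $\eta:[0,\infty)\to[0,\infty)$, an embedding $f:X\to Y$ of metric spaces is $\eta$-quasisymmetric if for every triple of distinct points $x,a,b\in X$, $\frac{|f(a)-f(x)|}{|f(b)-f(x)|}\le\eta\left(\frac{|a-x|}{|b-x|}\right)$, where $|\cdot-\cdot|$ denotes distance.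
   Formalization: When ∞ lies in ∂D, ''f|∂D is L-bilipschitz'' is taken to mean that f(∞)=∞ and that f maps the finite boundary points to finite points L-bilipschitzly; without f(∞)=∞ the claim fails (inversion of E\{0} swapping 0 and ∞). *)

(* Defs.v *)
From HB Require Import structures.
From mathcomp Require Export all_boot all_order all_algebra.
From mathcomp Require Export all_classical all_reals all_analysis.
Export Order.TTheory GRing.Theory Num.Theory.
Export numFieldNormedType.Exports.

#[export] Set Implicit Arguments.
#[export] Unset Strict Implicit.
#[export] Unset Printing Implicit Defensive.

#[global] Open Scope classical_set_scope.
#[global] Open Scope ring_scope.

(* The one-point extension of a normed space.  It differs from the library's
   [one_point_compactification] in infinite dimension: neighborhoods of
   infinity are complements of closed *bounded* sets, not of compact ones. *)
Definition one_point_ext (E : Type) : Type := option E.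
Definition fin {E : Type} (x : E) : one_point_ext E := Some x.
Definition infty {E : Type} : one_point_ext E := None.

Section ExtendedTopology.
Context {R : realType} {E : normedModType R}.
Local Notation eE := (one_point_ext E).

HB.instance Definition _ := Choice.on eE.
HB.instance Definition _ := Pointed.on eE.

Definition extended_nbhs (x : eE) : set_system eE :=
  if x is Some x' then fin @ nbhs x' else
    filter_from [set C : set E | closed C /\ bounded_set C]
                (fun C => (fin @` (~` C)) `|` [set infty]).

Let extended_filter (x : eE) : ProperFilter (extended_nbhs x).
Proof.
case: x => [x|]; first exact: fmap_proper_filter.
apply: filter_from_proper; last by move=> ? _; exists infty; right.
apply: filter_from_filter.
  exists set0; split; first exact: closed0.
  by rewrite /mkset /bounded_near; near=> M.
move=> P Q [cloP bndP] [cloQ bndQ]; exists (P `|` Q).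
  split; first exact: closedU.
  move: bndP bndQ; rewrite /mkset /bounded_near => bndP bndQ.
  by near=> M => x [Px|Qx]; [apply: (near bndP M) | apply: (near bndQ M)].
case=> [x [|//]|[] //= _]; [|by split; right..].
by move=> [a /not_orP[Pa Qa]] [<-{x}]; split => //; left; exists a.
Unshelve. all: by end_near. Qed.

Let extended_singleton (x : eE) U : extended_nbhs x U -> U x.
Proof. by case: x => [x' /= /nbhs_singleton//|[W _]]; apply; right. Qed.

Let extended_nbhs_nbhs (p : eE) (A : set eE) :
  extended_nbhs p A -> extended_nbhs p (extended_nbhs^~ A).
Proof.
case: p => [r /=|].
  rewrite nbhs_simpl nbhsE => -[U [oU Ur] USA/=].
  by exists U => //= z /=; rewrite nbhs_simpl nbhsE => Uz; exists U.
case=> C [cloC bndC] nCA /=; exists C => // -[|_]; last by exists C.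
move=> x [|//] [y] /[swap] -[-> /=] nCx; rewrite nbhs_simpl nbhsE/=.
exists (~` C); first by split => //; exact: closed_openC.
by move=> z /= nCz; apply: nCA; left; exists z.
Qed.

HB.instance Definition _ := hasNbhs.Build eE extended_nbhs.

HB.instance Definition _ := @Nbhs_isNbhsTopological.Build eE
  extended_filter extended_singleton extended_nbhs_nbhs.

End ExtendedTopology.

Definition homeo_on (S T : topologicalType) (A : set S) (B : set T)
    (f : S -> T) : Prop :=
  [/\ f @` A = B, {within A, continuous f} &
      exists g : T -> S, {within B, continuous g} /\
                         (forall x, A x -> g (f x) = x)].

Definition halfline_homeo (R : realType) (phi : R -> R) : Prop :=
  homeo_on [set t : R | 0 <= t] [set t : R | 0 <= t] phi.

Definition dim_ge2 (R : realType) (E : normedModType R) : Prop :=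
  exists u v : E, forall a b : R, a *: u + b *: v = 0 -> a = 0 /\ b = 0.

Section Domains.
Context {R : realType} {E : normedModType R}.
Implicit Types (D : set E) (z : E) (gam : R -> E).

Definition domain D : Prop := [/\ open D, connected D & D !=set0].

Definition ext_closure D : set (one_point_ext E) := closure (fin @` D).

Definition ext_boundary D : set (one_point_ext E) :=
  closure (fin @` D) `\` interior (fin @` D).

(* Only finite boundary points contribute to the distance; there is at least
   one as soon as D is a domain different from E. *)
Definition bdist D z : R :=
  inf [set `|z - w| | w in fin @^-1` ext_boundary D].

(* The norm length, in [0, +oo], of the restriction of gam to [a, b]. *)
Definition path_length (a b : R) gam : \bar R :=
  ereal_sup [set (let F := gam \o nth b (a :: s) in
                  \sum_(0 <= n < size s) `|F n.+1 - F n|)%:E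
            | s in itv_partition a b].

(* An arc is parametrized injectively by an interval [0, b]; b = 0 gives the
   degenerate arc {z1}, the only one joining z1 to itself. *)
Definition rectifiable_arc D z1 z2 (b : R) gam : Prop :=
  [/\ 0 <= b,
      {within `[0, b], continuous gam},
      {in `[0, b] &, injective gam},
      (forall t, 0 <= t <= b -> D (gam t)) &
      [/\ gam 0 = z1, gam b = z2 & (path_length 0 b gam < +oo)%E]].

(* v = \int_gam rho |dz|, where gam0 is the parametrization of gam by
   arc length. *)
Definition is_arc_integral (rho : E -> R) (b : R) gam (v : R) : Prop :=
  exists gam0 : R -> E,
    (forall t, 0 <= t <= b -> gam0 (fine (path_length 0 t gam)) = gam t) /\
    v = \int[lebesgue_measure]_(s in `[0, fine (path_length 0 b gam)])
          rho (gam0 s).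

Definition qh_dist D z1 z2 : R :=
  inf [set v | exists b gam, rectifiable_arc D z1 z2 b gam /\
                 is_arc_integral (fun z => (bdist D z)^-1) b gam v].

Definition uniform_domain (c : R) D : Prop :=
  forall z1 z2, D z1 -> D z2 ->
    exists b gam, [/\ rectifiable_arc D z1 z2 b gam,
      (forall t, 0 <= t <= b ->
        (mine (path_length 0 t gam) (path_length t b gam)
           <= (c * bdist D (gam t))%:E)%E) &
      (path_length 0 b gam <= (c * `|z1 - z2|)%:E)%E].

End Domains.

Section Maps.
Context {R : realType} {E E' : normedModType R}.
Implicit Types (phi eta : R -> R) (h : E -> E').
Implicit Type f : one_point_ext E -> one_point_ext E'.

Definition solid phi (G : set E) (G' : set E') h : Prop :=
  homeo_on G G' h /\
  forall x y, G x -> G y ->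
    qh_dist G' (h x) (h y) <= phi (qh_dist G x y) /\
    qh_dist G x y <= phi (qh_dist G' (h x) (h y)).

Definition fqc phi (G : set E) (G' : set E') h : Prop :=
  homeo_on G G' h /\
  forall G1 : set E, domain G1 -> G1 `<=` G -> solid phi G1 (h @` G1) h.

Definition bilipschitz (L : R) (A : set E) h : Prop :=
  homeo_on A (h @` A) h /\
  forall x y, A x -> A y ->
    `|x - y| / L <= `|h x - h y| /\ `|h x - h y| <= L * `|x - y|.

Definition quasisymmetric eta (X : set E) h : Prop :=
  homeo_on X (h @` X) h /\
  forall x a b, X x -> X a -> X b -> x != a -> x != b -> a != b ->
    `|h a - h x| / `|h b - h x| <= eta (`|a - x| / `|b - x|).

(* On the finite points of A, f takes finite values, given by h. *)
Definition finite_restriction f (A : set (one_point_ext E)) h : Prop :=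
  forall x, A (fin x) -> f (fin x) = fin (h x).

(* As the norm distance to infinity is infinite, a map which is bilipschitz on
   a set that may contain infinity is one sending finite points to finite
   points in a bilipschitz way, and infinity to infinity. *)
Definition ext_bilipschitz (L : R) (A : set (one_point_ext E)) f : Prop :=
  (exists h, finite_restriction f A h /\ bilipschitz L (fin @^-1` A) h) /\
  (A infty -> f infty = infty).

Definition ext_quasisymmetric eta (A : set (one_point_ext E)) f : Prop :=
  exists h, finite_restriction f A h /\ quasisymmetric eta (fin @^-1` A) h.

Definition QC (L : R) phi (D : set E) (D' : set E') f : Prop :=
  [/\ homeo_on (ext_closure D) (ext_closure D') f,
      (exists h, finite_restriction f (fin @` D) h /\ fqc phi D D' h) &
      ext_bilipschitz L (ext_boundary D) f].

End Maps.

(* Main.v *)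
Require Import Defs.
From mathcomp Require Import lra ring zify.

(* Everything is done with the separation
   gsep_d x y = (|x - y| + d x + d y)^2 / (d x * d y), d being the distance to
   the complement; its logarithm is comparable to the quasihyperbolic metric of
   a uniform domain.  Uniform domains and their one-point punctures are joined
   by chains of Whitney-type steps whose number is logarithmic in gsep, and a
   fully solid map distorts gsep at most by a power on D and on all D \ {x}.
   By a discrete Gehring-Osgood theorem, images of minimal chains satisfy
   the cone condition, so the map coarsely preserves betweenness.
   For x in D, applying this to D \ {x} -> D' \ {f x}, of which x and f x are
   boundary points, turns |x - a| / |x - b| into a separation of fat points
   between x, a (resp. x, b) and a root point that is far from x, a and b in both
   domains.  The root is taken near infinity, which f fixes, in an unbounded
   domain, and near the center of a bounded one, where the bilipschitz
   boundary values compare the diameters of D and D'.  Thus powers of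
   the ratios in D are comparable, and continuity extends this to the closure. *)

(* Solidity of [f] on [D] alone compares points only at the scale of their distance to the
   complement. Puncturing at [x] makes [x] a boundary point, so that distances to [x] become visible
   at every scale; this is where solidity on all subdomains is used. The quasihyperbolic distance
   enters through two estimates, the logarithmic lower bound [qh_dist_ge] and the bound 1 of
   [qh_dist_le1] on half-size balls; together they say that the image of a step has bounded [gsep].
   Chains with the fewest steps replace geodesics, whose existence would need compactness, and
   dimension at least 2 is what lets a chain go round a puncture. Since [eta] may depend on [c], [L]
   and [phi] only, every constant is fixed before the spaces, domains and maps are introduced. Some
   normalization is unavoidable: the Moebius self-maps of a disk are uniformly solid on all
   subdomains but not uniformly quasisymmetric, because they push the center towards the boundary.
   Controlling the image of a root excludes this. *)
(* lra and lia slow down badly in large contexts. *)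
Tactic Notation "lra_from" hyp_list(hs) := clear - hs; lra.

Ltac natlia :=
  repeat match goal with
  | H : ?T |- _ => lazymatch T with
    | is_true (leq _ _) => fail
    | is_true (andb _ _) => fail
    | nat => fail
    | @eq nat _ _ => fail
    | _ => clear H
    end
  end; lia.

(** * Length of paths *)

Section PathLength.
Context {R : realType} {E : normedModType R}.
Implicit Types (gam : R -> E) (a b c d e f r t : R) (s : seq R).

Fixpoint polygon_length gam a s : R :=
  if s is x :: s' then `|gam x - gam a| + polygon_length gam x s' else 0.

Lemma polygon_lengthE gam a b s :
  (let F := gam \o nth b (a :: s) in
   \sum_(0 <= n < size s) `|F n.+1 - F n|) = polygon_length gam a s.
Proof.
elim: s a => [|x s IHs] a /=; first by rewrite big_geq.
by rewrite big_nat_recl//= -IHs.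
Qed.

Lemma polygon_length_cat gam a s (t : seq R) :
  polygon_length gam a (s ++ t) =
  polygon_length gam a s + polygon_length gam (last a s) t.
Proof.
by elim: s a => [|x s IHs] a /=; rewrite ?add0r// IHs addrA.
Qed.

Lemma polygon_length_ge gam a s :
  `|gam (last a s) - gam a| <= polygon_length gam a s.
Proof.
elim: s a => [|x s IHs] a /=; first by rewrite subrr normr0.
by have := ler_distD (gam x) (gam (last x s)) (gam a); have := IHs x; lra.
Qed.

Lemma polygon_length_ge0 gam a s : 0 <= polygon_length gam a s.
Proof. exact: le_trans (polygon_length_ge gam a s). Qed.

(** Making [c] a vertex can only lengthen the polygon. The cases in which [c] already is [a] or a
    vertex stand apart because the vertices of an [itv_partition] increase strictly. *)
Lemma polygon_length_split gam a b c s : a <= c -> c <= b ->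
  itv_partition a b s -> exists s1 s2, [/\ itv_partition a c s1,
    itv_partition c b s2 &
    polygon_length gam a s <= polygon_length gam a s1 + polygon_length gam c s2].
Proof.
elim: s a => [|x s IHs] a ac cb [/= pas /eqP lasb].
  have ca : c = a by apply/eqP; rewrite eq_le ac lasb cb.
  by exists [::], [::]; split; rewrite /itv_partition /= ?addr0// ?ca ?lasb eqxx.
move: pas => /andP[ax pxs].
have [cx|xc] := leP c x; last first.
  have [|s1 [s2 [[p1 l1] p2 le]]] := IHs x (ltW xc) cb; first by split=> //; exact/eqP.
  exists (x :: s1), s2; split=> //=; first by rewrite /itv_partition /= ax.
  by rewrite -addrA lerD2l.
move: ac; rewrite le_eqVlt => /predU1P[<-|ac].
  exists [::], (x :: s); rewrite /itv_partition/= ax pxs lasb !eqxx.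
  by split => //=; rewrite add0r.
move: cx; rewrite le_eqVlt => /predU1P[cx|cx].
  exists [:: c], s; rewrite /itv_partition/= ac cx pxs lasb eqxx.
  by split => //=; rewrite addr0.
exists [:: c], (x :: s); rewrite /itv_partition/= ac cx pxs lasb eqxx.
split => //=; rewrite addr0 addrA lerD2r addrC; exact: ler_distD.
Qed.

Lemma path_length_ub gam a b s : itv_partition a b s ->
  ((polygon_length gam a s)%:E <= path_length a b gam)%E.
Proof.
by move=> ps; apply: ereal_sup_ubound; exists s => //; rewrite polygon_lengthE.
Qed.

Lemma path_length_lub gam a b (M : \bar R) :
  (forall s, itv_partition a b s -> ((polygon_length gam a s)%:E <= M)%E) ->
  (path_length a b gam <= M)%E.
Proof.
by move=> H; apply: ge_ereal_sup => _ [s ps <-]; rewrite polygon_lengthE; exact: H.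
Qed.

Lemma itv_partition_ex a b : a <= b -> exists s, itv_partition a b s.
Proof.
rewrite le_eqVlt => /predU1P[->|ab]; first by exists [::]; split.
by exists [:: b]; exact: itv_partition1.
Qed.

Lemma itv_partition_catle a b c s (t : seq R) :
  itv_partition a b s -> itv_partition b c t -> itv_partition a c (s ++ t).
Proof.
move=> [ps /eqP ls] [pt /eqP lt]; split; first by rewrite cat_path ps ls.
by rewrite last_cat ls lt.
Qed.

Lemma path_length_ge gam a b : a <= b ->
  (`|gam b - gam a|%:E <= path_length a b gam)%E.
Proof.
move=> /itv_partition_ex[s ps]; apply: le_trans (path_length_ub gam ps).
by rewrite lee_fin; move: ps => [_ /eqP <-]; exact: polygon_length_ge.
Qed.

Lemma path_length_ge0 gam a b : a <= b -> (0 <= path_length a b gam)%E.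
Proof. by move=> /(path_length_ge gam); apply: le_trans; rewrite lee_fin. Qed.

Lemma path_lengthxx gam a : path_length a a gam = 0%E.
Proof.
apply/eqP; rewrite eq_le path_length_ge0// andbT; apply: path_length_lub => s.
by move=> /itv_partitionxx ->.
Qed.

Lemma path_length_leD gam a b c : a <= c -> c <= b ->
  (path_length a b gam <= path_length a c gam + path_length c b gam)%E.
Proof.
move=> ac cb; apply: path_length_lub => s ps.
have [s1 [s2 [p1 p2 le]]] := polygon_length_split gam ac cb ps.
apply: (@le_trans _ _ ((polygon_length gam a s1)%:E + (polygon_length gam c s2)%:E)%E).
  by rewrite -EFinD lee_fin.
by apply: leeD; exact: path_length_ub.
Qed.

Lemma path_length_sub gam a b c d : a <= c -> c <= d -> d <= b ->
  (path_length c d gam <= path_length a b gam)%E.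
Proof.
move=> ac cd db; apply: path_length_lub => s ps.
have [s1 ps1] := itv_partition_ex ac; have [s2 ps2] := itv_partition_ex db.
apply: le_trans (path_length_ub gam
  (itv_partition_catle ps1 (itv_partition_catle ps ps2))).
rewrite lee_fin !polygon_length_cat.
move: ps1 ps ps2 => [_ /eqP ->] [_ /eqP ->] _.
by have := polygon_length_ge0 gam a s1; have := polygon_length_ge0 gam d s2; lra.
Qed.

Definition arclen gam a b : R := fine (path_length a b gam).

Section Finite.
Variables (gam : R -> E) (a b : R).
Hypothesis fin_ab : (path_length a b gam < +oo)%E.

Lemma arclen_fin c d : a <= c -> c <= d -> d <= b ->
  path_length c d gam = (arclen gam c d)%:E.
Proof.
move=> ac cd db; rewrite /arclen fineK// ge0_fin_numE ?path_length_ge0//.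
by apply: le_lt_trans fin_ab; exact: path_length_sub.
Qed.

Lemma arclen_ub c d s : a <= c -> c <= d -> d <= b ->
  itv_partition c d s -> polygon_length gam c s <= arclen gam c d.
Proof. by move=> *; rewrite -lee_fin -arclen_fin//; exact: path_length_ub. Qed.

Lemma arclen_ge c d : a <= c -> c <= d -> d <= b ->
  `|gam d - gam c| <= arclen gam c d.
Proof. by move=> *; rewrite -lee_fin -arclen_fin//; exact: path_length_ge. Qed.

Lemma arclen_adh c d e : a <= c -> c <= d -> d <= b -> 0 < e ->
  exists2 s, itv_partition c d s & arclen gam c d - e < polygon_length gam c s.
Proof.
move=> ac cd db e0; apply: contrapT => H.
have : (path_length c d gam <= (arclen gam c d - e)%:E)%E.
  apply: path_length_lub => s ps; rewrite lee_fin leNgt; apply/negP => lt.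
  by apply: H; exists s.
by rewrite arclen_fin// lee_fin; lra.
Qed.

Lemma arclenD c d f : a <= c -> c <= d -> d <= f -> f <= b ->
  arclen gam c f = arclen gam c d + arclen gam d f.
Proof.
move=> ac cd df fb; have ad : a <= d by lra.
have cf : c <= f by lra. have db : d <= b by lra.
apply/eqP; rewrite eq_le; apply/andP; split.
  by rewrite -lee_fin EFinD -!arclen_fin//; exact: path_length_leD.
apply/ler_addgt0Pr => e e0; have e20 : 0 < e / 2 by rewrite divr_gt0.
have [s ps h1] := arclen_adh ac cd db e20.
have [t pt h2] := arclen_adh ad df fb e20.
have := arclen_ub ac cf fb (itv_partition_catle ps pt).
by rewrite polygon_length_cat; move: ps => [_ /eqP ->]; lra.
Qed.

Lemma arclenxx c : arclen gam c c = 0.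
Proof. by rewrite /arclen path_lengthxx. Qed.

(* Move the last vertex of an almost optimal polygon; the mirror statement
   moves the first one. *)
Lemma arclen_left_small c e : {within `[a, b], continuous gam} ->
  a < c -> c <= b -> 0 < e ->
  exists2 r, 0 < r & forall t, a <= t -> c - r < t -> t <= c ->
    arclen gam t c <= e.
Proof.
move=> cg ac cb e0; have e20 : 0 < e / 2 by rewrite divr_gt0.
have [s ps hs] := arclen_adh (lexx a) (ltW ac) cb e20.
have [r1 r10 hr1] : exists2 r, 0 < r & forall t, a <= t -> c - r < t -> t <= c ->
    `|gam c - gam t| < e / 2.
  have /subspace_continuousP/(_ c) := cg.
  rewrite /= in_itv/= (ltW ac) cb => /(_ isT)/cvgrPdist_lt/(_ _ e20).
  rewrite near_withinE => -[r /= r0 H]; exists r => // t at_ ct tc.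
  apply: H; rewrite /= ?in_itv/= ?at_ ?(le_trans tc)// ger0_norm; lra.
move: ps hs => [+ /eqP]; case: (lastP s) => [|s' x]; first by move=> /= _ ?; lra.
rewrite rcons_path last_rcons => /andP[ps' lx] xc; rewrite xc in lx *.
move=> hs; exists (Num.min r1 (c - last a s')).
  by rewrite lt_min r10 /=; lra.
move=> t at_ /[swap] tc; rewrite ltrBlDl -ltrBlDr lt_min => /andP[h1 h2].
have ptc : itv_partition a t (rcons s' t).
  by split; rewrite ?rcons_path ?ps' ?last_rcons ?eqxx//=; lra.
have := arclen_ub (lexx a) at_ (le_trans tc cb) ptc.
rewrite (@arclenD a t c)// ?lexx// in hs.
move: hs; rewrite -!cats1 !polygon_length_cat/= !addr0.
have := hr1 t at_ ltac:(lra) tc.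
have := ler_distD (gam t) (gam c) (gam (last a s')).
by lra.
Qed.

Lemma arclen_right_small c e : {within `[a, b], continuous gam} ->
  a <= c -> c < b -> 0 < e ->
  exists2 r, 0 < r & forall t, c <= t -> t < c + r -> t <= b ->
    arclen gam c t <= e.
Proof.
move=> cg ac cb e0; have e20 : 0 < e / 2 by rewrite divr_gt0.
have [s ps hs] := arclen_adh ac (ltW cb) (lexx b) e20.
have [r1 r10 hr1] : exists2 r, 0 < r & forall t, c <= t -> t < c + r -> t <= b ->
    `|gam c - gam t| < e / 2.
  have /subspace_continuousP/(_ c) := cg.
  rewrite /= in_itv/= (ltW cb) ac => /(_ isT)/cvgrPdist_lt/(_ _ e20).
  rewrite near_withinE => -[r /= r0 H]; exists r => // t ct tc tb.
  apply: H; rewrite /= ?in_itv/= ?tb ?(le_trans ac)// ler0_norm; lra.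
move: ps hs => [+ /eqP]; case: s => [|x s]; first by move=> /= _ ?; lra.
move=> /= /andP[cx ps] lb hs; exists (Num.min r1 (x - c)).
  by rewrite lt_min r10 /=; lra.
move=> t ct /[swap] tb; rewrite -ltrBlDl lt_min => /andP[h1 h2].
have ptc : itv_partition t b (x :: s).
  by split; rewrite /= ?lb ?eqxx ?ps ?andbT//; lra.
have := arclen_ub (le_trans ac ct) tb (lexx b) ptc.
rewrite (@arclenD c t b)// ?lexx// in hs.
move: hs => /=.
have := hr1 t ct ltac:(lra) tb.
have := ler_distD (gam t) (gam x) (gam c); rewrite (distrC (gam t)).
by lra.
Qed.

(** With the intermediate value theorem it makes arc length run over the whole interval from 0 to
    the total length, so that [gam0] in [is_arc_integral] is determined there. *)
Lemma arclen_continuous : {within `[a, b], continuous gam} ->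
  {within `[a, b], continuous (arclen gam a)}.
Proof.
move=> cg; apply/subspace_continuousP => c /=; rewrite in_itv/= => /andP[ac cb].
apply/cvgrPdist_le => e e0; rewrite near_withinE.
have [r1 r10 H1] : exists2 r, 0 < r & forall t, a <= t -> c - r < t -> t <= c ->
    arclen gam t c <= e.
  move: ac; rewrite le_eqVlt => /predU1P[<-|ac]; last exact: arclen_left_small.
  by exists 1 => // t at_ _ ta; rewrite (_ : t = a) ?arclenxx; lra.
have [r2 r20 H2] : exists2 r, 0 < r & forall t, c <= t -> t < c + r -> t <= b ->
    arclen gam c t <= e.
  move: cb; rewrite le_eqVlt => /predU1P[->|cb]; last exact: arclen_right_small.
  by exists 1 => // t at_ _ ta; rewrite (_ : t = b) ?arclenxx; lra.
exists (Num.min r1 r2); first by rewrite /= lt_min r10.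
move=> t /=; rewrite lt_min => /andP[h1 h2]; rewrite in_itv/= => /andP[at_ tb].
rewrite /from_subspace; have [tc|ct] := leP t c.
  rewrite (@arclenD a t c)// addrAC subrr add0r ger0_norm.
    by apply: H1 => //; move: h1; rewrite ger0_norm; lra.
  by apply: le_trans (arclen_ge at_ tc cb); rewrite normr_ge0.
have ct' := ltW ct.
rewrite (@arclenD a c t)// opprD addrA subrr add0r normrN ger0_norm.
  by apply: H2 => //; move: h2; rewrite ler0_norm; lra.
by apply: le_trans (arclen_ge ac ct' tb); rewrite normr_ge0.
Qed.

Lemma arclen_surj (v : R) : {within `[a, b], continuous gam} -> a <= b ->
  0 <= v -> v <= arclen gam a b -> exists2 t, a <= t <= b & arclen gam a t = v.
Proof.
move=> cg ab s0 sb.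
have [|t] := IVT ab (arclen_continuous cg) (v := v).
  by rewrite arclenxx min_l ?max_r ?s0 ?sb //; exact: le_trans sb.
by rewrite in_itv/= => ? ?; exists t.
Qed.

End Finite.
End PathLength.

(** * Distance to the complement *)

Section DistanceToComplement.
Context {R : realType} {E : normedModType R}.
Implicit Types (G D : set E) (x y z u v w : E) (e r s t : R).

(** Unlike [bdist] it refers to no boundary: for a proper subset it is 1-Lipschitz on the whole
    space and vanishes off [G]. At points of a proper open set the two agree, by [bdistE]. *)
Definition dcomp G z : R := inf [set `|z - w| | w in ~` G].

Lemma dcomp_lb G z : has_lbound [set `|z - w| | w in ~` G].
Proof. by exists 0 => _ [w _ <-]. Qed.

Lemma dcomp_le G z w : ~ G w -> dcomp G z <= `|z - w|.
Proof. by move=> Gw; apply: ge_inf; [exact: dcomp_lb|exists w]. Qed.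

Lemma dcomp_ge G z r : ~` G !=set0 -> (forall w, ~ G w -> r <= `|z - w|) ->
  r <= dcomp G z.
Proof.
move=> [w0 Gw0] H; apply: lb_le_inf; first by exists `|z - w0|, w0.
by move=> _ [w Gw <-]; exact: H.
Qed.

Lemma dcomp_ge0 G z : ~` G !=set0 -> 0 <= dcomp G z.
Proof. by move=> nG; exact: dcomp_ge. Qed.

Lemma dcomp_lip G x y : ~` G !=set0 -> dcomp G x <= dcomp G y + `|x - y|.
Proof.
move=> nG; rewrite -lerBlDr; apply: dcomp_ge => // w Gw.
by have := dcomp_le x Gw; have := ler_distD y x w; lra.
Qed.

Lemma dcomp_ball G z w : `|z - w| < dcomp G z -> G w.
Proof.
by move=> lt; apply: contrapT => Gw; have := dcomp_le z Gw; lra.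
Qed.

Lemma dcomp_out G z : ~ G z -> dcomp G z = 0.
Proof.
move=> Gz; apply/eqP; rewrite eq_le dcomp_ge0 ?andbT; last by exists z.
by have := dcomp_le z Gz; rewrite subrr normr0.
Qed.

Lemma dcomp_gt0 G z : open G -> G z -> ~` G !=set0 -> 0 < dcomp G z.
Proof.
move=> oG Gz nG; have /nbhs_ballP[e /= e0 H] := open_nbhs_nbhs (conj oG Gz).
apply: lt_le_trans e0 _; apply: dcomp_ge => // w Gw; rewrite leNgt.
by apply/negP => lt; apply: Gw; apply: H; rewrite -ball_normE.
Qed.

Lemma dcomp_continuous G : ~` G !=set0 -> continuous (dcomp G).
Proof.
move=> nG x; apply/cvgrPdist_lt => e e0; near=> y.
have h : `|x - y| < e by near: y; exact: cvgr_dist_lt.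
have := dcomp_lip x y nG; have := dcomp_lip y x nG; rewrite (distrC y).
by rewrite ltr_norml; move=> *; apply/andP; split; lra.
Unshelve. all: by end_near. Qed.

Lemma ext_closure_fin D w : ext_closure D (fin w) <-> closure D w.
Proof.
split=> [cl B Bw|cl B].
- have [|_ [[y Dy <-] [b Bb /= [by_]]]] := cl (fin @` B).
    by rewrite /nbhs /= /nbhs /=; apply: filterS Bw => y By; exists y.
  by exists b; rewrite by_ in Bb *.
- rewrite /nbhs /= /nbhs /= => /cl[y [Dy By]].
  by exists (fin y); split => //; exists y.
Qed.

Lemma ext_boundary_fin D w : open D ->
  ext_boundary D (fin w) <-> closure D w /\ ~ D w.
Proof.
move=> oD; rewrite /ext_boundary; split.
- move=> [/ext_closure_fin cl ni]; split => // Dw; apply: ni.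
  rewrite /interior /= /nbhs /= /nbhs /=.
  by apply: filterS (open_nbhs_nbhs (conj oD Dw)) => y Dy; exists y.
- move=> [cl nD]; split; first exact/ext_closure_fin.
  by move=> /nbhs_singleton [y Dy [yw]]; apply: nD; rewrite -yw.
Qed.

(** The time is the infimum of all exit times: openness of [D] keeps the point at this time outside,
    and earlier times approach it from inside. *)
Lemma ray_exit D z v (s1 : R) : open D -> D z -> 0 <= s1 -> ~ D (z + s1 *: v) ->
  exists t, [/\ 0 < t <= s1, (forall s, 0 <= s -> s < t -> D (z + s *: v)),
    ~ D (z + t *: v) & closure D (z + t *: v)].
Proof.
move=> oD Dz s10 nD.
pose S := [set s : R | 0 <= s /\ ~ D (z + s *: v)].
have Sinf : has_inf S by split; [exists s1|exists 0 => s []].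
have Slb s : S s -> inf S <= s by move=> Ss; apply: ge_inf => //; case: Sinf.
have t0 : 0 <= inf S by apply: lb_le_inf; [case: Sinf|move=> s []].
have below s : 0 <= s -> s < inf S -> D (z + s *: v).
  by move=> s0 st; apply: contrapT => nDs; have := Slb s (conj s0 nDs); lra.
have cont : continuous (fun s : R => z + s *: v).
  move=> s; apply: cvgD; first exact: cvg_cst.
  by apply: cvgZr_tmp => //; exact: cvg_cst.
have nDt : ~ D (z + inf S *: v).
  move=> Dt; have /cont/nbhs_ballP[e /= e0 H] := open_nbhs_nbhs (conj oD Dt).
  have [s [s0 nDs] lt] := inf_adherent e0 Sinf.
  have le := Slb s (conj s0 nDs); apply: nDs; apply: H; rewrite -ball_normE /=.
  move: le; rewrite le_eqVlt => /predU1P[->|]; first by rewrite subrr normr0.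
  by move=> ?; rewrite ltr0_norm; lra.
have tpos : 0 < inf S.
  by rewrite lt_neqAle t0 andbT; apply/eqP => te; apply: nDt; rewrite -te scale0r addr0.
exists (inf S); split => //; first by rewrite tpos /=; apply: Slb.
move=> B /cont/nbhs_ballP[e /= e0 H].
have m0 : 0 < Num.min (e / 2) (inf S) by rewrite lt_min tpos divr_gt0.
have me : Num.min (e / 2) (inf S) <= e / 2 by rewrite ge_min lexx.
have mt : Num.min (e / 2) (inf S) <= inf S by rewrite ge_min lexx orbT.
exists (z + (inf S - Num.min (e / 2) (inf S)) *: v); split.
  by apply: below; lra.
by apply: H; rewrite -ball_normE /= ger0_norm; lra.
Qed.

(** A point outside [D] is at least as far from [z] as the first exit of the segment towards it, and
    that exit is a boundary point. *)
Lemma bdistE D z : open D -> D z -> ~` D !=set0 -> bdist D z = dcomp D z.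
Proof.
move=> oD Dz nD; apply/eqP; rewrite eq_le; apply/andP; split.
  apply: dcomp_ge => // w Dw.
  have [|t [/andP[t0 t1] _ nDt clt]] := @ray_exit D z (w - z) 1 oD Dz ler01.
    by rewrite scale1r addrC subrK.
  apply: (@le_trans _ _ `|z - (z + t *: (w - z))|).
    apply: ge_inf; first by exists 0 => _ [? _ <-].
    by exists (z + t *: (w - z)) => //=; apply/ext_boundary_fin.
  rewrite opprD addrA subrr add0r normrN normrZ gtr0_norm// distrC.
  by rewrite ler_piMl.
apply: lb_le_inf.
  have [w Dw] := nD.
  have [|t [/andP[t0 t1] _ nDt clt]] := @ray_exit D z (w - z) 1 oD Dz ler01.
    by rewrite scale1r addrC subrK.
  exists `|z - (z + t *: (w - z))|, (z + t *: (w - z)) => //.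
  exact/ext_boundary_fin.
by move=> _ [w /= /ext_boundary_fin [] // _ Dw <-]; exact: dcomp_le.
Qed.

End DistanceToComplement.

(** * Joining points by arcs *)

Section Arcs.
Context {R : realType} {E : normedModType R}.
Implicit Types (G D : set E) (x y z u v w : E) (a b c d e r s t : R) (gam : R -> E).

Lemma path_length_lip gam a b k : a <= b ->
  (forall s t, a <= s -> s <= t -> t <= b -> `|gam t - gam s| <= k * (t - s)) ->
  (path_length a b gam <= (k * (b - a))%:E)%E.
Proof.
move=> ab H; apply: path_length_lub => s; rewrite lee_fin.
elim: s a ab H => [|x s IHs] a ab H [/= ps /eqP lb].
  by have := H a b (lexx a) ab (lexx b); rewrite lb subrr normr0.
have [ax pxs] := andP ps.
have xb : x <= b by apply: (@itv_partition_le _ _ x b s); split=> //; exact/eqP.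
have := IHs x xb (fun s t xs => H s t (le_trans (ltW ax) xs)) ltac:(by split=> //; exact/eqP).
by have := H a x (lexx a) (ltW ax) xb; lra.
Qed.

Lemma eq_path_length gam1 gam2 a b : a <= b ->
  (forall t, a <= t -> t <= b -> gam1 t = gam2 t) ->
  path_length a b gam1 = path_length a b gam2.
Proof.
move=> ab H.
have P g1 g2 : (forall t, a <= t -> t <= b -> g1 t = g2 t) ->
    (path_length a b g1 <= path_length a b g2)%E.
  move=> H12; apply: path_length_lub => s ps.
  rewrite (_ : polygon_length g1 a s = polygon_length g2 a s).
    exact: path_length_ub.
  elim: s a ab H12 ps {H} => [//|x s IHs] a ab H12 [/= ps /eqP lb].
  have [ax pxs] := andP ps.
  have pxs' : itv_partition x b s by split => //; exact/eqP.
  have xb := itv_partition_le pxs'.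
  rewrite (IHs x) // ?H12 // ?ltW// => t xt; apply: H12; exact: le_trans (ltW ax) xt.
by apply/eqP; rewrite eq_le !P// => t at_ tb; rewrite H.
Qed.

Lemma within_itv_nbhs gam a b c (B : set E) :
  {within `[a, b], continuous gam} -> a <= c <= b -> nbhs (gam c) B ->
  exists2 r, 0 < r & forall t, a <= t <= b -> `|c - t| < r -> B (gam t).
Proof.
move=> /subspace_continuousP/(_ c); rewrite /= in_itv/= => H cab /(H cab).
rewrite /from_subspace /within => -[r /= r0 Hr]; exists r => // t tab ct.
by apply: Hr => //=; rewrite in_itv.
Qed.

Lemma lip1_continuous (f : R -> R) :
  (forall s t, `|f s - f t| <= `|s - t|) -> continuous f.
Proof.
move=> H x; apply/cvgrPdist_lt => e e0; near=> y; apply: le_lt_trans (H _ _) _.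
by near: y; exact: cvgr_dist_lt.
Unshelve. all: by end_near. Qed.

Definition arc_joined D x y : Prop := exists b gam, rectifiable_arc D x y b gam.

Lemma arc_joined_refl D x : D x -> arc_joined D x x.
Proof.
move=> Dx; exists 0, (fun=> x); split=> //.
- by move=> ?; exact: cvg_cst.
- by move=> s t; rewrite !in_itv/= => /andP[? ?] /andP[? ?] _; lra.
- by split=> //; rewrite path_lengthxx ltry.
Qed.

(* Cut the arc at its first point on the segment [z, y]. *)
Lemma arc_joined_segment D x z y : arc_joined D x z ->
  (forall s, 0 <= s <= 1 -> D (z + s *: (y - z))) -> arc_joined D x y.
Proof.
move=> [b [gam [b0 cg ig Dg [g0 gb fin_len]]]] Dseg.
pose K := [set z + s *: (y - z) | s in `[0, 1]%classic].
pose S := [set t : R | 0 <= t <= b /\ K (gam t)].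
have cseg : continuous (fun s : R => z + s *: (y - z)).
  move=> s; apply: cvgD; first exact: cvg_cst.
  by apply: cvgZr_tmp => //; exact: cvg_cst.
have clK : closed K.
  apply: compact_closed; first exact: norm_hausdorff.
  apply: continuous_compact; last exact: segment_compact.
  by apply: continuous_subspaceT.
have Kz : K z by exists 0; rewrite ?scale0r ?addr0//= in_itv/= lexx ler01.
have Sb : S b by split; rewrite ?gb// b0 lexx.
have Sinf : has_inf S by split; [exists b|exists 0 => s [] /andP[]].
have Slb s : S s -> inf S <= s by move=> Ss; apply: ge_inf => //; case: Sinf.
have t0 : 0 <= inf S by apply: lb_le_inf; [case: Sinf|move=> s [] /andP[]].
have tb : inf S <= b by exact: Slb.
have Kt : K (gam (inf S)).
  apply: contrapT => nK.
  have oK : open (~` K) by exact: closed_openC.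
  have [|e e0 H] := within_itv_nbhs cg _ (open_nbhs_nbhs (conj oK nK)).
    by rewrite t0 tb.
  have [s Ss lt] := inf_adherent e0 Sinf; have le := Slb s Ss.
  case: (Ss) => sb Ks; apply: (H s) Ks => //.
  by move: le; rewrite /= le_eqVlt => /predU1P[->|?]; rewrite ?subrr ?normr0// ltr0_norm; lra.
have below s : 0 <= s -> s < inf S -> ~ K (gam s).
  move=> s0 st Ks; have sb : 0 <= s <= b by rewrite s0; lra.
  by have := Slb s (conj sb Ks); lra.
set t1 := inf S in t0 tb Kt below; clearbody t1.
case: Kt => s1; rewrite /= in_itv/= => /andP[s10 s11] pE.
have fin1 : (path_length 0 t1 gam < +oo)%E.
  by apply: le_lt_trans fin_len; exact: path_length_sub.
have [py|py] := eqVneq (gam t1) y.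
  exists t1, gam; split=> //.
  - by apply: continuous_subspaceW cg; apply: subset_itvl; rewrite bnd_simp.
  - by move=> s t; rewrite !in_itv/= => /andP[? ?] /andP[? ?]; apply: ig; rewrite in_itv/=; lra.
  - by move=> t /andP[? ?]; apply: Dg; lra.
(* Truncating the parameter glues the arc up to [t1] and the rest of the segment in one formula,
   continuous without cases. Injectivity survives because the arc avoids [K] before [t1] and the new
   part stays in [K] ([Kr]). *)
pose p := gam t1; pose mn t := Num.min t t1; pose mx t := Num.max 0 (t - t1).
pose g2 t := gam (mn t) + mx t *: (y - p).
have g2l t : t <= t1 -> g2 t = gam t.
  by move=> tt1; rewrite /g2 /mn /mx min_l// max_l ?scale0r ?addr0//; lra_from tt1.
have g2r t : t1 <= t -> g2 t = p + (t - t1) *: (y - p).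
  by move=> tt1; rewrite /g2 /mn /mx min_r// max_r//; lra_from tt1.
have mn_lip s t : `|mn s - mn t| <= `|s - t|.
  rewrite /mn; have [?|?] := leP s t1; have [?|?] := leP t t1;
  rewrite ?subrr ?normr0 // ler_normr !ler_norml; lra.
have mx_lip s t : `|mx s - mx t| <= `|s - t|.
  rewrite /mx; have [?|?] := leP 0 (s - t1); have [?|?] := leP 0 (t - t1);
  rewrite ?subrr ?normr0 // ler_normr !ler_norml; lra.
have Kr t : t1 <= t -> t <= t1 + 1 -> K (g2 t).
  move=> h1 h2; rewrite g2r// /p -pE; exists (s1 + (t - t1) * (1 - s1)).
    by rewrite /= in_itv/=; nra.
  rewrite scalerDl -addrA; congr (_ + (_ + _)).
  by rewrite -scalerA; congr (_ *: _); rewrite scalerBl scale1r opprD addrA.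
have t11 : t1 <= t1 + 1 by lra_from.
exists (t1 + 1), g2; split=> //.
- by lra_from t0.
- have -> : g2 = (fun t => (gam \o mn) t + mx t *: (y - p)) by [].
  apply/subspace_continuousP => t /=; rewrite in_itv/= => /andP[h1 h2].
  apply: cvgD.
  + move=> B nB; have [|r r0 H] := @within_itv_nbhs gam 0 b (mn t) B cg _ nB.
      by rewrite /mn le_min ge_min; lra_from t0 tb h1.
    exists r => // u /= ut; rewrite in_itv/= => /andP[u0 u1]; apply: H.
      by rewrite /mn le_min ge_min; lra_from t0 tb u0.
    exact: le_lt_trans (mn_lip _ _) ut.
  + apply: cvgZr_tmp.
    by apply: cvg_within_filter; exact: lip1_continuous mx_lip t.
- move=> s t; rewrite !in_itv/=.
  wlog st : s t / s <= t => [W|].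
    move=> hs ht; have [st|ts] := leP s t; first exact: W.
    by move=> /esym e; apply/esym; apply: W => //; exact: ltW.
  move=> /andP[s0 s2] /andP[t0' t2].
  have [tt1|t1t] := leP t t1.
    by rewrite !g2l ?(le_trans st)//; apply: ig; rewrite in_itv/=; lra_from tb st s0 tt1.
  have [t1s|st1] := leP t1 s.
    rewrite !g2r // ?ltW// => /addrI /eqP.
    rewrite -subr_eq0 -scalerBl scaler_eq0 => /orP[/eqP ?|]; first lra.
    by rewrite subr_eq0 eq_sym (negPf py).
  move=> e; case: (below s) => //; rewrite -(g2l s) ?ltW// e; apply: Kr => //.
  exact: ltW.
- move=> t /andP[t0' t2]; have [tt1|t1t] := leP t t1.
    by rewrite g2l//; apply: Dg; lra_from tb t0' tt1.
  have [u /=] := Kr t (ltW t1t) t2.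
  by rewrite in_itv/= => u01 <-; exact: Dseg.
- split; first by rewrite g2l.
    by rewrite g2r// addrAC subrr add0r scale1r addrC subrK.
  apply: le_lt_trans (path_length_leD g2 t0 t11) _.
  rewrite lte_add_pinfty//.
    by rewrite (eq_path_length (gam2 := gam))// => t _ ?; exact: g2l.
  apply: le_lt_trans (@path_length_lip g2 t1 (t1 + 1) `|y - p| _ _) _ => //.
    move=> s t h1 h2 h3; rewrite (g2r _ h1) (g2r _ (le_trans h1 h2)).
    have -> : p + (t - t1) *: (y - p) - (p + (s - t1) *: (y - p)) = (t - s) *: (y - p).
      rewrite opprD addrACA subrr add0r -scalerBl; congr (_ *: _).
      by rewrite opprB addrA subrK.
    by rewrite normrZ ger0_norm ?subr_ge0// mulrC.
  exact: ltry.
Qed.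

End Arcs.

(** * Quasihyperbolic distance *)

Section QuasihyperbolicDistance.
Context {R : realType} {E : normedModType R}.
Implicit Types (G D : set E) (p q x y z u v w : E) (a b c d e r s t : R) (gam : R -> E).

(** By [arclen_surj] every number in the interval is an arc length, so the condition on [gam0]
    determines it there; a chord is no longer than its piece of arc, whence the Lipschitz bound. *)
Lemma arclength_param D p q b gam gam0 : rectifiable_arc D p q b gam ->
  (forall t, 0 <= t <= b -> gam0 (fine (path_length 0 t gam)) = gam t) ->
  [/\ 0 <= arclen gam 0 b, gam0 0 = p, gam0 (arclen gam 0 b) = q,
      (forall s, 0 <= s <= arclen gam 0 b -> D (gam0 s)) &
      (forall s t, 0 <= s <= arclen gam 0 b -> 0 <= t <= arclen gam 0 b ->
        `|gam0 s - gam0 t| <= `|s - t|)].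
Proof.
move=> [b0 cg ig Dg [g0 gb fin_len]] H0.
split.
- by apply: le_trans (arclen_ge fin_len (lexx 0) b0 (lexx b)).
- by have := H0 0; rewrite lexx b0 path_lengthxx g0 => ->.
- by rewrite H0 ?b0 ?lexx.
- move=> s /andP[s0 sl]; have [t /andP[t0 tb] <-] := arclen_surj fin_len cg b0 s0 sl.
  by rewrite H0 ?t0//; apply: Dg; rewrite t0.
- move=> s t; wlog st : s t / s <= t => [W|].
    move=> hs ht; have [st|ts] := leP s t; first exact: W.
    by rewrite distrC (distrC s); apply: W => //; exact: ltW.
  move=> /andP[s0 sl] /andP[t0 tl].
  have [t1 /andP[t10 t1b] <-] := arclen_surj fin_len cg b0 s0 sl.
  have [t2 /andP[t20 t2b] t2E] := arclen_surj fin_len cg b0 t0 tl.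
  have [t12|t21] := leP t1 t2.
    rewrite -t2E !H0 ?t10 ?t20// (arclenD fin_len (lexx 0) t10 t12 t2b).
    rewrite opprD addrA subrr add0r normrN distrC.
    have := arclen_ge fin_len t10 t12 t2b.
    by move=> h; apply: (le_trans h); exact: ler_norm.
  have h := arclen_ge fin_len t20 (ltW t21) t1b.
  rewrite -t2E !H0 ?t10 ?t20// (arclenD fin_len (lexx 0) t20 (ltW t21) t1b).
  by rewrite addrAC subrr add0r; apply: (le_trans h); exact: ler_norm.
Qed.

(** Any parameter with the given arc length may be chosen: two of them bound a piece of length 0,
    whose ends coincide. *)
Lemma arclength_param_ex D p q b gam : rectifiable_arc D p q b gam ->
  exists gam0 : R -> E,
    forall t, 0 <= t <= b -> gam0 (fine (path_length 0 t gam)) = gam t.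
Proof.
move=> [b0 cg ig Dg [g0 gb fin_len]].
exists (fun s => gam (xget 0 [set t | 0 <= t <= b /\ arclen gam 0 t = s])).
move=> t tb; have [t' /= _ [t'b e]|/(_ t)] := xgetP; last by case.
suff : forall t1 t2, 0 <= t1 <= b -> 0 <= t2 <= b -> t1 <= t2 ->
    arclen gam 0 t1 = arclen gam 0 t2 -> gam t1 = gam t2.
  move=> W; have [tt'|t't] := leP t t'; first by rewrite (W t t').
  by rewrite (W t' t)// ltW.
move=> t1 t2 /andP[t10 t1b] /andP[t20 t2b] t12.
rewrite (arclenD fin_len (lexx 0) t10 t12 t2b) => h.
have := arclen_ge fin_len t10 t12 t2b.
rewrite (_ : arclen gam t1 t2 = 0); last by lra.
by rewrite normr_le0 subr_eq0 => /eqP.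
Qed.

Lemma lip_within (l : R) (gam0 : R -> E) :
  (forall s t, 0 <= s <= l -> 0 <= t <= l -> `|gam0 s - gam0 t| <= `|s - t|) ->
  {within `[0, l], continuous gam0}.
Proof.
move=> H; apply/subspace_continuousP => t /=; rewrite in_itv/= => tl.
apply/cvgrPdist_lt => e e0; rewrite near_withinE; exists e => // s /= se.
rewrite in_itv/= => sl; exact: le_lt_trans (H t s tl sl) se.
Qed.

Lemma density_integrable G (l : R) (gam0 : R -> E) : open G -> ~` G !=set0 ->
  (forall s, 0 <= s <= l -> G (gam0 s)) ->
  (forall s t, 0 <= s <= l -> 0 <= t <= l -> `|gam0 s - gam0 t| <= `|s - t|) ->
  lebesgue_measure.-integrable `[0, l] (EFin \o (fun s => (bdist G (gam0 s))^-1)).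
Proof.
move=> oG nG Gg lip; apply: continuous_compact_integrable.
  exact: segment_compact.
have cg := lip_within lip.
have E1 : {in `[0, l]%classic, (fun s => (dcomp G (gam0 s))^-1) =1
    (fun s => (bdist G (gam0 s))^-1)}.
  by move=> s; rewrite inE /= in_itv/= => sl; rewrite bdistE//; exact: Gg.
apply/subspace_continuousP => t /=; rewrite in_itv/= => tl.
have /subspace_continuousP H : {within `[0, l], continuous (fun s => (dcomp G (gam0 s))^-1)}.
  apply/subspace_continuousP => s /=; rewrite in_itv/= => sl.
  apply: cvgV; first by rewrite gt_eqF// dcomp_gt0//; exact: Gg.
  apply: continuous_cvg; first exact: dcomp_continuous.
  by move/subspace_continuousP : cg; apply; rewrite /= in_itv.
rewrite {2}/from_subspace -(E1 t); last by rewrite inE /= in_itv.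
apply: cvg_trans (H t _); last by rewrite /= in_itv.
apply: near_eq_cvg; rewrite near_withinE; near=> s => sl.
by rewrite /from_subspace E1// inE.
Unshelve. all: by end_near. Qed.

Lemma integral_inv_shift (d l : R) : 0 < d -> 0 < l ->
  \int[lebesgue_measure]_(s in `[0, l]) (d + s)^-1 = ln (d + l) - ln d.
Proof.
move=> d0 l0; rewrite /Rintegral.
have dF (x : R) : 0 <= x -> is_derive x 1 (fun s => ln (d + s)) (d + x)^-1.
  move=> x0; have dx : 0 < d + x by lra.
  have := @is_derive1_comp _ (@ln R) (fun s => d + s) x _ _
    (is_derive1_ln dx) (is_deriveD (is_derive_cst d x 1) (is_derive_id x 1)).
  by rewrite add0r mulr1.
have cF (x : R) : 0 <= x -> {for x, continuous (fun s => ln (d + s))}.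
  move=> x0; apply: differentiable_continuous; apply/derivable1_diffP.
  by have [] := dF x x0.
rewrite (@continuous_FTC2 _ _ (fun s => ln (d + s)))//=.
- by rewrite addr0.
- apply: continuous_in_subspaceT => x; rewrite inE/= in_itv/= => /andP[x0 _].
  apply: cvgV; first by rewrite gt_eqF//; lra.
  by apply: cvgD; [exact: cvg_cst|exact: cvg_id].
- split => [x||].
  + by rewrite in_itv/= => /andP[x0 _]; have [] := dF x (ltW x0).
  + by apply: cvg_at_right_filter; exact: cF.
  + by apply: cvg_at_left_filter; apply: cF; exact: ltW.
- move=> x; rewrite in_itv/= => /andP[x0 _]; rewrite derive1E.
  by have [_ ] := dF x (ltW x0).
Qed.

(** At arc length [s] the distance to the complement is at most [dcomp G p + s], so the integral is
    at least that of [(dcomp G p + s)^-1]. The assumption [arc_joined] keeps [inf] off the empty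
    set, where its value would be 0. *)
Lemma qh_dist_ge G p q : open G -> ~` G !=set0 -> arc_joined G p q ->
  ln (1 + `|p - q| / dcomp G p) <= qh_dist G p q.
Proof.
move=> oG nG [b1 [gam1 arc1]]; have [gm hgm] := arclength_param_ex arc1.
apply: lb_le_inf.
  by exists (\int[lebesgue_measure]_(s in `[0, fine (path_length 0 b1 gam1)])
          (bdist G (gm s))^-1), b1, gam1; split => //; exists gm.
move=> _ [b [gam [arc [g0 [H ->]]]]].
have [l0 gp gq Gg lip] := arclength_param arc H.
rewrite -/(arclen gam 0 b); set l := arclen gam 0 b in l0 gp gq Gg lip *.
have Gp : G p by rewrite -gp; apply: Gg; rewrite lexx.
have dp := dcomp_gt0 oG Gp nG.
have pql : `|p - q| <= l.
  rewrite -gp -gq; apply: le_trans (lip _ _ _ _) _; rewrite ?lexx ?l0//.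
  by rewrite sub0r normrN ger0_norm.
have [l0'|{}l0] := leP l 0.
  have -> : p = q by apply/eqP; rewrite -subr_eq0 -normr_le0; lra.
  rewrite subrr normr0 mul0r addr0 ln1.
  apply: Rintegral_ge0 => s; rewrite /= in_itv/= => sl.
  by rewrite invr_ge0 bdistE ?dcomp_ge0//; exact: Gg.
apply: (@le_trans _ _ (ln (dcomp G p + l) - ln (dcomp G p))).
  rewrite -ln_div ?posrE//; last by lra.
  rewrite ler_ln ?posrE; last 2 first.
  - by rewrite ltr_pwDl// divr_ge0// ltW.
  - by rewrite divr_gt0//; lra.
  by rewrite mulrDl divff ?gt_eqF// lerD2l ler_pM2r// invr_gt0.
rewrite -integral_inv_shift//; apply: le_Rintegral => //.
- apply: continuous_compact_integrable; first exact: segment_compact.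
  apply: continuous_in_subspaceT => x; rewrite inE/= in_itv/= => /andP[x0 _].
  apply: cvgV; first by rewrite gt_eqF//; lra.
  by apply: cvgD; [exact: cvg_cst|exact: cvg_id].
- exact: density_integrable.
move=> s; rewrite /= in_itv/= => sl; have Gs := Gg s sl.
rewrite bdistE// lef_pV2 ?posrE ?dcomp_gt0//; last by lra.
apply: le_trans (dcomp_lip _ p nG) _; rewrite lerD2l -gp.
by apply: le_trans (lip _ _ _ _) _ => //; rewrite ?lexx ?subr0 ?ger0_norm; lra.
Qed.

Lemma qh_dist_ge0 G p q : open G -> ~` G !=set0 -> 0 <= qh_dist G p q.
Proof.
move=> oG nG; have [arcs|noarc] := pselect (arc_joined G p q).
  apply: le_trans (qh_dist_ge oG nG arcs); rewrite ln_ge0// lerDl.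
  by rewrite divr_ge0// dcomp_ge0.
rewrite /qh_dist (_ : [set v | _] = set0) ?inf0//.
by rewrite -subset0 => v [b [gam [? _]]]; apply: noarc; exists b, gam.
Qed.

Lemma segment_arc p q : p != q -> exists gam,
  [/\ gam 0 = p, gam `|p - q| = q,
    (forall s t, `|gam t - gam s| = `|t - s|) &
    (forall t, 0 <= t -> path_length 0 t gam = t%:E)].
Proof.
move=> pq; set l := `|p - q|; have l0 : 0 < l by rewrite normr_gt0 subr_eq0.
pose gam := fun t : R => p + t *: (l^-1 *: (q - p)); exists gam.
have ge s t : `|gam t - gam s| = `|t - s|.
  rewrite /gam opprD addrACA subrr add0r -scalerBl !normrZ (distrC q) -/l.
  by rewrite (ger0_norm (x := l^-1)) ?invr_ge0 ?ltW// mulVf ?mulr1 ?gt_eqF.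
have gam0 : gam 0 = p by rewrite /gam scale0r addr0.
split=> //.
  by rewrite /gam scalerA divff ?gt_eqF// scale1r addrC subrK.
move=> t t0; apply/eqP; rewrite eq_le; apply/andP; split.
  have := @path_length_lip _ _ gam 0 t 1 t0; rewrite subr0 mul1r; apply.
  by move=> s u s0 su ut; rewrite ge mul1r ger0_norm// subr_ge0.
apply: le_trans (path_length_ge gam t0).
by rewrite lee_fin ge subr0 ler_norm.
Qed.

(** The segment competes in the infimum: its length is at most [dcomp G p / 2], and the density on
    it is at most [2 / dcomp G p]. *)
Lemma qh_dist_le1 G p q : open G -> ~` G !=set0 -> G p -> p != q ->
  `|p - q| <= dcomp G p / 2 -> qh_dist G p q <= 1.
Proof.
move=> oG nG Gp pq lpq; have dp := dcomp_gt0 oG Gp nG.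
have l0 : 0 < `|p - q| by rewrite normr_gt0 subr_eq0.
have [gam []] := segment_arc pq; set l := `|p - q| in l0 lpq *.
move=> g0 gl gd glen.
have near_p t : 0 <= t <= l -> dcomp G p / 2 <= dcomp G (gam t).
  move=> /andP[t0 tl]; have := dcomp_lip p (gam t) nG.
  have -> : `|p - gam t| = t by rewrite -{1}g0 gd sub0r normrN ger0_norm.
  lra.
have Gg t : 0 <= t <= l -> G (gam t).
  by move=> /near_p; apply: contraPP => /dcomp_out ->; lra.
have lip s t : 0 <= s <= l -> 0 <= t <= l -> `|gam s - gam t| <= `|s - t|.
  by rewrite gd.
apply: (@le_trans _ _ (\int[lebesgue_measure]_(s in `[0, l]) (bdist G (gam s))^-1)).
  apply: ge_inf.
    exists 0 => _ [b [gam' [arc [g0' [H ->]]]]]; apply: Rintegral_ge0 => s.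
    have [l0' gp gq Gg' _] := arclength_param arc H.
    rewrite /= in_itv/= => sl.
    by rewrite invr_ge0 bdistE ?dcomp_ge0//; exact: Gg'.
  exists l, gam; split.
    split=> //; first exact: ltW.
    - exact: lip_within.
    - move=> s t _ _ /eqP; rewrite -subr_eq0 -normr_eq0 gd normr_eq0 subr_eq0.
      by move/eqP.
    - by split=> //; rewrite glen ?ltry// ltW.
  exists gam; split; last by rewrite glen ?ltW.
  by move=> t /andP[t0 _]; rewrite glen.
apply: (@le_trans _ _ (\int[lebesgue_measure]_(s in `[0, l]) (dcomp G p / 2)^-1)).
  apply: le_Rintegral => //.
  - exact: density_integrable.
  - apply: continuous_compact_integrable; first exact: segment_compact.
    by move=> ?; exact: cvg_cst.
  move=> s; rewrite /= in_itv/= => sl.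
  rewrite bdistE//; last exact: Gg.
  by rewrite lef_pV2 ?posrE ?dcomp_gt0// ?near_p//; [exact: Gg|lra].
rewrite Rintegral_cst//= lebesgue_measure_itv/= lte_fin l0 sube0/=.
by rewrite mulrC ler_pdivrMr ?mul1r//; lra.
Qed.

End QuasihyperbolicDistance.

(** * Separation and betweenness *)

Section CoarseGeometry.
Context {R : realType}.

Lemma bernoulli (e : R) n : 0 <= e -> 1 + n%:R * e <= (1 + e) ^+ n.
Proof.
move=> e0; elim: n => [|n IHn]; first by rewrite mul0r addr0 expr0.
rewrite exprS; apply: (@le_trans _ _ ((1 + e) * (1 + n%:R * e))).
  by rewrite -natr1; have := ler0n R n; nra.
by rewrite ler_wpM2l//; lra.
Qed.

(** With [m = n %/ k.+1] and [t = 1 + m%:R * e], Bernoulli's inequality gives [t ^+ k.+1 <= q ^+ n],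
    while the right side is at most [M * t ^+ k]; hence [t <= M]. As [C] depends on the coefficients
    alone, this yields the uniform step counts for quasigeodesics. *)
Lemma exp_le_poly_bounded (q B a b : R) k : 1 < q -> 0 <= B -> 0 <= a -> 0 <= b ->
  exists C : nat, forall n, q ^+ n <= B * (a * n%:R + b) ^+ k -> (n <= C)%N.
Proof.
move=> q1 B0 a0 b0; pose e := q - 1; have e0 : 0 < e by rewrite subr_gt0.
pose K : R := k.+1%:R; have K1 : 1 <= K by rewrite ler1n.
pose c := a * K / e + a * K + b; have aK : 0 <= a * K by rewrite mulr_ge0//; lra.
have c0 : 0 <= c by rewrite !addr_ge0// divr_ge0// ltW.
pose M := B * c ^+ k; have M0 : 0 <= M by rewrite mulr_ge0// exprn_ge0.
exists (k.+1 * (Num.bound (M / e)))%N => n H.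
set m := (n %/ k.+1)%N; have nm : (k.+1 * m <= n)%N by rewrite mulnC leq_trunc_div.
have mn : (n <= k.+1 * m.+1)%N by rewrite mulnC ltnW// ltn_ceil.
rewrite (leq_trans mn)// leq_pmul2l//.
suff h : m%:R <= M / e.
  by rewrite -(ltr_nat R); apply: le_lt_trans h (archi_boundP _); rewrite divr_ge0// ltW.
rewrite ler_pdivlMr//; set t := 1 + m%:R * e.
have t1 : 1 <= t by rewrite lerDl mulr_ge0// ltW.
suff : t <= M by rewrite /t; lra.
have h1 : t ^+ k.+1 <= q ^+ n.
  apply: (@le_trans _ _ (q ^+ (k.+1 * m))); last by rewrite ler_weXn2l// ltW.
  rewrite mulnC exprM lerXn2r ?nnegrE ?exprn_ge0//; [lra_from t1|lra_from q1|].
  by have := @bernoulli e m (ltW e0); rewrite -/t (_ : 1 + e = q)// /e; ring.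
have h2 : a * n%:R + b <= c * t.
  have nK : n%:R <= K * (m%:R + 1) by rewrite natr1 -natrM ler_nat.
  have : a * n%:R <= a * K * (m%:R + 1) by rewrite -mulrA ler_wpM2l.
  have -> : c * t = a * K * m%:R + a * K / e + (a * K + b) * t.
    by rewrite /c /t; field; rewrite gt_eqF.
  have : a * K + b <= (a * K + b) * t by rewrite ler_peMr// addr_ge0.
  have : 0 <= a * K / e by rewrite divr_ge0// ltW.
  lra_from.
have h3 : (a * n%:R + b) ^+ k <= (c * t) ^+ k.
  rewrite lerXn2r ?nnegrE//; first by rewrite addr_ge0// mulr_ge0.
  by rewrite mulr_ge0//; lra.
have : t ^+ k * t <= t ^+ k * M.
  rewrite -exprSr (le_trans h1)// (le_trans H)// /M mulrCA ler_wpM2l//.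
  by rewrite -exprMn (mulrC t).
by rewrite ler_pM2l// exprn_gt0//; lra.
Qed.

Lemma nat_argmax (f : nat -> R) N :
  exists2 p, (p <= N)%N & forall i, (i <= N)%N -> f i <= f p.
Proof.
elim: N => [|N [p pN H]]; first by exists 0%N => // i; rewrite leqn0 => /eqP ->.
have [le|lt] := leP (f N.+1) (f p).
  by exists p; [exact: leqW|move=> i; rewrite leq_eqVlt => /predU1P[->//|/H]].
exists N.+1 => // i; rewrite leq_eqVlt => /predU1P[->//|/H h].
by apply: le_trans h _; exact: ltW.
Qed.

Definition lip1 {E : normedModType R} (d : E -> R) :=
  forall x y, d x <= d y + `|x - y|.

Definition msep {E : normedModType R} (d : E -> R) x y : R :=
  `|x - y| + d x + d y.

(* The logarithm of gsep is, up to additive constants, a Gromov hyperbolic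
   metric, and zbetween says that z lies on a rough geodesic from x to y. *)
Definition gsep {E : normedModType R} (d : E -> R) x y : R :=
  msep d x y ^+ 2 / (d x * d y).

Definition zbetween {E : normedModType R} (d : E -> R) (A : R) x z y :=
  msep d x z * msep d z y <= A * d z * msep d x y.

(** In terms of log [gsep], the last clause bounds the index difference linearly by the distance, up
    to an additive constant, which is the quasigeodesic inequality for a sequence with bounded
    steps. *)
Definition quasigeodesic {E : normedModType R} (A q B : R) k (d : E -> R)
    (v : nat -> E) N :=
  [/\ (forall i, (i <= N)%N -> 0 < d (v i)),
      (forall i, (i < N)%N -> `|v i - v i.+1| <= A * d (v i) /\
                            `|v i - v i.+1| <= A * d (v i.+1)) &
      (forall i j, (i <= j)%N -> (j <= N)%N ->
         q ^+ (j - i) <= B * gsep d (v i) (v j) ^+ k)].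

Section Separation.
Context {E : normedModType R}.
Variable d : E -> R.
Implicit Types x y z : E.

Lemma msepC x y : msep d x y = msep d y x.
Proof. by rewrite /msep distrC; lra. Qed.

Lemma gsepC x y : gsep d x y = gsep d y x.
Proof. by rewrite /gsep msepC (mulrC (d x)). Qed.

Lemma zbetweenC A x z y : zbetween d A x z y -> zbetween d A y z x.
Proof. by rewrite /zbetween (msepC y z) (msepC z x) (msepC y x) mulrC. Qed.

Lemma msep_gt0 x y : 0 < d x -> 0 < d y -> 0 < msep d x y.
Proof. by rewrite /msep; have := normr_ge0 (x - y); lra. Qed.

Lemma gsep_gt0 x y : 0 < d x -> 0 < d y -> 0 < gsep d x y.
Proof. by move=> *; rewrite divr_gt0 ?mulr_gt0 ?exprn_gt0// msep_gt0. Qed.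

Lemma gsep_ge1 x y : 0 < d x -> 0 < d y -> 1 <= gsep d x y.
Proof.
move=> dx dy; rewrite ler_pdivlMr ?mulr_gt0// mul1r expr2.
by rewrite ler_pM ?ltW// /msep; have := normr_ge0 (x - y); lra.
Qed.

Lemma gsep_le x y t Q : 0 < d x -> 0 < d y -> 0 <= Q -> 0 < t ->
  t <= Q * d x -> t <= Q * d y -> forall c, msep d x y <= c * t ->
  gsep d x y <= (c * Q) ^+ 2.
Proof.
move=> dx dy Q0 t0 tx ty c h; have m0 := ltW (msep_gt0 dx dy).
rewrite ler_pdivrMr ?mulr_gt0//.
apply: (@le_trans _ _ ((c * t) ^+ 2)).
  by rewrite lerXn2r ?nnegrE//; exact: le_trans h.
rewrite (_ : _ * (d x * d y) = c ^+ 2 * ((Q * d x) * (Q * d y))); last by ring.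
rewrite exprMn ler_wpM2l ?sqr_ge0// expr2.
by rewrite ler_pM// ltW.
Qed.

Lemma msep_mul_le x z y : 0 < d x -> 0 < d y -> 0 < d z ->
  msep d x y * d z <= 2 * (msep d x z * msep d z y).
Proof.
move=> dx dy dz; have m1 := msep_gt0 dx dz; have m2 := msep_gt0 dz dy.
have : msep d x y <= msep d x z + msep d z y.
  by rewrite /msep; have := ler_distD z x y; lra.
have : d z <= msep d x z by rewrite /msep; have := normr_ge0 (x - z); lra.
have : d z <= msep d z y by rewrite /msep; have := normr_ge0 (z - y); lra.
by nra.
Qed.

(** The square of [msep_mul_le]. For log [gsep] it is the triangle inequality up to the additive
    constant log 4. *)
Lemma gsep_triangle x z y : 0 < d x -> 0 < d y -> 0 < d z ->
  gsep d x y <= 4 * gsep d x z * gsep d z y.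
Proof.
move=> dx dy dz; rewrite ler_pdivrMr ?mulr_gt0//.
rewrite (_ : _ * (d x * d y) = 4 * (msep d x z * msep d z y) ^+ 2 / d z ^+ 2); last first.
  by rewrite /gsep; field; rewrite !gt_eqF.
rewrite ler_pdivlMr ?exprn_gt0// -exprMn.
rewrite (_ : 4 * _ = (2 * (msep d x z * msep d z y)) ^+ 2); last by ring.
have m1 := msep_gt0 dx dz; have m2 := msep_gt0 dz dy; have m3 := msep_gt0 dx dy.
rewrite lerXn2r ?nnegrE//; last exact: msep_mul_le.
- by rewrite mulr_ge0// ltW.
- by rewrite !mulr_ge0// ltW.
Qed.

(* Concatenation of rough geodesics meeting at a point which is itself between
   their other endpoints. *)
Lemma zbetween_cat A B C x y1 z y2 y : 0 < d x -> 0 < d y1 -> 0 < d z ->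
  0 < d y2 -> 0 < d y -> 0 <= A -> 0 <= B -> 0 <= C ->
  zbetween d B x y1 z -> zbetween d C z y2 y -> zbetween d A x z y ->
  zbetween d (4 * A * B * C) y1 z y2.
Proof.
move=> dx dy1 dz dy2 dy A0 B0 C0 h1 h2 h3.
have t1 := msep_mul_le dx dy dy1; have t2 := msep_mul_le dy1 dy dy2.
move: h1 h2 h3 t1 t2; rewrite /zbetween.
have := msep_gt0 dx dy1; have := msep_gt0 dy2 dy; have := msep_gt0 dy1 dz.
have := msep_gt0 dz dy2; have := msep_gt0 dx dz; have := msep_gt0 dz dy.
have := msep_gt0 dy1 dy; have := msep_gt0 dx dy; have := msep_gt0 dy1 dy2.
set a := msep d x y1; set b := msep d y1 z; set c := msep d z y2.
set f := msep d y2 y; set g := msep d x y; set l := msep d y1 y2.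
set p := msep d x z; set r := msep d z y; set s := msep d y1 y.
move=> l0 g0 s0 r0 p0 c0 b0 f0 a0 h1 h2 h3 t1 t2.
(* The product of [h1] and [h2]. Then [p * r] is replaced through [h3] and [g] through [t1] and
   [t2], and the common factor [a * f] cancels. *)
have e1 : (a * b) * (c * f) <= (B * d y1 * p) * (C * d y2 * r).
  by rewrite ler_pM// mulr_ge0// ltW.
have e2 : (p * r) * (B * C * (d y1 * d y2)) <=
          (A * d z * g) * (B * C * (d y1 * d y2)).
  by rewrite ler_wpM2r// !mulr_ge0// ltW.
have e3 : g * d y1 * d y2 <= 4 * a * l * f.
  apply: (@le_trans _ _ (2 * (a * s) * d y2)); first by rewrite ler_wpM2r// ltW.
  rewrite (_ : 2 * (a * s) * d y2 = 2 * a * (s * d y2)); last by ring.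
  rewrite (_ : 4 * a * l * f = 2 * a * (2 * (l * f))); last by ring.
  by rewrite ler_wpM2l// mulr_ge0// ltW.
have e4 : (A * d z * B * C) * (g * d y1 * d y2) <= (A * d z * B * C) * (4 * a * l * f).
  by rewrite ler_wpM2l// !mulr_ge0// ltW.
have af0 : 0 < a * f by rewrite mulr_gt0.
rewrite -(ler_pM2r af0).
rewrite (_ : b * c * (a * f) = (a * b) * (c * f)); last by ring.
apply: (le_trans e1); move: e2 e4.
rewrite (_ : A * d z * g * _ = (A * d z * B * C) * (g * d y1 * d y2)); last by ring.
rewrite (_ : A * d z * B * C * (4 * a * l * f) = 4 * A * B * C * d z * l * (a * f)); last by ring.
rewrite (_ : p * r * _ = B * d y1 * p * (C * d y2 * r)); last by ring.
by move=> x1 x2; exact: le_trans x2.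
Qed.

End Separation.

End CoarseGeometry.

(** * A discrete Gehring-Osgood theorem *)

Section Morse.
Context {R : realType}.
Implicit Types (A B C Q q T : R).

Lemma le_mul_ge1 (c x : R) : 1 <= c -> 0 < x -> x <= c * x.
Proof. by move=> c1 x0; rewrite ler_peMl// ltW. Qed.


Lemma quasigeodesic_rev (E : normedModType R) A q B k (d : E -> R) v N :
  quasigeodesic A q B k d v N -> quasigeodesic A q B k d (fun i => v (N - i)%N) N.
Proof.
move=> [d0 st qg]; split.
- by move=> i iN; apply: d0; natlia.
- move=> i iN; have [|h1 h2] := st (N - i.+1)%N; first by natlia.
  move: h1 h2; rewrite (_ : (N - i.+1).+1 = N - i)%N; last by natlia.
  by rewrite distrC.
- move=> i j ij jN; rewrite gsepC (_ : (j - i = N - i - (N - j))%N); last by natlia.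
  by apply: qg; natlia.
Qed.

Lemma step_sum (E : normedModType R) A q B k (d : E -> R) v N T i n :
  0 <= A -> quasigeodesic A q B k d v N -> (i + n <= N)%N ->
  (forall l, (i <= l <= i + n)%N -> d (v l) <= T) ->
  `|v i - v (i + n)%N| <= A * T * n%:R.
Proof.
move=> A0 [d0 st qg]; elim: n => [|n IHn] inN dT.
  by rewrite addn0 subrr normr0 mulr0.
apply: le_trans (ler_distD (v (i + n)%N) _ _) _.
have h1 : `|v i - v (i + n)%N| <= A * T * n%:R.
  by apply: IHn; [natlia|move=> l h; apply: dT; natlia].
have [|h2 _] := st (i + n)%N; first by natlia.
have h3 : A * d (v (i + n)%N) <= A * T by rewrite ler_wpM2l//; apply: dT; natlia.
rewrite addnS -natr1 mulrDr mulr1; lra.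
Qed.

Lemma step_growth (E : normedModType R) A q B k (d : E -> R) v N i n :
  0 <= A -> lip1 d -> quasigeodesic A q B k d v N -> (i + n <= N)%N ->
  d (v (i + n)%N) <= (1 + A) ^+ n * d (v i) /\
  d (v i) <= (1 + A) ^+ n * d (v (i + n)%N).
Proof.
move=> A0 lip [d0 st qg]; elim: n => [|n IHn] inN.
  by rewrite addn0 expr0 mul1r.
have [|h1 h2] := IHn; first by natlia.
have [|s1 s2] := st (i + n)%N; first by natlia.
have l1 := lip (v (i + n)%N) (v (i + n).+1).
have l2 := lip (v (i + n).+1) (v (i + n)%N).
rewrite distrC in l2; rewrite addnS exprS.
have p0 : 0 <= (1 + A) ^+ n by rewrite exprn_ge0//; lra.
split.
  apply: (@le_trans _ _ ((1 + A) * d (v (i + n)%N))); first by lra.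
  by rewrite -mulrA ler_wpM2l//; lra.
rewrite -mulrA mulrCA; apply: (le_trans h2); apply: ler_wpM2l => //; lra.
Qed.

(** While [d] stays below [T], a stretch of n steps covers at most [A * T * n]; with both ends of
    size about [T], their [gsep] is polynomial in n. Along a quasigeodesic a power of it grows at
    least exponentially, so n is bounded. *)
Lemma fat_stretch A q B k Q : 0 <= A -> 1 < q -> 0 <= B -> 0 <= Q ->
  exists C : nat, forall (E : normedModType R) (d : E -> R) v N,
    quasigeodesic A q B k d v N ->
    forall i j T, (i <= j)%N -> (j <= N)%N -> 0 < T ->
      (forall l, (i <= l <= j)%N -> d (v l) <= T) ->
      T <= Q * d (v i) -> T <= Q * d (v j) -> (j - i <= C)%N.
Proof.
move=> A0 q1 B0 Q0.
have [||C HC] := @exp_le_poly_bounded R q B (A * Q) (2 * Q) (2 * k) q1 B0.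
- by rewrite mulr_ge0.
- by rewrite mulr_ge0.
exists C => E d v N qg i j T ij jN T0 dT Ti Tj; apply: HC.
have [d0 st /(_ i j ij jN) le] := qg; apply: (le_trans le).
rewrite ler_wpM2l// exprM lerXn2r ?nnegrE ?exprn_ge0//.
- by rewrite ltW// gsep_gt0//; apply: d0; natlia.
- by rewrite addr_ge0// mulr_ge0//; rewrite mulr_ge0.
have di : 0 < d (v i) by apply: d0; natlia.
have dj : 0 < d (v j) by apply: d0; natlia.
have hs := @step_sum E A q B k d v N T i (j - i) A0 qg.
rewrite subnKC// in hs; have {}hs := hs jN dT.
have := @gsep_le R E d _ _ T Q di dj Q0 T0 Ti Tj (A * (j - i)%:R + 2).
rewrite (_ : (A * (j - i)%:R + 2) * Q = A * Q * (j - i)%:R + 2 * Q); last by ring.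
have h1 := dT i; have h2 := dT j; rewrite ij !leqnn /= in h1 h2.
by apply; rewrite /msep; have := h1 isT; have := h2 isT; lra_from hs.
Qed.

(** Let [m] be the fattest index between [i] and [j], and [l] the first index from [j] on where [d]
    is again at least its value at [m]; the peak [p] ensures that [l] exists. Between them [d] is at
    most [(1 + A)] times that value, so [fat_stretch] bounds [l - m], and few steps cannot make [d]
    drop much at [j]. *)
Lemma quasi_increasing A q B k : 0 <= A -> 1 < q -> 0 <= B ->
  exists2 C : R, 1 <= C & forall (E : normedModType R) (d : E -> R) v N p,
    lip1 d -> quasigeodesic A q B k d v N -> (p <= N)%N ->
    (forall i, (i <= p)%N -> d (v i) <= d (v p)) ->
    forall i j, (i <= j)%N -> (j <= p)%N -> d (v i) <= C * d (v j).
Proof.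
move=> A0 q1 B0; have A10 : 0 <= 1 + A by lra.
have [C HC] := @fat_stretch A q B k (1 + A) A0 q1 B0 A10.
exists ((1 + A) ^+ C); first by rewrite exprn_ege1//; lra.
move=> E d v N p lip qg pN dp i j ij jp; have [d0 _ _] := qg.
have [t tji Ht] := nat_argmax (fun l => d (v (i + l)%N)) (j - i).
set m := (i + t)%N in Ht.
have mj : (m <= j)%N by rewrite /m; natlia.
have exl : exists l, (j <= l)%N && (d (v m) <= d (v l)).
  by exists p; rewrite jp dp//; natlia.
have lp : (ex_minn exl <= p)%N.
  by case: ex_minnP => l _; apply; rewrite jp dp//; natlia.
move: lp; case: ex_minnP => l /andP[jl ml] lmin lp.
have dm : 0 < d (v m) by apply: d0; natlia.
have between o : (m <= o <= l)%N -> d (v o) <= (1 + A) * d (v m).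
  move=> /andP[mo ol]; have [oj|jo] := leqP o j.
    have := Ht (o - i)%N; rewrite subnKC; last by natlia.
    move=> h; apply: (le_trans (h _)); first by natlia.
    by apply: le_mul_ge1 => //; lra_from A0.
  case: o => [|o] in mo ol jo *; first by natlia.
  have : d (v o) < d (v m).
    by rewrite ltNge; apply/negP => h; have := lmin o; rewrite h andbT; natlia.
  have := @step_growth E A q B k d v N o 1 A0 lip qg; rewrite addn1 expr1.
  by move=> h; have [|h1 _] := h; [natlia|move=> h2; apply: (le_trans h1); apply: ler_wpM2l => //; exact: ltW].
have lm : (l - m <= C)%N.
  apply: (HC E d v N qg m l ((1 + A) * d (v m))) => //; try natlia.
  - by rewrite mulr_gt0//; lra.
  - by rewrite ler_wpM2l.
have di : d (v i) <= d (v m).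
  by have := Ht 0%N; rewrite addn0; apply; natlia.
apply: (le_trans di).
have [|_ h] := @step_growth E A q B k d v N m (j - m) A0 lip qg; first by natlia.
rewrite subnKC// in h; apply: (le_trans h); rewrite ler_wpM2r//.
  by apply: ltW; apply: d0; natlia.
by apply: ler_weXn2l; [lra_from A0|natlia].
Qed.

(** If [d] failed to double, [quasi_increasing] would keep it within a constant factor along the
    whole stretch, which [fat_stretch] does not allow for so many steps. *)
Lemma quasi_doubling A q B k : 0 <= A -> 1 < q -> 0 <= B ->
  exists2 C : nat, (0 < C)%N & forall (E : normedModType R) (d : E -> R) v N p,
    lip1 d -> quasigeodesic A q B k d v N -> (p <= N)%N ->
    (forall i, (i <= p)%N -> d (v i) <= d (v p)) ->
    forall i, (i + C <= p)%N -> 2 * d (v i) <= d (v (i + C)%N).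
Proof.
move=> A0 q1 B0; have [C1 C11 H1] := @quasi_increasing A q B k A0 q1 B0.
have Q0 : 0 <= 2 * C1 ^+ 2 by rewrite mulr_ge0// sqr_ge0.
have [C HC] := @fat_stretch A q B k (2 * C1 ^+ 2) A0 q1 B0 Q0.
exists C.+1 => // E d v N p lip qg pN dp i iC; have [d0 _ _] := qg.
rewrite leNgt; apply/negP => lt.
have di : 0 < d (v i) by apply: d0; natlia.
have inc := H1 E d v N p lip qg pN dp.
suff : (i + C.+1 - i <= C)%N by natlia.
apply: (HC E d v N qg i (i + C.+1)%N (2 * C1 * d (v i))).
- natlia.
- natlia.
- by rewrite !mulr_gt0//; lra.
- move=> l /andP[il lC]; apply: (le_trans (inc l (i + C.+1)%N lC iC)).
  by rewrite -mulrA mulrCA; apply: ler_wpM2l; lra.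
- by apply: ler_wpM2r; [exact: ltW|rewrite ler_wpM2l// expr2 ler_peMl//; lra].
- have := inc i (i + C.+1)%N (leq_addr _ _) iC => h.
  by rewrite expr2 -!mulrA ler_wpM2l// ler_wpM2l//; lra.
Qed.

(** Induction by blocks of [C2] steps. If S is the cost of one block, the constant is 2 S: going
    back one block halves [d], so the earlier part costs at most half of the constant and the last
    block the other half. *)
Lemma start_cone A q B k : 0 <= A -> 1 < q -> 0 <= B ->
  exists2 C : R, 0 <= C & forall (E : normedModType R) (d : E -> R) v N p,
    lip1 d -> quasigeodesic A q B k d v N -> (p <= N)%N ->
    (forall i, (i <= p)%N -> d (v i) <= d (v p)) ->
    forall i, (i <= p)%N -> `|v 0%N - v i| <= C * d (v i).
Proof.
move=> A0 q1 B0; have [C1 C11 H1] := @quasi_increasing A q B k A0 q1 B0.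
have [C2 C20 H2] := @quasi_doubling A q B k A0 q1 B0.
have AC : 0 <= A * C1 * C2%:R by rewrite !mulr_ge0//; lra.
exists (2 * (A * C1 * C2%:R)); first by rewrite mulr_ge0.
move=> E d v N p lip qg pN dp; have [d0 _ _] := qg.
have inc := H1 E d v N p lip qg pN dp; have dbl := H2 E d v N p lip qg pN dp.
have short i n : (n <= C2)%N -> (i + n <= p)%N ->
    `|v i - v (i + n)%N| <= A * C1 * C2%:R * d (v (i + n)%N).
  move=> nC inp; have di : 0 < d (v (i + n)%N) by apply: d0; natlia.
  have := @step_sum E A q B k d v N (C1 * d (v (i + n)%N)) i n A0 qg.
  move=> h; apply: (le_trans (h _ _)); first by natlia.
    by move=> l /andP[il ln]; apply: inc => //; natlia.
  rewrite (_ : A * C1 * _ * _ = A * (C1 * d (v (i + n)%N)) * C2%:R); last by ring.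
  rewrite ler_wpM2l ?ler_nat// mulr_ge0// mulr_ge0//; lra_from C11 di.
elim/ltn_ind => i IH ip; have di : 0 < d (v i) by apply: d0; natlia.
have [iC|Ci] := leqP i C2.
  have := short 0%N i iC; rewrite add0n => /(_ ip) h.
  by apply: (le_trans h); apply: ler_wpM2r; [exact: ltW|lra].
have e : (i - C2 + C2 = i)%N by natlia.
have h1 : `|v 0%N - v (i - C2)%N| <= 2 * (A * C1 * C2%:R) * d (v (i - C2)%N).
  by apply: IH; natlia.
have h2 := short (i - C2)%N C2 (leqnn _); rewrite e in h2; have {}h2 := h2 ip.
have h3 := dbl (i - C2)%N; rewrite e in h3; have {}h3 := h3 ip.
have := ler_distD (v (i - C2)%N) (v 0%N) (v i).
have : (A * C1 * C2%:R) * (2 * d (v (i - C2)%N)) <= (A * C1 * C2%:R) * d (v i).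
  by rewrite ler_wpM2l.
lra_from h1 h2.
Qed.

(* The discrete Gehring-Osgood theorem: the quasigeodesic widens like a cone
   up to its fattest vertex p and narrows like a cone afterwards. *)
Lemma quasigeodesic_cones A q B k : 0 <= A -> 1 < q -> 0 <= B ->
  exists2 C : R, 1 <= C & forall (E : normedModType R) (d : E -> R) v N,
    lip1 d -> quasigeodesic A q B k d v N ->
    (exists p, [/\ (p <= N)%N,
       (forall i, (i <= p)%N -> `|v 0%N - v i| <= C * d (v i)) &
       (forall i, (p <= i)%N -> (i <= N)%N -> `|v i - v N| <= C * d (v i))]) /\
    (forall i, (i <= N)%N -> zbetween d C (v 0%N) (v i) (v N)).
Proof.
move=> A0 q1 B0; have [C C0 HC] := @start_cone A q B k A0 q1 B0.
pose c := 2 * C * (1 + A) + 1 + 2 * (1 + A).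
have CA : 0 <= C * A by rewrite mulr_ge0.
have c0 : 0 <= c by rewrite /c; nra.
(* Degree 0 of the polynomial bound: a [gsep] of at most [c ^+ 2] allows at most [n] steps. *)
have [n Hn] := @exp_le_poly_bounded R q (B * (c * 1) ^+ 2 ^+ k) 0 0 0 q1
   ltac:(by rewrite mulr_ge0// exprn_ge0// exprn_ge0// mulr_ge0) (lexx 0) (lexx 0).
pose C4 := (1 + A) ^+ n.+1.
have C41 : 1 <= C4 by rewrite exprn_ege1//; lra.
have CC4 : 0 <= C * C4 by rewrite mulr_ge0//; lra.
pose C5 := 2 * (C + 1) * ((C + 1) * C4 + 1).
have C5C : C + 1 <= C5 by rewrite /C5; nra.
exists C5; first by lra.
move=> E d v N lip qg; have [d0 st qgd] := qg.
have [p pN dp] := nat_argmax (fun i => d (v i)) N.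
have left_cone i : (i <= p)%N -> `|v 0%N - v i| <= C * d (v i).
  by apply: (HC E d v N p lip qg pN) => j jp; apply: dp; natlia.
have right_cone i : (p <= i)%N -> (i <= N)%N -> `|v i - v N| <= C * d (v i).
  move=> pi iN.
  have := HC E d _ N (N - p)%N lip (quasigeodesic_rev qg) ltac:(natlia).
  rewrite subn0 (_ : (N - (N - p) = p)%N); last by natlia.
  move=> /(_ (fun j _ => dp _ (leq_subr _ _))) /(_ (N - i)%N).
  rewrite (_ : (N - (N - i) = i)%N); last by natlia.
  by rewrite distrC; apply; natlia.
have d00 : 0 < d (v 0%N) by exact: d0.
have dN0 : 0 < d (v N) by exact: d0.
(* Let [i] and [j] be the first and last indices with [r <= d]. There [d] is about [r], and the
   cones place both vertices within a multiple of [r] from the ends, so their [gsep] is bounded and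
   [j - i <= n]. The peak lies in between, a bounded number of steps from [i]. *)
have peak : d (v p) <= C4 * msep d (v 0%N) (v N).
  set r := msep d (v 0%N) (v N); have r0 : 0 < r by exact: msep_gt0.
  have [lt|ge] := ltP (d (v p)) r.
    by apply: (le_trans (ltW lt)); exact: le_mul_ge1.
  have exi : exists i, r <= d (v i) by exists p.
  have ip : (ex_minn exi <= p)%N by case: ex_minnP => i _; apply.
  move: ip; case: ex_minnP => i ri imin ip.
  have exj : exists j, (j <= N)%N && (r <= d (v j)) by exists p; rewrite pN.
  have bj j : (j <= N)%N && (r <= d (v j)) -> (j <= N)%N by case/andP.
  have pj : (p <= ex_maxn exj bj)%N.
    by case: ex_maxnP => j _; apply; rewrite pN.
  move: pj; case: ex_maxnP => j /andP[jN rj] jmax pj.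
  have di : d (v i) <= (1 + A) * r.
    case: i ri imin ip => [|i] ri imin ip.
      have : d (v 0%N) <= r by rewrite /r /msep; have := normr_ge0 (v 0%N - v N); lra_from dN0.
      by move=> h; apply: (le_trans h); apply: le_mul_ge1 => //; lra_from A0.
    have : d (v i) < r by rewrite ltNge; apply/negP => /imin; rewrite ltnn.
    have [|h _] := @step_growth E A q B k d v N i 1 A0 lip qg; first by natlia.
    rewrite addn1 expr1 in h => lt; apply: (le_trans h).
    by apply: ler_wpM2l; [lra_from A0|exact: ltW].
  have dj : d (v j) <= (1 + A) * r.
    have [->|jN'] := eqVneq j N.
      have : d (v N) <= r by rewrite /r /msep; have := normr_ge0 (v 0%N - v N); lra_from d00.
      by move=> h; apply: (le_trans h); apply: le_mul_ge1 => //; lra_from A0.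
    have jltN : (j < N)%N by rewrite ltn_neqAle jN'.
    have : d (v j.+1) < r.
      by rewrite ltNge; apply/negP => h; have := jmax j.+1; rewrite h andbT; natlia.
    have [|_ h] := @step_growth E A q B k d v N j 1 A0 lip qg; first by natlia.
    rewrite addn1 expr1 in h => lt; apply: (le_trans h).
    by apply: ler_wpM2l; [lra_from A0|exact: ltW].
  have dvi : 0 < d (v i) by lra_from r0 ri. have dvj : 0 < d (v j) by lra_from r0 rj.
  have ji : (j - i <= n)%N.
    apply: Hn; rewrite expr0 mulr1.
    apply: le_trans (qgd i j ltac:(natlia) jN) _; rewrite ler_wpM2l//.
    rewrite lerXn2r ?nnegrE//.
    - exact: ltW (gsep_gt0 _ _).
    - by rewrite exprn_ge0// mulr_ge0.
    apply: (@gsep_le R E d _ _ r) => //; rewrite ?mul1r// /msep.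
    have h1 := left_cone i ip; have h2 := right_cone j pj jN.
    have h3 := ler_distD (v 0%N) (v i) (v j).
    have h4 := ler_distD (v N) (v 0%N) (v j).
    have h5 : `|v 0%N - v N| <= r by rewrite /r /msep; lra_from d00 dN0.
    rewrite (distrC (v i) (v 0%N)) in h3; rewrite (distrC (v N)) in h4.
    have : C * d (v i) <= C * ((1 + A) * r) by rewrite ler_wpM2l.
    have : C * d (v j) <= C * ((1 + A) * r) by rewrite ler_wpM2l.
    rewrite /c; lra_from di dj h1 h2 h5 h3 h4.
  have [|h _] := @step_growth E A q B k d v N i (p - i) A0 lip qg; first by natlia.
  rewrite subnKC// in h; apply: (le_trans h).
  apply: (@le_trans _ _ ((1 + A) ^+ n * ((1 + A) * r))).
    apply: ler_pM => //; first by rewrite exprn_ge0//; lra_from A0.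
      exact: ltW.
    by apply: ler_weXn2l; [lra_from A0|natlia].
  by rewrite /C4 exprSr mulrA.
split.
  exists p; split=> // i; first move=> ip; last move=> pi iN.
    have h := left_cone i ip.
    by apply: (le_trans h); apply: ler_wpM2r; [apply/ltW/d0; natlia|lra_from C5C].
  by apply: (le_trans (right_cone i pi iN)); apply: ler_wpM2r; [exact/ltW/d0|lra_from C5C].
move=> i iN; have di : 0 < d (v i) by exact: d0.
have dip : d (v i) <= d (v p) by exact: dp.
set r := msep d (v 0%N) (v N) in peak *; have r0 : 0 < r by exact: msep_gt0.
have key x y : 0 < d x -> 0 < d y -> msep d x y = r ->
    `|x - v i| <= C * d (v i) -> zbetween d C5 x (v i) y.
  move=> dx dy xyr h; rewrite /zbetween xyr.
  have m1 : msep d x (v i) <= 2 * (C + 1) * d (v i).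
    by rewrite /msep; have := lip x (v i); lra_from h.
  have m2 : msep d (v i) y <= ((C + 1) * C4 + 1) * r.
    have : (C + 1) * d (v i) <= (C + 1) * (C4 * r) by rewrite ler_wpM2l; lra_from A0 C0 dip peak.
    move: xyr; rewrite /msep; have := ler_distD x (v i) y.
    by rewrite (distrC (v i) x); lra_from dx h.
  apply: le_trans (ler_pM _ _ m1 m2) _; [exact/ltW/msep_gt0|exact/ltW/msep_gt0|].
  by rewrite /C5 le_eqVlt; apply/orP; left; apply/eqP; ring.
have [ip|pi] := leqP i p; first by apply: key => //; exact: left_cone.
apply: zbetweenC; apply: key => //; first by rewrite msepC.
by rewrite distrC; apply: right_cone; natlia.
Qed.

End Morse.

(** * Chains and coarse maps *)

Section Chains.
Context {R : realType}.
Implicit Types (A B C Q q T e : R).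

Definition step {E : normedModType R} (d : E -> R) e x y :=
  `|x - y| <= e * d x /\ `|x - y| <= e * d y.

Definition chain {E : normedModType R} (G : set E) (d : E -> R) e x y v N :=
  [/\ v 0%N = x, v N = y, (forall i, (i <= N)%N -> G (v i)) &
      (forall i, (i < N)%N -> step d e (v i) (v i.+1))].

Definition log_chained {E : normedModType R} (G : set E) (d : E -> R) e q B :=
  forall x y, G x -> G y ->
    exists v N, chain G d e x y v N /\ q ^+ N <= B * gsep d x y.

(** For the metrics log [gsep], the second clause is a Lipschitz bound at the scale of one step and
    the third a linear lower bound: just what turns a minimal chain into a quasigeodesic. *)
Definition coarse_map {E E' : normedModType R} (G : set E) (d : E -> R)
    (d' : E' -> R) (h : E -> E') e B k :=
  [/\ (forall x, G x -> 0 < d x /\ 0 < d' (h x)),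
      (forall x y, G x -> G y -> step d e x y -> gsep d' (h x) (h y) <= B) &
      (forall x y, G x -> G y -> gsep d x y <= B * gsep d' (h x) (h y) ^+ k)].

Definition splice {T : Type} (v w : nat -> T) n i :=
  if (i <= n)%N then v i else w (i - n)%N.

Section Splice.
Context {E : normedModType R}.
Variables (G : set E) (d : E -> R) (e : R).

Lemma step_sym x y : step d e x y -> step d e y x.
Proof. by rewrite /step distrC => -[]. Qed.

Lemma splice_l (v w : nat -> E) n i : (i <= n)%N -> splice v w n i = v i.
Proof. by rewrite /splice => ->. Qed.

Lemma splice_r (v w : nat -> E) n i : v n = w 0%N -> (n <= i)%N ->
  splice v w n i = w (i - n)%N.
Proof.
move=> vw; rewrite leq_eqVlt => /predU1P[<-|ni]; last by rewrite /splice leqNgt ni.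
by rewrite splice_l// subnn.
Qed.

Lemma chain_cat x y z v w n m :
  chain G d e x y v n -> chain G d e y z w m ->
  chain G d e x z (splice v w n) (n + m).
Proof.
move=> [v0 vn vG vs] [w0 wm wG ws]; have vw : v n = w 0%N by rewrite vn w0.
split.
- by rewrite splice_l.
- by rewrite (splice_r vw (leq_addr _ _)) addKn.
- move=> i im; have [le|gt] := leqP i n; first by rewrite splice_l//; exact: vG.
  by rewrite (splice_r vw (ltnW gt)); apply: wG; natlia.
- move=> i im; have [lt|ge] := ltnP i n.
    by rewrite (splice_l _ _ (ltnW lt)) (splice_l _ _ lt); exact: vs.
  by rewrite (splice_r vw ge) (splice_r vw (leqW ge)) subSn//; apply: ws; natlia.
Qed.

Lemma chain_sub x y v N i j : chain G d e x y v N -> (i <= j)%N -> (j <= N)%N ->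
  chain G d e (v i) (v j) (fun l => v (i + l)%N) (j - i).
Proof.
move=> [v0 vn vG vs] ij jN; split; rewrite ?addn0 ?subnKC//.
- by move=> l h; apply: vG; natlia.
- by move=> l h; rewrite addnS; apply: vs; natlia.
Qed.

Lemma chain_rev x y v N : chain G d e x y v N ->
  chain G d e y x (fun i => v (N - i)%N) N.
Proof.
move=> [v0 vn vG vs]; split; rewrite ?subn0 ?subnn//.
- by move=> l h; apply: vG; natlia.
- move=> l h; rewrite -(subnSK h); apply: step_sym; apply: vs; natlia.
Qed.

(** In a chain with the fewest steps no piece can be replaced by a shorter chain, so each piece
    inherits the bound of [log_chained] for its own ends. *)
Lemma minimal_chain q B : 1 < q -> log_chained G d e q B ->
  forall x y, G x -> G y -> exists v N, chain G d e x y v N /\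
    forall i j, (i <= j)%N -> (j <= N)%N ->
      q ^+ (j - i) <= B * gsep d (v i) (v j).
Proof.
move=> q1 LC x y Gx Gy.
have exN : exists N, `[< exists v, chain G d e x y v N >].
  by have [v [N [c _]]] := LC x y Gx Gy; exists N; apply/asboolP; exists v.
case: (ex_minnP exN) => N /asboolP[v c] Nmin; exists v, N; split=> // i j ij jN.
have [v0 vN vG vs] := c.
have [w [n [cw le]]] := LC (v i) (v j) (vG i ltac:(natlia)) (vG j jN).
apply: le_trans le; apply: ler_weXn2l; first exact: ltW.
have c1 := @chain_sub _ _ _ _ 0%N i c ltac:(natlia) ltac:(natlia).
have c2 := @chain_sub _ _ _ _ j N c jN (leqnn N).
rewrite v0 in c1; rewrite vN in c2.
have := Nmin (i - 0 + (n + (N - j)))%N.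
have -> : `[< exists v, chain G d e x y v (i - 0 + (n + (N - j)))%N >].
  by apply/asboolP; eexists; exact: chain_cat c1 (chain_cat cw c2).
by move=> /(_ isT); natlia.
Qed.

End Splice.

Lemma chain_image_gsep (E E' : normedModType R) G (d : E -> R) (d' : E' -> R) h
    e B x y v N : 1 <= B ->
  (forall x, G x -> 0 < d x /\ 0 < d' (h x)) ->
  (forall x y, G x -> G y -> step d e x y -> gsep d' (h x) (h y) <= B) ->
  chain G d e x y v N -> gsep d' (h x) (h y) <= 4 * (4 * B) ^+ N.
Proof.
move=> B1 pos st [<- <- vG vs]; elim: N vG vs => [|N IHN] vG vs.
  have [_ p] := pos _ (vG 0%N isT); rewrite expr0 mulr1.
  rewrite /gsep /msep subrr normr0 add0r ler_pdivrMr ?mulr_gt0//.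
  by rewrite expr2 le_eqVlt; apply/orP; left; apply/eqP; ring.
have [_ p0] := pos _ (vG 0%N isT); have [_ pN] := pos _ (vG N ltac:(natlia)).
have [_ pS] := pos _ (vG N.+1 ltac:(natlia)).
apply: le_trans (gsep_triangle p0 pS pN) _.
have h1 : gsep d' (h (v 0%N)) (h (v N)) <= 4 * (4 * B) ^+ N.
  by apply: IHN => i iN; [apply: vG|apply: vs]; natlia.
have h2 : gsep d' (h (v N)) (h (v N.+1)) <= B.
  by apply: st; [apply: vG|apply: vG|apply: vs]; natlia.
apply: (@le_trans _ _ (4 * (4 * (4 * B) ^+ N) * B)).
  apply: ler_pM => //; first by rewrite mulr_ge0// ltW// gsep_gt0.
    by rewrite ltW// gsep_gt0.
  by rewrite ler_wpM2l.
by rewrite exprS le_eqVlt; apply/orP; left; apply/eqP; ring.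
Qed.

Lemma exp_dominates q B : 1 < q -> exists k : nat, B <= q ^+ k.
Proof.
move=> q1; have e0 : 0 < q - 1 by rewrite subr_gt0.
exists (Num.bound (`|B| / (q - 1))).
have := @bernoulli R (q - 1) (Num.bound (`|B| / (q - 1))) (ltW e0).
rewrite (_ : 1 + (q - 1) = q); last by ring.
move=> h; apply: le_trans h.
have : `|B| / (q - 1) < (Num.bound (`|B| / (q - 1)))%:R.
  by apply: archi_boundP; rewrite divr_ge0// ltW.
rewrite ltr_pdivrMr// => h; have := ler_norm B; lra.
Qed.

(* The power comes from comparing the number of steps of a chain, which is
   logarithmic on the source side, with a bounded factor per step. *)
Lemma chain_image_power e q B : 1 < q -> 1 <= B ->
  exists2 k : nat, (0 < k)%N & forall (E E' : normedModType R) G (d : E -> R) (d' : E' -> R) h,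
    log_chained G d e q B ->
    (forall x, G x -> 0 < d x /\ 0 < d' (h x)) ->
    (forall x y, G x -> G y -> step d e x y -> gsep d' (h x) (h y) <= B) ->
    forall x y, G x -> G y ->
      gsep d' (h x) (h y) <= 4 * (B * gsep d x y) ^+ k.
Proof.
move=> q1 B1; have [k hk] := exp_dominates (4 * B) q1.
exists k.+1 => // E E' G d d' h LC pos st x y Gx Gy.
have [v [N [c le]]] := LC x y Gx Gy.
have H := chain_image_gsep B1 pos st c.
apply: (le_trans H); rewrite ler_wpM2l//.
apply: (@le_trans _ _ ((q ^+ k.+1) ^+ N)).
  rewrite lerXn2r ?nnegrE//; [lra|by rewrite exprn_ge0//; lra|].
  by apply: (le_trans hk); apply: ler_weXn2l; [exact: ltW|natlia].
rewrite -exprM mulnC exprM lerXn2r ?nnegrE ?exprn_ge0//; first lra.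
by apply: le_trans le; rewrite exprn_ge0//; lra.
Qed.

Lemma minimal_chain_quasigeodesic (E : normedModType R) G (d : E -> R) e q B x y v N :
  (forall x, G x -> 0 < d x) -> chain G d e x y v N ->
  (forall i j, (i <= j)%N -> (j <= N)%N -> q ^+ (j - i) <= B * gsep d (v i) (v j)) ->
  quasigeodesic e q B 1 d v N.
Proof. by move=> pos [v0 vN vG vs] H; split=> // i iN; apply: pos; exact: vG. Qed.

(** A bound [B] on [gsep] makes the square of [msep] at most [B] times the product of the two values
    of [d']. Since [msep] dominates each of them, it is at most [B] times the other, which bounds
    the step at both ends. *)
Lemma image_quasigeodesic (E E' : normedModType R) G (d : E -> R) (d' : E' -> R) h
    e q B Q k x y v N : 0 <= Q -> coarse_map G d d' h e B k -> chain G d e x y v N ->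
  (forall i j, (i <= j)%N -> (j <= N)%N -> q ^+ (j - i) <= Q * gsep d (v i) (v j)) ->
  quasigeodesic B q (Q * B) k d' (h \o v) N.
Proof.
move=> Q0 [pos st pw] [v0 vN vG vs] H; split => [i iN|i iN|i j ij jN] /=.
- by have [] := pos _ (vG i iN).
- have Gi := vG i (ltnW iN); have GSi := vG i.+1 iN.
  have [_ pi] := pos _ Gi; have [_ pSi] := pos _ GSi.
  have := st _ _ Gi GSi (vs i iN).
  rewrite /gsep ler_pdivrMr ?mulr_gt0// expr2.
  have m0 := msep_gt0 pi pSi; set m := msep _ _ _ in m0 *.
  have mi : d' (h (v i)) <= m by rewrite /m /msep; have := normr_ge0 (h (v i) - h (v i.+1)); lra.
  have mSi : d' (h (v i.+1)) <= m by rewrite /m /msep; have := normr_ge0 (h (v i) - h (v i.+1)); lra.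
  have nm : `|h (v i) - h (v i.+1)| <= m by rewrite /m /msep; lra.
  move=> le; split; apply: (le_trans nm).
    rewrite -(ler_pM2r pSi); apply: le_trans (_ : m * m <= _); first by rewrite ler_pM2l.
    by apply: (le_trans le); rewrite mulrA.
  rewrite -(ler_pM2r pi); apply: le_trans (_ : m * m <= _); first by rewrite ler_pM2l.
  by apply: (le_trans le); rewrite mulrA mulrAC.
- apply: le_trans (H i j ij jN) _; rewrite -mulrA ler_wpM2l//.
  by apply: pw; apply: vG; natlia.
Qed.

(** Stability of quasigeodesics: minimal chains from [x] to [z] and from [z] to [y] join to a
    quasigeodesic because [z] is between the ends. Its image is a quasigeodesic through [h z], and
    [quasigeodesic_cones] reads betweenness off it. *)
Lemma zbetween_map e q B k A : 0 <= e -> 1 < q -> 1 <= B -> 0 <= A ->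
  exists2 A' : R, 1 <= A' & forall (E E' : normedModType R) G (d : E -> R) (d' : E' -> R) h,
    lip1 d -> lip1 d' -> log_chained G d e q B -> coarse_map G d d' h e B k ->
    forall x z y, G x -> G z -> G y -> zbetween d A x z y ->
      zbetween d' A' (h x) (h z) (h y).
Proof.
move=> e0 q1 B1 A0; have B0 : 0 <= B by lra.
have [C C1 HC] := @quasigeodesic_cones R e q B 1 e0 q1 B0.
pose Q := B + B * B * (4 * A * C * C) ^+ 2.
have Q0 : 0 <= Q by rewrite /Q addr_ge0//; apply: mulr_ge0; rewrite ?sqr_ge0//; exact: mulr_ge0.
have QB : B <= Q by rewrite /Q lerDl; apply: mulr_ge0; rewrite ?sqr_ge0//; exact: mulr_ge0.
have QB0 : 0 <= Q * B by rewrite mulr_ge0.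
have [A' A'1 HA'] := @quasigeodesic_cones R B q (Q * B) k B0 q1 QB0.
exists A' => // E E' G d d' h lip lip' LC cm x z y Gx Gz Gy bet.
have pos u : G u -> 0 < d u by case: cm => p _ _ /p [].
have [v [n [cv mv]]] := minimal_chain q1 LC Gx Gz.
have [w [m [cw mw]]] := minimal_chain q1 LC Gz Gy.
have cvw := chain_cat cv cw.
have [v0 vn vG vs] := cv; have [w0 wm wG ws] := cw.
have vw : v n = w 0%N by rewrite vn w0.
have [_ bv] := HC E d v n lip (minimal_chain_quasigeodesic pos cv mv).
have [_ bw] := HC E d w m lip (minimal_chain_quasigeodesic pos cw mw).
have QG i j : (i <= j)%N -> (j <= n + m)%N ->
    q ^+ (j - i) <= Q * gsep d (splice v w n i) (splice v w n j).
  move=> ij jN; have [jn|nj] := leqP j n.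
    rewrite !splice_l//; last exact: leq_trans jn.
    apply: le_trans (mv i j ij jn) _; rewrite ler_wpM2r//.
    by rewrite ltW// gsep_gt0//; apply/pos/vG; natlia.
  have [ni|ni] := leqP n i.
    rewrite (splice_r vw (ltnW nj)) (splice_r vw ni) (_ : (j - i = (j - n) - (i - n))%N); last by natlia.
    apply: le_trans (mw _ _ _ _) _; [natlia|natlia|].
    by rewrite ler_wpM2r// ltW// gsep_gt0//; apply/pos/wG; natlia.
  (* The piece passes through [z]. Both halves are bounded separately, and [zbetween_cat] bounds the
     product of their separations by [D ^+ 2] times that of [y1] and [y2]. *)
  rewrite (splice_l _ _ (ltnW ni)) (splice_r vw (ltnW nj)).
  set y1 := v i; set y2 := w (j - n)%N.
  have p1 : 0 < d y1 by apply/pos/vG; natlia.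
  have p2 : 0 < d y2 by apply/pos/wG; natlia.
  have px := pos _ Gx; have py := pos _ Gy; have pz := pos _ Gz.
  have h1 : zbetween d C x y1 z by have := bv i (ltnW ni); rewrite v0 vn.
  have h2 : zbetween d C z y2 y.
    by have := bw (j - n)%N; rewrite w0 wm; apply; natlia.
  have C0 : 0 <= C by lra_from C1.
  have := zbetween_cat px p1 pz p2 py A0 C0 C0 h1 h2 bet.
  rewrite /zbetween; set D := 4 * A * C * C.
  have D0 : 0 <= D by rewrite /D !mulr_ge0//.
  move=> h3; have le1 := mv i n (ltnW ni) (leqnn n).
  have le2 := mw 0%N (j - n)%N isT ltac:(natlia).
  rewrite vn in le1; rewrite w0 subn0 in le2.
  rewrite (_ : (j - i = (n - i) + (j - n))%N); last by natlia.
  rewrite exprD; apply: le_trans (ler_pM _ _ le1 le2) _; rewrite ?exprn_ge0//; [lra_from q1|lra_from q1|].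
  apply: (@le_trans _ _ (B * B * D ^+ 2 * gsep d y1 y2)); last first.
    by rewrite ler_wpM2r ?lerDr// ltW// gsep_gt0.
  rewrite mulrACA -[leRHS]mulrA ler_wpM2l ?mulr_ge0//.
  rewrite /gsep mulf_div ler_pdivrMr ?mulr_gt0//.
  rewrite (_ : _ * (d y1 * d z * (d z * d y2)) = (D * d z * msep d y1 y2) ^+ 2); last first.
    by field; rewrite !gt_eqF.
  rewrite -exprMn lerXn2r ?nnegrE//.
    by rewrite mulr_ge0// ltW// msep_gt0.
  by rewrite mulr_ge0 ?mulr_ge0// ltW// msep_gt0.
have qg := image_quasigeodesic Q0 cm cvw QG.
have [_ H] := HA' E' d' _ _ lip' qg.
have [s0 sN _ _] := cvw.
by have := H n (leq_addr _ _); rewrite /= s0 sN splice_l// vn.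
Qed.

End Chains.

(** * Betweenness for limit points *)

Section Hubs.
Context {R : realType}.
Implicit Types (A B C K q r s t e : R).

(** The pair [(x, x')] lies in the closure of the graph of [h] over [G]. This covers punctures and
    boundary points, which lie outside [G] and where [d] vanishes. *)
Definition graph_limit {E E' : normedModType R} (G : set E) (h : E -> E') x x' :=
  forall e, 0 < e -> exists u, [/\ G u, `|u - x| < e & `|h u - x'| < e].

Lemma graph_limit_in (E E' : normedModType R) (G : set E) (h : E -> E') x :
  G x -> graph_limit G h x (h x).
Proof. by move=> Gx e e0; exists x; rewrite !subrr !normr0. Qed.

Lemma zbetweenW (E : normedModType R) (d : E -> R) A B x z y :
  0 <= d x -> 0 <= d z -> 0 <= d y -> A <= B -> zbetween d A x z y -> zbetween d B x z y.
Proof.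
move=> dx dz dy AB h; apply: (le_trans h); apply: ler_wpM2r.
  by rewrite /msep; have := normr_ge0 (x - y); lra.
exact: ler_wpM2r.
Qed.

Lemma msep_ge0 (E : normedModType R) (d : E -> R) x y :
  (forall x, 0 <= d x) -> 0 <= msep d x y.
Proof. by move=> d0; rewrite /msep !addr_ge0. Qed.

Lemma msep_perturb (E : normedModType R) (d : E -> R) x y u v e :
  lip1 d -> `|u - x| <= e -> `|v - y| <= e -> msep d u v <= msep d x y + 4 * e.
Proof.
move=> lip ux vy; rewrite /msep; have := lip u x; have := lip v y.
have := ler_distD x u v; have := ler_distD y x v; rewrite (distrC y v); lra.
Qed.

(** Approximate [x] and [y] from [G]. As [0 < msep d x y], small perturbations keep betweenness with
    [A + 1] in place of [A]; on the image side the error tends to 0. *)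
Lemma zbetween_map_lim e q B k A : 0 <= e -> 1 < q -> 1 <= B -> 0 <= A ->
  exists2 A' : R, 1 <= A' & forall (E E' : normedModType R) G (d : E -> R) (d' : E' -> R) h,
    lip1 d -> lip1 d' -> (forall x, 0 <= d x) -> (forall x, 0 <= d' x) ->
    log_chained G d e q B -> coarse_map G d d' h e B k ->
    forall x x' z y y', graph_limit G h x x' -> G z -> graph_limit G h y y' ->
      0 < msep d x y -> zbetween d A x z y -> zbetween d' A' x' (h z) y'.
Proof.
move=> e0 q1 B1 A0; have A10 : 0 <= A + 1 by lra.
have [A' A'1 H] := @zbetween_map R e q B k (A + 1) e0 q1 B1 A10.
exists A' => // E E' G d d' h lip lip' dge dge' LC cm x x' z y y' lx Gz ly m0 bet.
have [dz dz'] : 0 < d z /\ 0 < d' (h z) by case: cm => p _ _; exact: p.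
apply/ler_addgt0Pr => eta eta0.
pose S := msep d x z + msep d z y + (A + 1) * d z + 4.
have S4 : 4 <= S.
  by rewrite /S; have := @msep_ge0 _ d x z dge; have := @msep_ge0 _ d z y dge; nra.
pose S' := msep d' x' (h z) + msep d' (h z) y' + A' * d' (h z) + 4.
have S'4 : 4 <= S'.
  by rewrite /S'; have := @msep_ge0 _ d' x' (h z) dge'; have := @msep_ge0 _ d' (h z) y' dge'; nra.
(* The entry with [S] makes the errors on the source side smaller than the gain [d z * msep d x y]
   from [A + 1]; the entry with [S'] keeps those on the image side below [eta]. *)
pose t := Num.min (Num.min 1 (d z * msep d x y / (4 * S))) (eta / (8 * S')) / 4.
have t0 : 0 < t.
  by rewrite /t divr_gt0// !lt_min ltr01 !divr_gt0// ?mulr_gt0//; lra_from S'4 S4.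
have [t1 [t2 t3]] : 4 * t <= 1 /\ 4 * t * (4 * S) <= d z * msep d x y /\
    4 * t * (8 * S') <= eta.
  have e4 : 4 * t = Num.min (Num.min 1 (d z * msep d x y / (4 * S))) (eta / (8 * S')).
    by rewrite /t mulrC divfK.
  rewrite e4; split; [|split].
  - by rewrite !ge_min lexx.
  - by rewrite -ler_pdivlMr ?ge_min ?lexx ?orbT//; lra_from S4.
  - by rewrite -ler_pdivlMr ?ge_min ?lexx ?orbT//; lra_from S'4.
have [u [Gu ux ux']] := lx t t0; have [v [Gv vy vy']] := ly t t0.
have zz : `|z - z| <= t by rewrite subrr normr0 ltW.
have zz' : `|h z - h z| <= t by rewrite subrr normr0 ltW.
have xu : `|x - u| <= t by rewrite distrC ltW.
have yv : `|y - v| <= t by rewrite distrC ltW.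
have xu' : `|x' - h u| <= t by rewrite distrC ltW.
have yv' : `|y' - h v| <= t by rewrite distrC ltW.
have n1 := msep_perturb lip (ltW ux) zz.
have n2 := msep_perturb lip zz (ltW vy).
have n3 := msep_perturb lip xu yv.
have buv : zbetween d (A + 1) u z v.
  rewrite /zbetween; apply: le_trans (ler_pM _ _ n1 n2) _; [exact: msep_ge0|exact: msep_ge0|].
  apply: (@le_trans _ _ ((A + 1) * d z * (msep d x y - 4 * t))); last first.
    by rewrite ler_wpM2l; [|rewrite mulr_ge0// ltW|lra_from n3].
  move: bet t2; rewrite /zbetween /S.
  have := @msep_ge0 _ d x z dge; have := @msep_ge0 _ d z y dge.
  have : 0 <= (A + 1) * d z by rewrite mulr_ge0// ltW.
  move: t1 (ltW t0); clear; move: (msep d x z) (msep d z y) (msep d x y) (d z).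
  move=> a b c w t1 t0 Aw b0 a0 ab t2.
  have := mulr_ge0 t0 a0; have := mulr_ge0 t0 b0; have := mulr_ge0 t0 Aw.
  have : t * (4 * t) <= t * 1 by rewrite ler_wpM2l.
  lra_from t0 ab t2.
have := H E E' G d d' h lip lip' LC cm u z v Gu Gz Gv buv; rewrite /zbetween.
have n1' := msep_perturb lip' xu' zz'.
have n2' := msep_perturb lip' zz' yv'.
have n3' := msep_perturb lip' (ltW ux') (ltW vy').
have n4' := msep_perturb lip' (ltW ux') zz'.
have n5' := msep_perturb lip' zz' (ltW vy').
move=> F; apply: le_trans (ler_pM _ _ n1' n2') _; [exact: msep_ge0|exact: msep_ge0|].
have F2 : A' * d' (h z) * msep d' (h u) (h v) <= A' * d' (h z) * (msep d' x' y' + 4 * t).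
  by rewrite ler_wpM2l// mulr_ge0; [|lra_from A'1|exact: ltW].
move: F F2 n4' n5' t3; rewrite /S'.
have := @msep_ge0 _ d' (h u) (h z) dge'; have := @msep_ge0 _ d' (h z) (h v) dge'.
have := @msep_ge0 _ d' x' (h z) dge'; have := @msep_ge0 _ d' (h z) y' dge'.
have : 0 <= A' * d' (h z) by rewrite mulr_ge0; [|lra_from A'1|exact: ltW].
move: t1 (ltW t0); clear.
move: (msep d' (h u) (h z)) (msep d' (h z) (h v)) (msep d' (h u) (h v)).
move: (msep d' x' (h z)) (msep d' (h z) y') (msep d' x' y') (d' (h z)).
move=> a b c w a1 b1 c1 t1 t0 Aw b0 a0 b10 a10 ab cw ha hb t3.
have := mulr_ge0 t0 a0; have := mulr_ge0 t0 b0; have := mulr_ge0 t0 Aw.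
have : t * (4 * t) <= t * 1 by rewrite ler_wpM2l.
have : t * a1 <= t * (a + 4 * t) by rewrite ler_wpM2l.
have : t * b1 <= t * (b + 4 * t) by rewrite ler_wpM2l.
lra_from t0 ab cw t3.
Qed.

(** In the product of the two separations, divide by the larger one: a point between [x] and [y] is
    as fat as it is close to the nearer of them. *)
Lemma zbetween_min (E : normedModType R) (d : E -> R) A x z y :
  0 < d z -> 0 <= d x -> 0 <= d y -> 0 <= A -> zbetween d A x z y ->
  msep d x z <= 2 * A * d z \/ msep d z y <= 2 * A * d z.
Proof.
move=> dz dx dy A0; rewrite /zbetween.
have tri : msep d x y <= msep d x z + msep d z y.
  by rewrite /msep; have := ler_distD z x y; lra.
have a0 : 0 < msep d x z by rewrite /msep; have := normr_ge0 (x - z); lra.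
have b0 : 0 < msep d z y by rewrite /msep; have := normr_ge0 (z - y); lra.
have Ad : 0 <= A * d z by rewrite mulr_ge0// ltW.
set a := msep d x z in tri a0 *; set b := msep d z y in tri b0 *.
move=> H; have {H} : a * b <= A * d z * (a + b) by apply: (le_trans H); exact: ler_wpM2l.
have [ab|ba] := leP a b => H.
  left; rewrite -(ler_pM2r b0); apply: (le_trans H).
  have : A * d z * a <= A * d z * b by exact: ler_wpM2l.
  lra.
right; rewrite -(ler_pM2r a0) mulrC; apply: (le_trans H).
have : A * d z * b <= A * d z * a by apply: ler_wpM2l => //; exact: ltW.
lra.
Qed.

Lemma zbetween_max (E : normedModType R) (d : E -> R) A x z y :
  0 < d z -> 0 <= d x -> 0 <= d y -> zbetween d A x z y ->
  msep d x z <= A * msep d x y.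
Proof.
move=> dz dx dy; rewrite /zbetween => H; rewrite -(ler_pM2r dz).
rewrite mulrAC; apply: le_trans H; rewrite ler_wpM2l//.
  by rewrite /msep; have := normr_ge0 (x - z); lra.
by rewrite /msep; have := normr_ge0 (z - y); lra.
Qed.

End Hubs.

(** * Hubs and ratios at a puncture *)

Section PuncturedRatio.
Context {R : realType}.
Implicit Types (A B C K q r s t e : R).

(* A hub for the puncture x and the point a is a fat point at distance about
   |x - a| from both; the root w plays the role of the point at infinity. *)
Definition hub {E : normedModType R} (d : E -> R) C x a z :=
  [/\ `|x - a| <= C * d z, d z <= C * `|x - a| & `|x - z| <= C * d z].

(** The hub is the first vertex [z] on a minimal chain from [a] to the root with
    [|x - a| <= K * d z]; being first bounds [d z] from above. By betweenness [z] is close to [a] or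
    to [w], and in the second case [w] itself is not far from [x]. *)
Lemma source_hub e q B K : 0 <= e -> 1 < q -> 0 <= B -> 1 <= K ->
  exists2 C, 1 <= C & forall (E : normedModType R) G (d : E -> R),
    lip1 d -> (forall x, 0 <= d x) -> (forall x, G x -> 0 < d x) ->
    log_chained G d e q B ->
    forall x a w, d x = 0 -> G a -> G w ->
      `|x - a| <= K * d w -> `|x - w| <= K * d w ->
    exists z, [/\ G z, hub d C x a z, zbetween d C x z w, zbetween d C a z w &
                  zbetween d C x z a].
Proof.
move=> e0 q1 B0 K1; have [C1 C11 HC] := @quasigeodesic_cones R e q B 1 e0 q1 B0.
pose C2 := 4 * K * C1 + 2 * C1; pose C3 := K + C2.
have KC : 1 <= K * C1 by rewrite -[leLHS]mulr1 ler_pM//.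
have C20 : 2 <= C2 by rewrite /C2; lra.
pose D := (C3 + 1) * (1 + e) * K.
have D0 : 0 <= D by rewrite /D /C3 !mulr_ge0//; lra.
pose A1 := (C3 + 1) * (D + 1); pose A3 := (C3 + 1) * ((2 * C2 + 2) * (1 + e)).
have A10 : 0 <= A1 by rewrite /A1 mulr_ge0//; rewrite /C3; lra.
have A30 : 0 <= A3 by rewrite /A3 mulr_ge0// ?mulr_ge0//; rewrite /C3; lra_from K1 C20 e0.
pose C := 1 + e + C1 + C3 + A1 + A3.
have C30 : 0 <= C3 by rewrite /C3; lra.
exists C; first by rewrite /C; lra.
move=> E G d lip dge dpos LC x a w dx Ga Gw xa xw.
have [v [N [cv mv]]] := minimal_chain q1 LC Ga Gw.
have qg := minimal_chain_quasigeodesic dpos cv mv.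
have [_ bet] := HC E d v N lip qg; have [v0 vN vG vs] := cv.
have exi : exists i, (i <= N)%N && (`|x - a| <= K * d (v i)) by exists N; rewrite leqnn vN.
case: (ex_minnP exi) => i /andP[iN xai] imin; set z := v i in xai.
have Gz : G z by exact: vG.
have dz := dpos z Gz; have dw := dpos w Gw; have da := dpos a Ga.
have bz : zbetween d C1 a z w by have := bet i iN; rewrite v0 vN.
have dax : d a <= `|x - a| by have := lip a x; rewrite dx add0r distrC.
have dza : d z <= (1 + e) * `|x - a|.
  have [i0|ipos] := posnP i.
    by rewrite /z i0 v0; apply: (le_trans dax); rewrite ler_peMl//; lra_from e0.
  have iE : i.-1.+1 = i by exact: prednK.
  have lt : K * d (v i.-1) < `|x - a|.
    rewrite ltNge; apply/negP => h; have := imin i.-1; rewrite h andbT.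
    by move=> /(_ ltac:(natlia)); natlia.
  have [h _] := vs i.-1 ltac:(natlia); rewrite iE -/z in h.
  have := lip z (v i.-1); rewrite distrC => h2.
  have di : d (v i.-1) <= K * d (v i.-1) by rewrite ler_peMl.
  apply: (@le_trans _ _ ((1 + e) * d (v i.-1))); first lra_from h h2.
  by apply: ler_wpM2l; lra_from e0 lt di.
have az : `|a - z| <= C2 * d z.
  have [h|h] := zbetween_min dz (dge a) (dge w) (le_trans ler01 C11) bz.
    apply: (@le_trans _ _ (2 * C1 * d z)).
      by move: h; rewrite /msep; lra_from dz da.
    by rewrite ler_wpM2r ?ltW// /C2; lra_from KC.
  have zw : `|z - w| <= 2 * C1 * d z by move: h; rewrite /msep; lra_from dz dw.
  have dwz : d w <= 2 * C1 * d z by move: h; rewrite /msep; have := normr_ge0 (z - w); lra_from dz.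
  have := ler_distD x a z; have := ler_distD w x z.
  rewrite (distrC a x) (distrC w z).
  have : K * d w <= K * (2 * C1 * d z) by rewrite ler_wpM2l//; lra_from K1.
  by rewrite /C2; lra_from xa xw zw.
have xz : `|x - z| <= C3 * d z.
  by have := ler_distD a x z; rewrite /C3; lra_from xai az.
have mxz : msep d x z <= (C3 + 1) * d z by rewrite /msep dx; lra_from xz.
have mza : msep d z a <= (2 * C2 + 2) * d z.
  by rewrite /msep distrC; have := lip a z; lra_from az.
have scale : (C3 + 1) * d z <= D * d w.
  apply: (@le_trans _ _ ((C3 + 1) * ((1 + e) * (K * d w)))).
    rewrite ler_wpM2l//; first lra_from C30.
    by apply: (le_trans dza); rewrite ler_wpM2l//; lra_from e0.
  by rewrite /D le_eqVlt; apply/orP; left; apply/eqP; ring.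
have xw0 : d w <= msep d x w by rewrite /msep dx; have := normr_ge0 (x - w); lra_from.
have mge u u' : 0 <= msep d u u' by exact: msep_ge0.
have hubz : hub d C x a z.
  split.
  - by apply: (le_trans xai); rewrite ler_wpM2r ?ltW// /C /C3; lra_from e0 C11 C20 A10 A30.
  - by apply: (le_trans dza); rewrite ler_wpM2r// /C; lra_from C11 A10 A30 C30.
  - by apply: (le_trans xz); rewrite ler_wpM2r ?ltW// /C; lra_from e0 C11 A10 A30.
have CA1 : A1 <= C by rewrite /C; lra_from e0 C11 A30 C30.
have CC1 : C1 <= C by rewrite /C; lra_from e0 A10 A30 C30.
have CA3 : A3 <= C by rewrite /C; lra_from e0 C11 A10 C30.
exists z; split=> //.
- apply: (zbetweenW _ _ _ CA1) => //; rewrite /zbetween.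
  have mzw : msep d z w <= (D + 1) * msep d x w.
    have : D * d w <= D * msep d x w by rewrite ler_wpM2l.
    have : msep d z w <= msep d x z + msep d x w.
      by rewrite /msep; have := ler_distD x z w; rewrite (distrC z x); have := dge z; lra_from dx.
    lra_from mxz scale.
  apply: le_trans (ler_pM _ _ mxz mzw) _ => //.
  by rewrite /A1 le_eqVlt; apply/orP; left; apply/eqP; ring.
- exact: (zbetweenW _ _ _ CC1).
- apply: (zbetweenW _ _ _ CA3) => //; rewrite /zbetween.
  have {}mza : msep d z a <= (2 * C2 + 2) * (1 + e) * msep d x a.
    apply: (le_trans mza); rewrite -mulrA ler_wpM2l//; first lra_from C20.
    apply: (le_trans dza); rewrite ler_wpM2l//; first lra_from e0.
    by rewrite /msep dx; lra_from da.
  apply: le_trans (ler_pM _ _ mxz mza) _ => //.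
  by rewrite /A3 le_eqVlt; apply/orP; left; apply/eqP; ring.
Qed.

(** Betweenness survives the map, so it is what the image hub must be recovered from. The first two
    relations put [z] close to [x] and [a] unless it is close to the root, which dominates both
    distances; the third bounds [d z] from above. *)
Lemma image_hub A K : 1 <= A -> 1 <= K ->
  exists2 C, 1 <= C & forall (E : normedModType R) (d : E -> R),
    lip1 d -> (forall x, 0 <= d x) ->
    forall x a w z, d x = 0 -> 0 < d z ->
      `|x - a| <= K * d w -> `|x - w| <= K * d w ->
      zbetween d A x z w -> zbetween d A a z w -> zbetween d A x z a ->
    hub d C x a z.
Proof.
move=> A1 K1; pose C := 6 * K * A + 4 * A; have KA : 1 <= K * A by rewrite -[leLHS]mulr1 ler_pM.
exists C; first by rewrite /C; lra.
have A0 : 0 <= A by lra.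
move=> E d lip dge x a w z dx dz xa xw b1 b2 b3.
have xz : `|x - z| <= (2 * K * A + 2 * A) * d z.
  have [|h|h] := zbetween_min dz _ (dge w) A0 b1; first by rewrite dx.
    move: h; rewrite /msep dx; have : 0 <= K * A * d z by rewrite mulr_ge0//; lra.
    lra.
  have dw : d w <= 2 * A * d z by move: h; rewrite /msep; have := normr_ge0 (z - w); lra.
  have : K * d w <= K * (2 * A * d z) by rewrite ler_wpM2l//; lra.
  have := ler_distD w x z; rewrite (distrC w z); move: h; rewrite /msep; have := dge w; lra.
have az : `|a - z| <= (4 * K * A + 2 * A) * d z.
  have [h|h] := zbetween_min dz (dge a) (dge w) A0 b2.
    move: h; rewrite /msep; have : 0 <= K * A * d z by rewrite mulr_ge0//; lra.
    have := dge a; lra.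
  have dw : d w <= 2 * A * d z by move: h; rewrite /msep; have := normr_ge0 (z - w); lra.
  have : K * d w <= K * (2 * A * d z) by rewrite ler_wpM2l//; lra.
  have := ler_distD w x z; have := ler_distD x a z; rewrite (distrC w z) (distrC a x).
  by move: h; rewrite /msep; have := dge w; lra.
have KAd : 0 <= K * A * d z by rewrite mulr_ge0//; lra.
have Ad : 0 <= A * d z by rewrite mulr_ge0//; lra.
split.
- by have := ler_distD z x a; rewrite (distrC z a) /C; lra.
- have dx0 : 0 <= d x by rewrite dx.
  have := zbetween_max dz dx0 (dge a) b3.
  have : d a <= `|x - a| by have := lip a x; rewrite dx add0r distrC.
  rewrite /msep dx => da h; have : A * (`|x - a| + 0 + d a) <= A * (2 * `|x - a|).
    by rewrite ler_wpM2l//; lra_from da.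
  have : 0 <= K * A * `|x - a| by rewrite mulr_ge0//; lra_from KA.
  have : 0 <= A * `|x - a| by rewrite mulr_ge0.
  by have := normr_ge0 (x - z); rewrite /C; lra_from h.
- by apply: (le_trans xz); rewrite ler_wpM2r ?ltW// /C; lra_from A1 KA.
Qed.

(** With r and s the distances of [x] to [a] and [b], the hubs have sizes about r and s and [msep]
    about the larger s, so [gsep] is about s^2 / (r s) = s / r. *)
Lemma hub_gsep (E : normedModType R) (d : E -> R) C x a b za zb :
  1 <= C -> 0 < d za -> 0 < d zb -> hub d C x a za -> hub d C x b zb ->
  `|x - a| <= `|x - b| ->
  `|x - b| / `|x - a| <= C ^+ 2 * gsep d za zb /\
  gsep d za zb <= 16 * (C + 1) ^+ 8 * (`|x - b| / `|x - a|).
Proof.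
move=> C1 pa pb [a1 a2 a3] [b1 b2 b3] ab.
have r0 : 0 < `|x - a|.
  rewrite lt_neqAle normr_ge0 andbT; apply/eqP => e; move: a2; rewrite -e mulr0; lra.
have s0 : 0 < `|x - b| by exact: lt_le_trans ab.
split.
  rewrite ler_pdivrMr// /gsep mulrAC mulrA ler_pdivlMr ?mulr_gt0//.
  have m1 : d zb <= msep d za zb by rewrite /msep; have := normr_ge0 (za - zb); lra.
  apply: (@le_trans _ _ ((C * d zb) * ((C * `|x - a|) * d zb))).
    apply: ler_pM => //; first by rewrite mulr_ge0// ltW.
    by apply: ler_wpM2r => //; exact: ltW.
  rewrite (_ : _ * (_ * d zb) = C ^+ 2 * d zb ^+ 2 * `|x - a|); last by ring.
  rewrite [leLHS]mulrAC; apply: ler_wpM2l; first by rewrite mulr_ge0 ?sqr_ge0.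
  by rewrite lerXn2r ?nnegrE//; [exact: ltW|exact: le_trans (ltW pb) m1].
rewrite /gsep ler_pdivrMr ?mulr_gt0//.
set r := `|x - a| in a1 a2 r0 ab *; set s := `|x - b| in b1 b2 s0 ab *.
have m : msep d za zb <= 4 * (C + 1) ^+ 2 * s.
  have := ler_distD x za zb; rewrite (distrC za x) /msep.
  have : C * d za <= C * (C * r) by rewrite ler_wpM2l//; lra.
  have : C * d zb <= C * (C * s) by rewrite ler_wpM2l//; lra.
  have : C * r <= C * s by rewrite ler_wpM2l//; lra.
  have : C * (C * r) <= C * (C * s) by rewrite ler_wpM2l ?ler_wpM2l//; lra_from C1.
  have : 0 <= C * s by rewrite mulr_ge0//; lra_from C1 s0.
  have : 0 <= C * (C * s) by rewrite !mulr_ge0//; lra_from C1 s0.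
  rewrite expr2; lra_from a3 b3 a2 b2 s0.
have m0 : 0 <= msep d za zb by rewrite /msep; have := normr_ge0 (za - zb); lra.
have c1 : 1 <= C + 1 by lra.
apply: (@le_trans _ _ ((4 * (C + 1) ^+ 2 * s) ^+ 2)).
  by rewrite lerXn2r ?nnegrE ?mulr_ge0 ?exprn_ge0//; lra_from C1 s0.
have h1 : r <= (C + 1) * d za by apply: (le_trans a1); rewrite ler_wpM2r ?ltW//; lra_from.
have h2 : s <= (C + 1) * d zb by apply: (le_trans b1); rewrite ler_wpM2r ?ltW//; lra_from.
have h3 : (C + 1) ^+ 4 <= (C + 1) ^+ 6 by apply: ler_weXn2l.
rewrite (_ : (4 * (C + 1) ^+ 2 * s) ^+ 2 = 16 * (C + 1) ^+ 4 * (s / r) * (r * s)); last first.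
  by field; rewrite gt_eqF.
have sr0 : 0 <= s / r by rewrite divr_ge0// ltW.
apply: (@le_trans _ _ (16 * (C + 1) ^+ 6 * (s / r) * (r * s))).
  apply: ler_wpM2r; first by rewrite mulr_ge0 ?ltW.
  by apply: ler_wpM2r => //; apply: ler_wpM2l.
rewrite (_ : 16 * (C + 1) ^+ 8 * (s / r) * (d za * d zb) =
  16 * (C + 1) ^+ 6 * (s / r) * (((C + 1) * d za) * ((C + 1) * d zb))); last by ring.
have c6 : 0 <= 16 * (C + 1) ^+ 6 by rewrite mulr_ge0 ?exprn_ge0//; lra_from C1.
apply: ler_wpM2l; first exact: mulr_ge0 c6 sr0.
by apply: ler_pM => //; exact: ltW.
Qed.

End PuncturedRatio.

Section Ratio.
Context {R : realType}.
Implicit Types (A B C K q r s t e : R).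

(** The separation of hubs does not tell which one is nearer to [x]. This relation survives the map
    and fixes the order up to a constant. *)
Lemma hub_zbetween (E : normedModType R) (d : E -> R) C x a b za zb :
  (forall u, 0 <= d u) -> d x = 0 -> 1 <= C -> hub d C x a za -> hub d C x b zb ->
  `|x - a| <= `|x - b| -> zbetween d ((C + 1) * ((C + 1) * (C * C + 1))) x za zb.
Proof.
move=> dge dx C1 [a1 a2 a3] [b1 b2 b3] ab; rewrite /zbetween.
have h1 : d za <= C * (C * d zb).
  apply: (le_trans a2); rewrite ler_wpM2l//; first lra.
  exact: le_trans ab b1.
have m1 : msep d x za <= (C + 1) * d za by rewrite /msep dx; lra.
have m3 : d zb <= msep d x zb by rewrite /msep dx; have := normr_ge0 (x - zb); lra.
have C0 : 0 <= (C + 1) * (C * C + 1).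
  by rewrite mulr_ge0// ?addr_ge0 ?mulr_ge0//; lra_from C1.
have m2 : msep d za zb <= (C + 1) * (C * C + 1) * msep d x zb.
  apply: (@le_trans _ _ ((C + 1) * (C * C + 1) * d zb)); last exact: ler_wpM2l.
  have : (C + 1) * d za <= (C + 1) * (C * (C * d zb)) by rewrite ler_wpM2l//; lra.
  have := ler_distD x za zb; rewrite (distrC za x) /msep; lra.
apply: le_trans (ler_pM _ _ m1 m2) _; rewrite ?msep_ge0//.
by rewrite le_eqVlt; apply/orP; left; apply/eqP; ring.
Qed.

(** Here [u] and [v] are the ratios in source and image, [g] and [g'] the separations of the hubs.
    The power of [v] matches [contracting_ratio_bound]. *)
Lemma expanding_ratio_bound (c B M g g' u v : R) k : 1 <= c -> 1 <= B -> 1 <= M ->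
  1 <= u -> 0 <= v -> 0 <= g -> (1 <= v -> v <= c ^+ 2 * g') ->
  g' <= B * g ^+ k -> g <= M * u ->
  v ^+ k <= (c ^+ 2 * (B * M ^+ k)) ^+ k * u ^+ (k * k).
Proof.
move=> c1 B1 M1 u1 v0 g0 hv hg' hg.
have ge1M a b : 1 <= a -> 1 <= b -> 1 <= a * b :> R.
  by move=> ha hb; rewrite -[leLHS]mulr1; apply: ler_pM.
have C1 : 1 <= c ^+ 2 * (B * M ^+ k) by rewrite !ge1M// exprn_ege1.
have uk : 1 <= u ^+ k by exact: exprn_ege1.
suff main : v <= c ^+ 2 * (B * M ^+ k) * u ^+ k.
  by rewrite exprM -exprMn lerXn2r ?nnegrE//; apply: mulr_ge0; lra.
have [v1|v1] := leP 1 v; last first.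
  by apply: (le_trans (ltW v1)); exact: ge1M.
apply: (le_trans (hv v1)); rewrite -mulrA ler_wpM2l ?sqr_ge0//.
apply: (le_trans hg'); rewrite -mulrA -exprMn; apply: ler_wpM2l; first lra.
by rewrite lerXn2r ?nnegrE//; apply: mulr_ge0; lra.
Qed.

(** For [v <= 1] the separations bound [u^-1] by a power of [v^-1], which controls only [v ^+ k].
    For [v] between 1 and [H] they are bounded, so [u] is bounded below and a constant multiple of
    it suffices. *)
Lemma contracting_ratio_bound (c B M H g u v : R) k : 1 <= B -> 1 <= M ->
  1 <= H -> 0 < u -> 0 < v -> 0 <= g -> v <= H -> u^-1 <= c ^+ 2 * (B * g ^+ k) ->
  (v <= 1 -> g <= M * v^-1) -> (1 <= v -> g <= M * v) ->
  v ^+ k <= (c ^+ 2 * (B * M ^+ k) + H ^+ k * (c ^+ 2 * (B * (M * H) ^+ k))) * u.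
Proof.
move=> B1 M1 H1 u0 v0 g0 vH hu h1 h2.
have M0 : 0 <= M by lra. have H0 : 0 <= H by lra. have B0 : 0 <= B by lra.
have P1 : 0 <= c ^+ 2 * (B * M ^+ k).
  by rewrite mulr_ge0 ?sqr_ge0// mulr_ge0// exprn_ge0.
have P2 : 0 <= H ^+ k * (c ^+ 2 * (B * (M * H) ^+ k)).
  by rewrite mulr_ge0 ?exprn_ge0// mulr_ge0 ?sqr_ge0// mulr_ge0// exprn_ge0// mulr_ge0.
have mono x : 0 <= x -> g <= x -> u^-1 <= c ^+ 2 * (B * x ^+ k).
  move=> x0 gx; apply: (le_trans hu); rewrite ler_wpM2l ?sqr_ge0// ler_wpM2l//.
  by rewrite lerXn2r ?nnegrE.
have [v1|v1] := leP v 1.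
  have vi0 : 0 <= v^-1 by rewrite invr_ge0 ltW.
  have := mono _ (mulr_ge0 M0 vi0) (h1 v1).
  rewrite exprMn exprVn !mulrA ler_pdivlMr ?exprn_gt0// ler_pdivrMl// mulrC => h3.
  apply: (le_trans h3); rewrite [leRHS]mulrDl -[X in X <= _]addr0; apply: lerD => //.
  by have := mulr_ge0 P2 (ltW u0); rewrite !mulrA.
have := mono _ (mulr_ge0 M0 H0) (le_trans (h2 (ltW v1)) (ler_wpM2l M0 vH)).
rewrite -[X in X <= _]mul1r ler_pdivrMr// => h3.
apply: (@le_trans _ _ (H ^+ k * 1)).
  by rewrite mulr1 lerXn2r ?nnegrE// ltW.
apply: (@le_trans _ _ (H ^+ k * (c ^+ 2 * (B * (M * H) ^+ k)) * u)).
  by rewrite -mulrA ler_wpM2l// exprn_ge0.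
by apply: ler_wpM2r; [exact: ltW|rewrite lerDr].
Qed.

Lemma punctured_ratio e q B k K : 0 <= e -> 1 < q -> 1 <= B -> 1 <= K ->
  exists2 C, 1 <= C & forall (E E' : normedModType R) G (d : E -> R) (d' : E' -> R) h,
    lip1 d -> lip1 d' -> (forall x, 0 <= d x) -> (forall x, 0 <= d' x) ->
    log_chained G d e q B -> coarse_map G d d' h e B k ->
    (forall u v, G u -> G v -> gsep d' (h u) (h v) <= B * gsep d u v ^+ k) ->
    forall x x' a b w, graph_limit G h x x' -> d x = 0 -> d' x' = 0 ->
      G a -> G b -> G w ->
      `|x - a| <= K * d w -> `|x - b| <= K * d w -> `|x - w| <= K * d w ->
      `|x' - h a| <= K * d' (h w) -> `|x' - h b| <= K * d' (h w) ->
      `|x' - h w| <= K * d' (h w) ->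
      (`|x' - h a| / `|x' - h b|) ^+ k <=
        C * Num.max (`|x - a| / `|x - b|) ((`|x - a| / `|x - b|) ^+ (k * k)).
Proof.
move=> e0 q1 B1 K1; have B0 : 0 <= B by lra.
have [c c1 Hs] := @source_hub R e q B K e0 q1 B0 K1.
pose A := c + (c + 1) * ((c + 1) * (c * c + 1)).
have A4 : 0 <= (c + 1) * ((c + 1) * (c * c + 1)).
  by rewrite mulr_ge0// ?mulr_ge0// ?addr_ge0 ?mulr_ge0//; lra_from c1.
have A0 : 0 <= A by rewrite /A; lra.
have [A' A'1 Hb] := @zbetween_map_lim R e q B k A e0 q1 B1 A0.
have [c' c'1 Hi] := @image_hub R A' K A'1 K1.
have [M M1 ME] : exists2 M : R, 1 <= M & M = 16 * (c + 1) ^+ 8.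
  by eexists; last reflexivity; have : 1 <= (c + 1) ^+ 8 by [rewrite exprn_ege1//; lra_from c1]; lra_from.
have [M' M'1 ME'] : exists2 M : R, 1 <= M & M = 16 * (c' + 1) ^+ 8.
  by eexists; last reflexivity; have : 1 <= (c' + 1) ^+ 8 by [rewrite exprn_ege1//; lra_from c'1]; lra_from.
have [H H1 HE] : exists2 H : R, 1 <= H & H = c' * (A' * ((c' + 1) * c')).
  eexists; last reflexivity; rewrite -[leLHS]mulr1; apply: ler_pM => //.
  rewrite -[leLHS]mulr1; apply: ler_pM => //.
  by rewrite -[leLHS]mulr1; apply: ler_pM => //; lra_from c'1.
have ge1M u v : 1 <= u -> 1 <= v -> 1 <= u * v :> R.
  by move=> hu hv; rewrite -[leLHS]mulr1; apply: ler_pM.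
have [C C1 CE] : exists2 C : R, 1 <= C & C = (c' ^+ 2 * (B * M ^+ k)) ^+ k.
  by eexists; last reflexivity; rewrite exprn_ege1// !ge1M// exprn_ege1.
have [C' C'1 CE'] : exists2 C : R, 1 <= C &
    C = c ^+ 2 * (B * M' ^+ k) + H ^+ k * (c ^+ 2 * (B * (M' * H) ^+ k)).
  eexists; last reflexivity; rewrite -[leLHS]addr0; apply: lerD.
    by rewrite !ge1M// exprn_ege1.
  by apply: (le_trans ler01); rewrite !ge1M ?exprn_ege1// ge1M.
exists (C + C'); first by lra_from C1 C'1.
move=> E E' G d d' h lip lip' dge dge' LC cm up x x' a b w lx dx dx' Ga Gb Gw xa xb xw xa' xb' xw'.
have dpos u : G u -> 0 < d u by case: cm => p _ _ /p [].
have dpos' u : G u -> 0 < d' (h u) by case: cm => p _ _ /p [].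
have m0 u : G u -> 0 < msep d x u.
  by move=> /dpos; rewrite /msep dx; have := normr_ge0 (x - u); lra_from.
have m0' u v : G u -> G v -> 0 < msep d u v.
  by move=> /dpos pu /dpos; exact: msep_gt0.
have lim u : G u -> graph_limit G h u (h u) by exact: graph_limit_in.
have cA : c <= A by rewrite /A; lra_from A4.
have betw x1 x1' z y1 y1' : graph_limit G h x1 x1' -> G z -> graph_limit G h y1 y1' ->
    0 < msep d x1 y1 -> zbetween d A x1 z y1 -> zbetween d' A' x1' (h z) y1'.
  exact: (Hb E E' G d d' h lip lip' dge dge' LC cm).
have hubs u : G u -> `|x - u| <= K * d w -> `|x' - h u| <= K * d' (h w) ->
    exists z, [/\ G z, hub d c x u z & hub d' c' x' (h u) (h z)].
  move=> Gu xu xu'.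
  have [z [Gz hz b1 b2 b3]] := Hs E G d lip dge dpos LC x u w dx Gu Gw xu xw.
  exists z; split => //; apply: (Hi E' d' lip' dge' x' (h u) (h w) (h z) dx' (dpos' z Gz) xu' xw').
  - by apply: betw (lx) Gz (lim w Gw) (m0 w Gw) _; apply: (zbetweenW _ _ _ cA).
  - by apply: betw (lim u Gu) Gz (lim w Gw) (m0' u w Gu Gw) _; apply: (zbetweenW _ _ _ cA).
  - by apply: betw (lx) Gz (lim u Gu) (m0 u Gu) _; apply: (zbetweenW _ _ _ cA).
have [za [Gza ha ha']] := hubs a Ga xa xa'.
have [zb [Gzb hb hb']] := hubs b Gb xb xb'.
have pos1 (E0 : normedModType R) (d0 : E0 -> R) c0 x0 a0 z0 : 0 < d0 z0 -> hub d0 c0 x0 a0 z0 ->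
    0 < `|x0 - a0|.
  move=> p [_ h2 _]; rewrite lt_neqAle normr_ge0 andbT; apply/eqP => e1.
  by move: h2; rewrite -e1 mulr0; lra_from p.
have pza := dpos za Gza; have pzb := dpos zb Gzb.
have pza' := dpos' za Gza; have pzb' := dpos' zb Gzb.
have r0 := pos1 _ _ _ _ _ _ pza ha; have s0 := pos1 _ _ _ _ _ _ pzb hb.
have r0' := pos1 _ _ _ _ _ _ pza' ha'; have s0' := pos1 _ _ _ _ _ _ pzb' hb'.
have [_ _ lowpow] := cm.
have gab := gsep_ge1 pza pzb; have gab' := gsep_ge1 pza' pzb'.
have gs0 := gsep_gt0 pza pzb; have gs0' := gsep_gt0 pza' pzb'.
have [gu gu'] : 0 <= gsep d za zb /\ 0 <= gsep d' (h za) (h zb).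
  by split; apply/ltW/gsep_gt0.
have t0 : 0 < `|x - a| / `|x - b| by rewrite divr_gt0.
have t0' : 0 < `|x' - h a| / `|x' - h b| by rewrite divr_gt0.
have [sr|rs] := leP `|x - b| `|x - a|.
  have t1 : 1 <= `|x - a| / `|x - b| by rewrite ler_pdivlMr ?mul1r.
  have [_ gM] := hub_gsep c1 pzb pza hb ha sr; rewrite -ME in gM.
  apply: (@le_trans _ _ (C * (`|x - a| / `|x - b|) ^+ (k * k))); last first.
    apply: ler_pM; first exact: le_trans C1.
    - by rewrite exprn_ge0// ltW.
    - by rewrite lerDl; exact: le_trans C'1.
    - by rewrite le_max lexx orbT.
  rewrite CE; apply: (expanding_ratio_bound (g := gsep d zb za) (g' := gsep d' (h zb) (h za))) => //.
- by rewrite gsepC.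
- rewrite ler_pdivlMr// mul1r => sr'.
  by have [] := hub_gsep c'1 pzb' pza' hb' ha' sr'.
- exact: up.
have ltrs := ltW rs.
have b4 := hub_zbetween dge dx c1 ha hb ltrs.
have b4' : zbetween d' A' x' (h za) (h zb).
  apply: betw (lx) Gza (lim zb Gzb) (m0 zb Gzb) _.
  by apply: (zbetweenW _ _ _ _ b4) => //; rewrite /A lerDr (le_trans ler01).
have [lo _] := hub_gsep c1 pza pzb ha hb ltrs.
(* When [a] is the nearer point, the ratio in the image might still exceed 1; betweenness of the
   hubs bounds it by [H]. *)
have Hrs' : `|x' - h a| <= H * `|x' - h b|.
  have dx'0 : 0 <= d' x' by rewrite dx'.
  have mx := zbetween_max pza' dx'0 (dge' _) b4'.
  move: ha' hb' => [a1 a2 a3] [_ b2 b3].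
  have n1 : d' (h za) <= msep d' x' (h za) by rewrite /msep dx' addr0 lerDr.
  have n2 : msep d' x' (h zb) <= (c' + 1) * (c' * `|x' - h b|).
    apply: (@le_trans _ _ ((c' + 1) * d' (h zb))).
      by rewrite /msep dx' addr0 mulrDl mul1r lerD2r.
    by rewrite ler_wpM2l// addr_ge0// (le_trans ler01).
  apply: (le_trans a1); rewrite HE -!mulrA ler_wpM2l//; first exact: le_trans c'1.
  apply: (le_trans n1); apply: (le_trans mx).
  by rewrite ler_wpM2l// (le_trans ler01).
apply: (@le_trans _ _ (C' * (`|x - a| / `|x - b|))); last first.
  apply: ler_pM; first exact: le_trans C'1.
  - exact: ltW.
  - by rewrite lerDr; exact: le_trans C1.
  - by rewrite le_max lexx.
rewrite CE'; apply: (contracting_ratio_bound (g := gsep d' (h za) (h zb))) => //.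
- by rewrite ler_pdivrMr.
- by rewrite invf_div; apply: (le_trans lo); rewrite ler_wpM2l ?sqr_ge0//; exact: lowpow.
- rewrite ler_pdivrMr// mul1r invf_div => rs'.
  by have [_] := hub_gsep c'1 pza' pzb' ha' hb' rs'; rewrite -ME'.
- rewrite ler_pdivlMr// mul1r gsepC => sr'.
  by have [_] := hub_gsep c'1 pzb' pza' hb' ha' sr'; rewrite -ME'.
Qed.

End Ratio.

(** * Uniform domains and their punctures *)

Section UniformChains.
Context {R : realType}.
Implicit Types (c q B s t l e : R).

Lemma dcomp_lip1 (E : normedModType R) (G : set E) : ~` G !=set0 -> lip1 (dcomp G).
Proof. by move=> nG x y; exact: dcomp_lip. Qed.

Lemma uniform_param c (E : normedModType R) (D : set E) z1 z2 :
  open D -> ~` D !=set0 -> uniform_domain c D -> D z1 -> D z2 ->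
  exists l (sg : R -> E), [/\ 0 <= l <= Num.max 1 c * `|z1 - z2|,
    sg 0 = z1 /\ sg l = z2, (forall s, 0 <= s <= l -> D (sg s)),
    (forall s t, 0 <= s <= l -> 0 <= t <= l -> `|sg s - sg t| <= `|s - t|) &
    (forall s, 0 <= s <= l -> Num.min s (l - s) <= Num.max 1 c * dcomp D (sg s))].
Proof.
move=> oD nD unif D1 D2; have [b [gam [arc cig len]]] := unif z1 z2 D1 D2.
have [b0 cg _ Dg [g0 gb fin_len]] := arc.
have [sg Hsg] := arclength_param_ex arc.
have [l0 s0 sl Ds lip] := arclength_param arc Hsg.
exists (arclen gam 0 b), sg; split=> //.
  rewrite l0/=; have := len; rewrite (arclen_fin fin_len)// lee_fin => h.
  by apply: (le_trans h); rewrite ler_wpM2r// le_max lexx orbT.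
move=> s sl'; have Dss := Ds s sl'; have /andP[s0' s1] := sl'.
have [t /andP[t0 tb] tE] := arclen_surj fin_len cg b0 s0' s1.
have tin : 0 <= t <= b by rewrite t0.
have := cig t tin; rewrite (arclen_fin fin_len)// (arclen_fin fin_len)//.
have -> : arclen gam t b = arclen gam 0 b - s.
  by rewrite (arclenD fin_len (lexx 0) t0 tb (lexx b)) tE addrAC subrr add0r.
rewrite tE -EFin_min lee_fin.
have <- : sg s = gam t by rewrite -(Hsg t tin) -/(arclen gam 0 t) tE.
rewrite bdistE// => h; apply: (le_trans h); rewrite ler_wpM2r ?dcomp_ge0//.
by rewrite le_max lexx orbT.
Qed.

(** Sample the curve at [(q ^+ i - 1) * d1]. The cone condition and the Lipschitz property give
    [d1 + s <= (1 + 2 * c) * d (sg s)], and [q] is chosen so that a gap of [(q - 1) * (d1 + s)] is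
    then at most [e / 2] times [d]. *)
Lemma cone_chain (E : normedModType R) (D : set E) (d : E -> R) c e l
    (sg : R -> E) : 0 < e -> e <= 1 -> 1 <= c -> lip1 d -> 0 <= l -> 0 < d (sg 0) ->
  (forall s, 0 <= s <= l -> D (sg s)) ->
  (forall s t, 0 <= s <= l -> 0 <= t <= l -> `|sg s - sg t| <= `|s - t|) ->
  (forall s, 0 <= s <= l -> s <= c * d (sg s)) ->
  let q := 1 + e / 2 / (1 + 2 * c) in
  exists v N, chain D d e (sg 0) (sg l) v N /\ q ^+ N * d (sg 0) <= q * (d (sg 0) + l).
Proof.
move=> e0 e1 c1 lip l0 d0 Ds sl cone q; set d1 := d (sg 0) in d0 *.
have c20 : 0 < 1 + 2 * c by lra.
have q1 : 1 < q by rewrite /q ltrDl !divr_gt0.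
have qc : (q - 1) * (1 + 2 * c) = e / 2 by rewrite /q; field; rewrite gt_eqF.
pose s i := Num.min l ((q ^+ i - 1) * d1).
have sE i : 0 <= s i <= l.
  rewrite /s le_min ge_min l0 lexx /= andbT; apply: mulr_ge0; last exact: ltW.
  by rewrite subr_ge0 exprn_ege1// ltW.
have mono i : s i <= s i.+1.
  rewrite /s le_min ge_min lexx /= ge_min; apply/orP; right.
  apply: ler_wpM2r; first exact: ltW.
  by rewrite lerD2r; apply: ler_weXn2l; [exact: ltW|].
have gap i : s i.+1 - s i <= (q - 1) * (d1 + s i).
  rewrite /s; have [h|h] := leP l ((q ^+ i - 1) * d1).
    have : Num.min l ((q ^+ i.+1 - 1) * d1) <= l by rewrite ge_min lexx.
    have : 0 <= (q - 1) * (d1 + l) by rewrite mulr_ge0//; lra.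
    lra.
  have : Num.min l ((q ^+ i.+1 - 1) * d1) <= (q ^+ i.+1 - 1) * d1.
    by rewrite ge_min lexx orbT.
  rewrite exprS; lra.
have fat i : d1 + s i <= (1 + 2 * c) * d (sg (s i)).
  have := lip (sg 0) (sg (s i)); rewrite -/d1.
  have /andP[si0 sil] := sE i.
  have := sl 0 (s i); rewrite lexx l0 sE => /(_ isT isT).
  rewrite sub0r normrN (ger0_norm si0).
  have := cone (s i) (sE i); lra.
have st i : step d e (sg (s i)) (sg (s i.+1)).
  have h1 : `|sg (s i) - sg (s i.+1)| <= e / 2 * d (sg (s i)).
    apply: (le_trans (sl _ _ (sE i) (sE i.+1))).
    rewrite ler0_norm ?subr_le0// opprB; apply: (le_trans (gap i)).
    rewrite -qc -mulrA ler_wpM2l//; first by rewrite subr_ge0 ltW.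
  have p : 0 <= d (sg (s i)).
    by have := fat i; have /andP[si0 _] := sE i; rewrite -(pmulr_rge0 _ c20); lra.
  have := lip (sg (s i)) (sg (s i.+1)); rewrite /step.
  have : e * d (sg (s i)) <= 1 * d (sg (s i)) by rewrite ler_wpM2r.
  have : 0 <= e * d (sg (s i)) by rewrite mulr_ge0// ltW.
  move=> a1 a2 a3; split; first lra_from h1 a1.
  have : d (sg (s i)) <= 2 * d (sg (s i.+1)) by lra.
  move=> a4; have : e * d (sg (s i)) <= e * (2 * d (sg (s i.+1))).
    by apply: ler_wpM2l => //; exact: ltW.
  lra_from h1.
have exN : exists N, l <= (q ^+ N - 1) * d1.
  have [N hN] := exp_dominates (l / d1 + 1) q1; exists N.
  by rewrite -ler_pdivrMr// lerBrDr.
case: (ex_minnP exN) => N hN Nmin.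
exists (fun i => sg (s i)), N; split.
  split=> //.
  - by rewrite /s expr0 subrr mul0r min_r.
  - by rewrite /s min_l.
  - by move=> i _; exact: Ds.
case: N hN Nmin => [|N] hN Nmin.
  rewrite expr0; have : 1 * (d1 + l) <= q * (d1 + l); last lra.
  by apply: ler_wpM2r; lra_from l0 d0 q1.
have : (q ^+ N - 1) * d1 < l by rewrite ltNge; apply/negP => /Nmin; rewrite ltnn.
rewrite exprS -mulrA => h; apply: ler_wpM2l; lra_from q1 h.
Qed.

(** Run [cone_chain] from both ends to the middle of the uniform arc. Multiplying the two counts
    gives [msep] squared over [d x * d y]. The bound [q <= 3 / 2] keeps the steps of [radial_chain]
    within one half. *)
Lemma uniform_log_chained c e : 0 < e -> e <= 1 ->
  exists q B, [/\ 1 < q, q <= 3 / 2, 1 <= B &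
    forall (E : normedModType R) (D : set E), open D -> ~` D !=set0 ->
      uniform_domain c D -> log_chained D (dcomp D) e q B].
Proof.
move=> e0 e1; set c1 := Num.max 1 c; have c11 : 1 <= c1 by rewrite le_max lexx.
have c20 : 0 < 1 + 2 * c1 by lra.
pose q := 1 + e / 2 / (1 + 2 * c1).
have q1 : 1 < q by rewrite /q ltrDl !divr_gt0.
exists q, (q ^+ 2 * c1 ^+ 2); split=> //.
- have : e / 2 / (1 + 2 * c1) <= 1 / 2; last by rewrite /q; lra.
  by rewrite ler_pdivrMr//; lra.
- rewrite -[leLHS]mulr1; apply: ler_pM => //; apply: exprn_ege1 => //; exact: ltW.
move=> E D oD nD unif x y Dx Dy.
have [l [sg [/andP[l0 ll] [s0 sl] Ds lip cig]]] := uniform_param oD nD unif Dx Dy.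
rewrite -/c1 in ll cig; set d := dcomp D in cig *; have lipd : lip1 d by exact: dcomp_lip1.
have dx : 0 < d x by exact: dcomp_gt0. have dy : 0 < d y by exact: dcomp_gt0.
have l20 : 0 <= l / 2 by rewrite divr_ge0.
have [||||v [N [cv hv]]] := @cone_chain E D d c1 e (l / 2) sg e0 e1 c11 lipd l20.
- by rewrite s0.
- by move=> s hs; apply: Ds; lra.
- by move=> s t hs ht; apply: lip; lra_from hs ht.
- by move=> s hs; have := cig s; rewrite min_l; [apply; lra_from hs|lra_from hs].
have [||||w [M [cw hw]]] := @cone_chain E D d c1 e (l / 2) (fun s => sg (l - s)) e0 e1 c11 lipd l20.
- by rewrite subr0 sl.
- by move=> s hs; apply: Ds; lra_from hs.
- move=> s t hs ht; apply: le_trans (lip _ _ _ _) _; [lra_from hs|lra_from ht|].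
  by rewrite (_ : l - s - (l - t) = t - s) ?(distrC t)//; lra_from.
- by move=> s hs; have := cig (l - s); rewrite min_r; [rewrite opprB addrCA subrr addr0; apply; lra_from hs|lra_from hs].
rewrite -/q s0 in cv hv; rewrite -/q subr0 sl in cw hw.
rewrite (_ : l - l / 2 = l / 2) in cw; last by lra_from.
have cvw := chain_cat cv (chain_rev cw).
eexists; exists (N + M)%N; split; first exact: cvw.
rewrite /gsep mulrA ler_pdivlMr ?mulr_gt0//.
have nxy := normr_ge0 (x - y).
have a1 : d x + l / 2 <= c1 * msep d x y.
  rewrite /msep; have : d x <= c1 * d x by rewrite ler_peMl// ltW.
  have : 0 <= c1 * d y by rewrite mulr_ge0// ?ltW//; lra_from c11.
  lra_from l0 ll.
have a2 : d y + l / 2 <= c1 * msep d x y.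
  rewrite /msep; have : d y <= c1 * d y by rewrite ler_peMl// ltW.
  have : 0 <= c1 * d x by rewrite mulr_ge0// ?ltW//; lra_from c11.
  lra_from l0 ll.
have q0 : 0 < q by lra_from q1.
rewrite exprD mulrACA (_ : q ^+ 2 * c1 ^+ 2 * _ = (q * (c1 * msep d x y)) * (q * (c1 * msep d x y))); last by ring.
have p0 : 0 <= q ^+ N by rewrite exprn_ge0// ltW.
have p1 : 0 <= q ^+ M by rewrite exprn_ge0// ltW.
apply: ler_pM; [by rewrite mulr_ge0// ltW|by rewrite mulr_ge0// ltW| |].
  by apply: (le_trans hv); rewrite ler_pM2l.
by apply: (le_trans hw); rewrite ler_pM2l.
Qed.

End UniformChains.

(** * Chains around a puncture *)

Section Puncture.
Context {R : realType} {E : normedModType R}.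
Implicit Types (u w p x : E) (r s t : R) (D : set E).

Lemma indep_ex u : dim_ge2 E -> u != 0 -> exists w, forall a b : R,
  a *: u + b *: w = 0 -> a = 0 /\ b = 0.
Proof.
move=> [e1 [e2 He]] u0.
have out w : ~ (exists c : R, w = c *: u) -> forall a b : R,
    a *: u + b *: w = 0 -> a = 0 /\ b = 0.
  move=> nw a b; have [->|b0] := eqVneq b 0.
    by rewrite scale0r addr0 => /eqP; rewrite scaler_eq0 (negPf u0) orbF => /eqP ->.
  move=> h; case: nw; exists (- (b^-1 * a)).
  rewrite scaleNr -scalerA; have -> : a *: u = - (b *: w).
    by apply/eqP; rewrite -addr_eq0 h.
  by rewrite scalerN opprK scalerA mulVf// scale1r.
have [[c hc]|/out] := pselect (exists c : R, e1 = c *: u); last by exists e1.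
have [[c' hc']|/out] := pselect (exists c : R, e2 = c *: u); last by exists e2.
have [|_ /eqP] := He c' (- c).
  by rewrite hc hc' !scalerA mulNr scaleNr mulrC subrr.
rewrite oppr_eq0 => /eqP c0; have [|/eqP] := He 1 0.
  by rewrite hc c0 !scale0r scaler0 addr0.
by rewrite oner_eq0.
Qed.

(* Intermediate value theorem along a path from u to - u avoiding 0. *)
Lemma equidistant_ex u : dim_ge2 E -> u != 0 -> exists w,
  [/\ `|w| = `|u|, `|u| <= `|w - u| & `|u| <= `|w + u|].
Proof.
move=> dim2 u0; have [w indep] := indep_ex dim2 u0.
have nu0 : 0 < `|u| by rewrite normr_gt0.
pose y t := (1 - 2 * t) *: u + (t * (1 - t)) *: w.
have y0 t : y t != 0.
  apply/eqP => /indep [h1 h2]; have h3 : t = 1 / 2 by lra.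
  by move: h2; rewrite h3 => /eqP; rewrite mulf_eq0 => /orP[] /eqP; lra.
have ycont : continuous y.
  move=> t; apply: cvgD; apply: cvgZr_tmp.
    by apply: cvgB; [exact: cvg_cst|apply: cvgM; [exact: cvg_cst|exact: cvg_id]].
  by apply: cvgM; [exact: cvg_id|apply: cvgB; [exact: cvg_cst|exact: cvg_id]].
(* This is [|y t|] times the difference of the distances from the normalized vector [c] to [u] and
   to [- u], written without division. *)
pose F t := `| `|u| *: y t - `|y t| *: u | - `| `|u| *: y t + `|y t| *: u |.
have Fcont : continuous F.
  move=> t; have c1 : `|u| *: y s @[s --> t] --> `|u| *: y t by apply: cvgZl_tmp; exact: ycont.
  have c2 : `|y s| *: u @[s --> t] --> `|y t| *: u.
    by apply: cvgZr_tmp; apply: cvg_norm; exact: ycont.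
  by apply: cvgB; apply: cvg_norm; [exact: cvgB|exact: cvgD].
have nn : `| `|u| *: u + `|u| *: u| = 2 * `|u| ^+ 2.
  by rewrite -scalerDl normrZ ger0_norm ?addr_ge0//; ring.
have F0 : F 0 = - (2 * `|u| ^+ 2).
  rewrite /F /y mulr0 subr0 scale1r mul0r scale0r addr0 subrr normr0 sub0r.
  by rewrite nn.
have F1 : F 1 = 2 * `|u| ^+ 2.
  have y1 : y 1 = - u.
    rewrite /y subrr mulr0 scale0r addr0 mulr1 (_ : 1 - 2 = - 1 :> R); last by lra.
    by rewrite scaleN1r.
  by rewrite /F y1 normrN scalerN addNr normr0 subr0 -opprD normrN nn.
have [||t _ Ft] := @IVT R F 0 1 0 ler01.
- exact: continuous_subspaceT.
- rewrite F0 F1; have : 0 <= `|u| ^+ 2 by [].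
  by move=> h; rewrite ge_min le_max; apply/andP; split; apply/orP; [left|right]; lra.
have ny : 0 < `|y t| by rewrite normr_gt0.
pose c := (`|u| / `|y t|) *: y t.
have cu : `|c| = `|u|.
  by rewrite /c normrZ ger0_norm ?divr_ge0// divfK// gt_eqF.
have eqd : `|c - u| = `|c + u|.
  move: Ft; rewrite /F => /eqP; rewrite subr_eq0 => /eqP.
  have h (v : E) : `| `|u| *: y t + `|y t| *: v | = `|y t| * `|c + v|.
    have yy : `|y t| *: c = `|u| *: y t by rewrite /c scalerA mulrC divfK// gt_eqF.
    by rewrite -yy -scalerDr normrZ normr_id.
  by rewrite -scalerN !h => /(mulfI (lt0r_neq0 ny)).
have : `|(c + u) - (c - u)| <= `|c + u| + `|c - u| by exact: ler_normB.
rewrite opprB (addrC c u) addrACA subrr addr0 -mulr2n normrMn => h.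
have h2 : 2 * `|u| <= `|c + u| + `|c - u| by rewrite mulr_natl (addrC c).
by exists c; split=> //; lra_from eqd h2.
Qed.

(** A point of small norm n on the segment has [|1 - 2 * t| * |p| <= n], so it is within n of the
    midpoint, whose norm is at least [|p| / 4]. *)
Lemma segment_norm p w t : `|p| = `|w| -> `|p| / 2 <= `|p + w| -> 0 <= t <= 1 ->
  `|p| / 8 <= `|(1 - t) *: p + t *: w| <= `|p|.
Proof.
move=> pw h /andP[t0 t1]; apply/andP; split; last first.
  apply: (le_trans (ler_normD _ _)); rewrite !normrZ -pw !ger0_norm//; lra.
set n := `|_ + _|; rewrite leNgt; apply/negP => lt.
have h1 : `|1 - 2 * t| * `|p| <= n.
  have := ler_dist_dist ((1 - t) *: p) (- (t *: w)).
  rewrite opprK normrN !normrZ -pw (ger0_norm t0) ger0_norm; last lra.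
  by rewrite -mulrBl normrM (ger0_norm (normr_ge0 p)) (_ : 1 - t - t = 1 - 2 * t)//; ring.
have e : (1 - t) *: p + t *: w = (1 / 2) *: (p + w) + ((1 - 2 * t) / 2) *: (p - w).
  have gen (a k : R) : a *: (p + w) + k *: (p - w) = (a + k) *: p + (a - k) *: w.
    by rewrite !scalerDr scalerN addrACA -scalerDl -scalerBl.
  by rewrite gen; congr (_ *: _ + _ *: _); field.
have : `|(1 / 2) *: (p + w)| <= n + `|((1 - 2 * t) / 2) *: (p - w)|.
  by rewrite -{1}[(1 / 2) *: _](addrK (((1 - 2 * t) / 2) *: (p - w))) -e; exact: ler_normB.
rewrite !normrZ ger0_norm; last lra.
rewrite (_ : `|2^-1| = 2^-1 :> R); last by rewrite ger0_norm.
have : `|1 - 2 * t| * `|p - w| <= `|1 - 2 * t| * (2 * `|p|).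
  by rewrite ler_wpM2l// (le_trans (ler_normB _ _))// -pw; lra.
lra.
Qed.

Section Annulus.
Variables (D : set E) (x : E).
Hypotheses (dim2 : dim_ge2 E) (nD : ~` D !=set0) (Dx : D x) (oD : open D).
Let G := D `\` [set x].
Let d := dcomp D.
Let dG := dcomp G.

Lemma nG : ~` G !=set0. Proof. by exists x => -[_ /(_ erefl)]. Qed.

Lemma dG_le z : dG z <= d z.
Proof. by apply: dcomp_ge => // w Dw; apply: dcomp_le => -[]. Qed.

Lemma dG_lex z : dG z <= `|z - x|.
Proof. by apply: dcomp_le => -[_ /(_ erefl)]. Qed.

Lemma dG_ge z r : r <= d z -> r <= `|z - x| -> r <= dG z.
Proof.
move=> h1 h2; apply: dcomp_ge => [|w Gw]; first exact: nG.
have [->//|wx] := pselect (w = x).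
by apply: (le_trans h1); apply: dcomp_le => Dw; apply: Gw; split.
Qed.

Lemma puncture_open : open G.
Proof.
rewrite /G setDE; apply: openI => //; apply: closed_openC.
by apply: compact_closed; [exact: norm_hausdorff|exact: compact_set1].
Qed.

Lemma d_pos : 0 < d x. Proof. exact: dcomp_gt0. Qed.

Lemma dG_inner z : `|z - x| <= d x / 2 -> dG z = `|z - x|.
Proof.
move=> h; apply/eqP; rewrite eq_le dG_lex dG_ge//.
by have := dcomp_lip x z nD; rewrite -/d (distrC x); lra.
Qed.

Lemma G_inner z : z != x -> `|z - x| <= d x / 2 -> G z.
Proof.
move=> zx h; split; last exact/eqP.
by apply: (@dcomp_ball _ _ D x); rewrite distrC -/d; have := d_pos; lra.
Qed.

Lemma segment_chain p w : p != 0 -> `|p| = `|w| -> `|p| <= d x / 2 ->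
  `|p| / 2 <= `|p + w| ->
  exists v, chain G dG (1 / 2) (x + p) (x + w) v 32.
Proof.
move=> p0 pw hp h; have np : 0 < `|p| by rewrite normr_gt0.
(* The segment has length at most [2 * |p|], so 32 pieces give steps of at most [|p| / 16], half of
   the lower bound [|p| / 8] for the distance to [x]. *)
pose v i : E := x + ((1 - i%:R / 32) *: p + (i%:R / 32) *: w).
have ti i : (i <= 32)%N -> 0 <= (i%:R / 32 : R) <= 1.
  by move=> i32; rewrite divr_ge0//= ler_pdivrMr// mul1r ler_nat.
have vn i : (i <= 32)%N -> `|p| / 8 <= `|v i - x| <= `|p|.
  by move=> /ti i01; rewrite /v addrAC subrr add0r; exact: segment_norm.
have vG i : (i <= 32)%N -> dG (v i) = `|v i - x|.
  by move=> /vn /andP[h1 h2]; apply: dG_inner; lra.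
exists v; split.
- by rewrite /v mul0r subr0 scale1r scale0r addr0.
- by rewrite /v divff// subrr scale0r add0r scale1r.
- move=> i /vn /andP[h1 h2]; apply: G_inner; last lra.
  by rewrite -subr_eq0 -normr_gt0; lra.
move=> i i32; have /andP[a1 a2] := vn i (ltnW i32); have /andP[b1 b2] := vn i.+1 i32.
have st : `|v i - v i.+1| <= `|p| / 16.
  have gen (t t' : R) : x + ((1 - t) *: p + t *: w) - (x + ((1 - t') *: p + t' *: w)) =
      (t' - t) *: (p - w).
    rewrite opprD addrACA subrr add0r opprD addrACA -!scalerBl scalerBr -scaleNr.
    by congr (_ *: _ + _ *: _); ring.
  rewrite /v gen (_ : i.+1%:R / 32 - i%:R / 32 = 1 / 32); last by rewrite -natr1; field.
  rewrite normrZ ger0_norm//; have := ler_normB p w; rewrite -pw; lra_from nD Dx oD G.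
by rewrite /step (vG _ (ltnW i32)) (vG _ i32); split; lra_from a1 a2 st b1.
Qed.

(** If [w] is nearly opposite to [p], the segment passes too close to [x]. The detour through the
    equidistant [c] works: [c] is far from [- p], and also from [- w], which is near [p]. *)
Lemma sphere_chain p w : p != 0 -> `|p| = `|w| -> `|p| <= d x / 2 ->
  exists v N, chain G dG (1 / 2) (x + p) (x + w) v N /\ (N <= 64)%N.
Proof.
move=> p0 pw hp; have [h|h] := leP (`|p| / 2) `|p + w|.
  by have [v cv] := segment_chain p0 pw hp h; exists v, 32.
have [c [cp h1 h2]] := equidistant_ex dim2 p0.
have [|v cv] := segment_chain p0 (esym cp) hp.
  by rewrite addrC; apply: le_trans h2; have := normr_ge0 p; lra.
have c0 : c != 0 by rewrite -normr_gt0 cp normr_gt0.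
have [|||w' cw] := @segment_chain c w c0; rewrite ?cp//.
  have := ler_normB (c + w) (p + w); rewrite opprD addrACA subrr addr0.
  by have := normr_ge0 p; lra.
by eexists; exists (32 + 32)%N; split; first exact: chain_cat cv cw.
Qed.

Lemma radial_chain q p r : 1 < q -> q <= 3 / 2 -> p != 0 -> 1 <= r ->
  r * `|p| <= d x / 2 ->
  exists v N, chain G dG (1 / 2) (x + p) (x + r *: p) v N /\ q ^+ N <= q * r.
Proof.
move=> q1 q32 p0 r1 hr; have np : 0 < `|p| by rewrite normr_gt0.
pose s i := Num.min r (q ^+ i); pose v i : E := x + s i *: p.
have s1 i : 1 <= s i by rewrite le_min r1 exprn_ege1// ltW.
have sr i : s i <= r by rewrite ge_min lexx.
have vn i : `|v i - x| = s i * `|p|.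
  by rewrite /v addrAC subrr add0r normrZ ger0_norm// (le_trans ler01).
have vG i : dG (v i) = s i * `|p|.
  rewrite -vn; apply: dG_inner; rewrite vn; apply: le_trans hr.
  by rewrite ler_pM2r.
have mono i : s i <= s i.+1.
  rewrite le_min sr /= ge_min; apply/orP; right.
  by apply: ler_weXn2l; [exact: ltW|].
have gap i : s i.+1 <= q * s i.
  rewrite /s; have [h|h] := leP r (q ^+ i); rewrite ge_min exprS ?lexx ?orbT//.
  by apply/orP; left; rewrite ler_peMl// ?ltW//; lra.
have exN : exists N, r <= q ^+ N by have [N hN] := exp_dominates r q1; exists N.
case: (ex_minnP exN) => N hN Nmin; exists v, N; split.
  split.
  - by rewrite /v /s expr0 min_r// scale1r.
  - by rewrite /v /s min_l.
  - move=> i _; apply: G_inner.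
      by rewrite -subr_eq0 -normr_gt0 vn mulr_gt0// (lt_le_trans ltr01).
    by rewrite vn; apply: le_trans hr; rewrite ler_pM2r.
  move=> i _; have vv : `|v i - v i.+1| = (s i.+1 - s i) * `|p|.
    rewrite /v opprD addrACA subrr add0r -scalerBl normrZ distrC ger0_norm//.
    by rewrite subr_ge0.
  have h1 : (s i.+1 - s i) * `|p| <= 1 / 2 * (s i * `|p|).
    rewrite mulrA; apply: ler_wpM2r => //.
    have : q * s i <= 3 / 2 * s i by rewrite ler_wpM2r// (le_trans ler01).
    have := gap i; lra.
  have h2 : s i * `|p| <= s i.+1 * `|p| by rewrite ler_wpM2r.
  by rewrite /step !vG vv; split; lra_from hN h1 h2.
case: N hN Nmin => [|N] hN Nmin.
  by rewrite expr0 -[leLHS]mulr1; apply: ler_pM => //; exact: ltW.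
rewrite exprS ler_pM2l; last by lra.
by apply: ltW; rewrite ltNge; apply/negP => /Nmin; rewrite ltnn.
Qed.

Lemma inner_chain q u w : 1 < q -> q <= 3 / 2 -> u != x ->
  `|u - x| <= `|w - x| -> `|w - x| <= d x / 2 ->
  exists v N, chain G dG (1 / 2) u w v N /\
    q ^+ N <= q ^+ 65 * (`|w - x| / `|u - x|).
Proof.
move=> q1 q32 ux uw wd; have nu : 0 < `|u - x| by rewrite normr_gt0 subr_eq0.
have p0 : u - x != 0 by rewrite subr_eq0.
set r := `|w - x| / `|u - x|; have r1 : 1 <= r by rewrite ler_pdivlMr// mul1r.
have rE : r * `|u - x| = `|w - x| by rewrite divfK// gt_eqF.
have [|v [N [cv hv]]] := radial_chain q1 q32 p0 r1; first by rewrite rE.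
have n' : `|r *: (u - x)| = `|w - x| by rewrite normrZ ger0_norm ?rE// (le_trans ler01).
have [|||v' [M [cv' hM]]] := @sphere_chain (r *: (u - x)) (w - x); rewrite ?n'//.
  by rewrite -normr_gt0 n'; exact: lt_le_trans uw.
rewrite (addrC x (u - x)) subrK in cv; rewrite (addrC x (w - x)) subrK in cv'.
eexists; exists (N + M)%N; split; first exact: chain_cat cv cv'.
(* One factor [q] comes from the radial part, 64 from the spherical part. *)
rewrite exprD (_ : q ^+ 65 = q * q ^+ 64); last exact: exprS.
rewrite mulrAC; apply: ler_pM => //.
- by rewrite exprn_ge0//; lra.
- by rewrite exprn_ge0//; lra.
- by apply: ler_weXn2l => //; exact: ltW.
Qed.

(** From [d x <= 4 * |z - x|] follows [d z <= 5 * |z - x|], so away from [x] the puncture shrinks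
    the distance to the complement at most by the factor 5. Steps of size 1 / 20 leave ample
    room. *)
Lemma puncture_step u w : G u -> G w -> d x / 4 <= `|u - x| -> d x / 4 <= `|w - x| ->
  step d (1 / 20) u w -> step dG (1 / 2) u w.
Proof.
have fat z : d x / 4 <= `|z - x| -> d z / 5 <= dG z.
  move=> h; have := dcomp_lip z x nD; rewrite -/d => l.
  have := normr_ge0 (z - x); have := dcomp_ge0 z nD; rewrite -/d => l0 l1.
  by apply: dG_ge; lra.
move=> Gu Gw /fat fu /fat fw [h1 h2].
have := dcomp_ge0 u nD; have := dcomp_ge0 w nD; rewrite -/d => l0 l1.
by split; lra.
Qed.

Lemma puncture_gsep u w : G u -> G w -> d x / 4 <= `|u - x| -> d x / 4 <= `|w - x| ->
  gsep d u w <= 25 * gsep dG u w.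
Proof.
have fat z : d x / 4 <= `|z - x| -> d z <= 5 * dG z.
  move=> h; have := dcomp_lip z x nD; rewrite -/d => l.
  have := normr_ge0 (z - x); have := dcomp_ge0 z nD; rewrite -/d => l0 l1.
  suff : d z / 5 <= dG z by lra.
  by apply: dG_ge; lra.
move=> Gu Gw /fat fu /fat fw.
have pu : 0 < dG u by apply: dcomp_gt0 => //; [exact: puncture_open|exact: nG].
have pw : 0 < dG w by apply: dcomp_gt0 => //; [exact: puncture_open|exact: nG].
have du := dG_le u; have dw := dG_le w.
rewrite /gsep mulrA; apply: ler_pM; rewrite ?sqr_ge0//.
- by rewrite invr_ge0 mulr_ge0//; lra.
- rewrite (_ : 25 * _ = (5 * msep dG u w) ^+ 2); last by ring.
  have m0 : 0 <= msep d u w by rewrite /msep; have := normr_ge0 (u - w); lra.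
  have m1 : msep d u w <= 5 * msep dG u w by rewrite /msep; have := normr_ge0 (u - w); lra.
  by rewrite lerXn2r ?nnegrE//; exact: le_trans m1.
- rewrite lef_pV2 ?posrE ?mulr_gt0//; [|lra_from pu du|lra_from pw dw].
  by apply: ler_pM => //; exact: ltW.
Qed.

Lemma annulus_chain (q : R) u w : 1 < q -> q <= 3 / 2 ->
  d x / 4 <= `|u - x| <= d x / 2 -> d x / 4 <= `|w - x| <= d x / 2 ->
  exists v N, chain G dG (1 / 2) u w v N /\ q ^+ N <= q ^+ 65 * 2.
Proof.
move=> q1 q32; wlog uw : u w / `|u - x| <= `|w - x|.
  move=> W hu hw; have [h|h] := leP `|u - x| `|w - x|; first exact: W.
  have [v [N [cv hv]]] := W w u (ltW h) hw hu.
  by exists (fun i => v (N - i)%N), N; split=> //; exact: chain_rev.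
move=> /andP[u1 u2] /andP[w1 w2]; have dx := d_pos.
have nu : 0 < `|u - x| by lra.
have [|v [N [cv hv]]] := inner_chain q1 q32 _ uw w2; first by rewrite -subr_eq0 -normr_gt0.
exists v, N; split=> //; apply: (le_trans hv); rewrite ler_wpM2l//.
  by rewrite exprn_ge0//; lra.
by rewrite ler_pdivrMr//; lra.
Qed.

(** Cut out everything from the first to the last vertex near [x]. Steps are so short that the
    vertices just before and just after lie in the annulus between [d x / 4] and [d x / 2], where
    [annulus_chain] reconnects them at bounded cost. *)
Lemma outer_chain q B : 1 < q -> q <= 3 / 2 -> 1 <= B ->
  log_chained D d (1 / 20) q B -> forall u w, G u -> G w ->
  d x / 4 <= `|u - x| -> d x / 4 <= `|w - x| ->
  exists v N, chain G dG (1 / 2) u w v N /\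
    q ^+ N <= q ^+ 65 * 2 * (B * (25 * gsep dG u w)).
Proof.
move=> q1 q32 B1 LC u w Gu Gw u1 w1; have dx := d_pos.
have [v [N [cv hv]]] := LC u w (proj1 Gu) (proj1 Gw).
have [v0 vN vD vs] := cv.
have hv' : q ^+ N <= B * (25 * gsep dG u w).
  by apply: (le_trans hv); rewrite ler_wpM2l ?puncture_gsep//; lra.
have q65 : 1 <= q ^+ 65 * 2 by have : 1 <= q ^+ 65; [apply: exprn_ege1; exact: ltW|lra].
have qN0 : 0 <= q ^+ N by rewrite exprn_ge0//; lra.
have inG z : D z -> d x / 4 <= `|z - x| -> G z.
  by move=> Dz h; split=> // zx; move: h; rewrite /= zx subrr normr0; lra_from dx cv.
pose far i := d x / 4 <= `|v i - x|.
have sub i j : (i <= j)%N -> (j <= N)%N -> (forall l, (i <= l <= j)%N -> far l) ->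
    chain G dG (1 / 2) (v i) (v j) (fun l => v (i + l)%N) (j - i).
  move=> ij jN hf; split; rewrite ?addn0 ?subnKC//.
    by move=> l h; apply: inG; [apply: vD; natlia|apply: hf; natlia].
  move=> l h; rewrite addnS; have f1 : far (i + l)%N by apply: hf; natlia.
  have f2 : far (i + l).+1 by apply: hf; natlia.
  by apply: puncture_step => //; [apply: inG|apply: inG|apply: vs] => //; try (apply: vD); natlia.
have [allfar|] := pselect (forall i, (i <= N)%N -> far i).
  exists (fun l => v (0 + l)%N), (N - 0)%N; split.
    by rewrite -{1}v0 -{1}vN; apply: sub => // l /andP[_ ?]; exact: allfar.
  by rewrite subn0; apply: (le_trans hv'); apply: ler_peMl => //; exact: le_trans hv'.
move=> /existsNP[i1 /not_implyP[i1N ni1]].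
have ex1 : exists i, (i <= N)%N && ~~ far i by exists i1; rewrite i1N; apply/negP.
have bnd i : (i <= N)%N && ~~ far i -> (i <= N)%N by case/andP.
case: (ex_minnP ex1) => i /andP[iN ni] imin.
case: (ex_maxnP ex1 bnd) => j /andP[jN nj] jmax.
have f0 : far 0%N by rewrite /far v0.
have fN : far N by rewrite /far vN.
have ipos : (0 < i)%N by rewrite lt0n; apply/eqP => i0; move: ni; rewrite i0 f0.
have jlt : (j < N)%N by rewrite ltn_neqAle jN andbT; apply/eqP => e; move: nj; rewrite e fN.
have ij : (i <= j)%N by apply: jmax; rewrite iN.
have farl l : (l < i)%N -> far l.
  move=> li; apply: contraT => nl; have := imin l; rewrite nl andbT.
  by move=> /(_ ltac:(natlia)); natlia.
have farr l : (j < l)%N -> (l <= N)%N -> far l.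
  by move=> jl lN; apply: contraT => nl; have := jmax l; rewrite nl lN; natlia.
have near_in l m : (l <= N)%N -> ~~ far l -> far m -> step d (1 / 20) (v l) (v m) ->
    d x / 4 <= `|v m - x| <= d x / 2.
  move=> lN; rewrite /far -ltNge => h1 h2 [s1 s2]; rewrite h2 /=.
  have := dcomp_lip (v l) x nD; rewrite -/d => h3.
  have := ler_distD (v l) (v m) x; rewrite (distrC (v m) (v l)); lra_from h1 h2 s1 h3.
have pin : d x / 4 <= `|v i.-1 - x| <= d x / 2.
  apply: (near_in i) => //; first by apply: farl; natlia.
  by apply: step_sym; have := vs i.-1; rewrite (prednK ipos); apply; natlia.
have jin : d x / 4 <= `|v j.+1 - x| <= d x / 2.
  by apply: (near_in j) => //; [apply: farr; natlia|exact: vs].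
have [v' [M [cM hM]]] := annulus_chain q1 q32 pin jin.
have c1 : chain G dG (1 / 2) (v 0%N) (v i.-1) (fun l => v (0 + l)%N) (i.-1 - 0).
  by apply: sub; [natlia|natlia|move=> l h; apply: farl; natlia].
have c3 : chain G dG (1 / 2) (v j.+1) (v N) (fun l => v (j.+1 + l)%N) (N - j.+1).
  by apply: sub; [natlia|natlia|move=> l h; apply: farr; natlia].
have := chain_cat c1 (chain_cat cM c3); rewrite v0 vN => c.
eexists; eexists; split; first exact: c.
apply: (@le_trans _ _ (q ^+ M * q ^+ N)).
  by rewrite -exprD; apply: ler_weXn2l; [exact: ltW|natlia].
by apply: ler_pM => //; rewrite exprn_ge0//; lra_from oD G B q1 q32.
Qed.

(** The mixed case, [u] near [x] and [w] away from it, leaves radially to [u'] at distance [d x / 4]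
    and continues with [outer_chain]. The radial cost [r] is paid for because [dG u] is at most
    [|u - x|], smaller than [dG u'] by the factor [r]; the 9 is the square of the factor 3 lost in
    [msep]. *)
Lemma puncture_log_chained q B : 1 < q -> q <= 3 / 2 -> 1 <= B ->
  log_chained D d (1 / 20) q B ->
  log_chained G dG (1 / 2) q (9 * (q * (q ^+ 65 * 2 * (B * 25)))).
Proof.
move=> q1 q32 B1 LC u w Gu Gw; have dx := d_pos.
have q65 : 1 <= q ^+ 65 by apply: exprn_ege1; exact: ltW.
set K := q ^+ 65 * 2 * (B * 25).
have KB : q ^+ 65 <= K.
  rewrite /K -mulrA ler_peMr//; first exact: le_trans q65.
  lra.
have K0 : 0 <= K by apply: le_trans KB; exact: le_trans q65.
have qK : K <= q * K by rewrite ler_peMl// ltW.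
have pos z : G z -> 0 < dG z.
  by move=> Gz; apply: dcomp_gt0 => //; [exact: puncture_open|exact: nG].
wlog uw : u w Gu Gw / `|u - x| <= `|w - x|.
  move=> W; have [h|h] := leP `|u - x| `|w - x|; first exact: W.
  have [v [N [cv hv]]] := W w u Gw Gu (ltW h).
  exists (fun i => v (N - i)%N), N; split; first exact: chain_rev.
  by rewrite gsepC.
have pu := pos u Gu; have pw := pos w Gw.
have gs0 := gsep_gt0 pu pw.
have ux : u != x by apply/eqP => e; case: Gu => _; apply.
have nu : 0 < `|u - x| by rewrite normr_gt0 subr_eq0.
have [wd|wd] := leP `|w - x| (d x / 2).
  have [v [N [cv hv]]] := inner_chain q1 q32 ux uw wd.
  exists v, N; split=> //; apply: (le_trans hv).
  apply: ler_pM; [exact: le_trans q65|by rewrite divr_ge0| |].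
    by apply: (le_trans KB); lra_from KB K0 qK u w.
  rewrite /gsep ler_pdivlMr ?mulr_gt0//.
  have wE := dG_inner wd; have ule := dG_lex u.
  have m1 : `|w - x| <= msep dG u w by rewrite /msep wE; have := normr_ge0 (u - w); lra_from uw pu.
  apply: (@le_trans _ _ (`|w - x| ^+ 2)); last first.
    by rewrite lerXn2r ?nnegrE//; exact: le_trans m1.
  rewrite wE (_ : _ * (dG u * _) = dG u / `|u - x| * `|w - x| ^+ 2); last by ring.
  by rewrite ler_piMl ?sqr_ge0// ler_pdivrMr// mul1r.
have w1 : d x / 4 <= `|w - x| by lra_from uw nu wd.
have [u1|u1] := leP (d x / 4) `|u - x|.
  have [v [N [cv hv]]] := outer_chain q1 q32 B1 LC Gu Gw u1 w1.
  exists v, N; split=> //; apply: (le_trans hv).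
  rewrite (_ : _ * (B * (25 * _)) = K * gsep dG u w); last by rewrite /K; ring.
  by apply: ler_wpM2r; [exact: ltW|lra_from K0 qK Gu].
set r := d x / 4 / `|u - x|.
have r1 : 1 <= r by rewrite ler_pdivlMr// mul1r ltW.
have p0 : u - x != 0 by rewrite subr_eq0.
have rE : r * `|u - x| = d x / 4 by rewrite divfK// gt_eqF.
have [|v [N [cv hv]]] := radial_chain q1 q32 p0 r1; first by rewrite rE; lra_from dx q65 K.
rewrite (addrC x (u - x)) subrK in cv; set u' := x + r *: (u - x) in cv.
have nu' : `|u' - x| = d x / 4.
  by rewrite /u' addrAC subrr add0r normrZ ger0_norm ?rE// (le_trans ler01).
have Gu' : G u'.
  by apply: G_inner; [rewrite -subr_eq0 -normr_gt0 nu'|rewrite nu']; lra_from B1 LC dx.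
have [|v' [M [cv' hv']]] := outer_chain q1 q32 B1 LC Gu' Gw _ w1; first by rewrite nu'.
eexists; exists (N + M)%N; split; first exact: chain_cat cv cv'.
have u'E : dG u' = d x / 4 by rewrite dG_inner nu'//; lra_from LC dx q65.
have near_uw : d x / 4 <= `|u - w|.
  by have := ler_distD u w x; rewrite (distrC w u); lra_from nu wd u1.
have uu' : `|u' - u| <= d x / 4.
  have -> : u' - u = (r - 1) *: (u - x).
    by rewrite /u' scalerBl scale1r opprB addrAC addrC.
  by rewrite normrZ ger0_norm ?subr_ge0// mulrBl rE mul1r; lra_from pu nu.
have m1 : msep dG u' w <= 3 * msep dG u w.
  by rewrite /msep u'E; have := ler_distD u u' w; lra_from pu pw near_uw uu'.
have key : r * gsep dG u' w <= 9 * gsep dG u w.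
  rewrite /gsep u'E (_ : r * _ = msep dG u' w ^+ 2 / (`|u - x| * dG w)); last first.
    by rewrite /r; field; rewrite !gt_eqF.
  rewrite mulrA; apply: ler_pM; rewrite ?sqr_ge0//.
  - by rewrite invr_ge0 mulr_ge0// ltW.
  - rewrite (_ : 9 * _ = (3 * msep dG u w) ^+ 2); last by ring.
    have m0 : 0 <= msep dG u' w by apply: ltW; apply: msep_gt0 => //; exact: pos.
    by rewrite lerXn2r ?nnegrE//; exact: le_trans m1.
  - rewrite lef_pV2 ?posrE ?mulr_gt0//; apply: ler_wpM2r; first exact: ltW.
    exact: dG_lex.
rewrite exprD; apply: le_trans (ler_pM _ _ hv hv') _; rewrite ?exprn_ge0//; [lra_from G q1 q32 B1|lra_from G q1 q32 B1|].
rewrite (_ : q * r * _ = q * K * (r * gsep dG u' w)); last by rewrite /K; ring.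
rewrite (_ : 9 * (q * K) * _ = q * K * (9 * gsep dG u w)); last by ring.
by rewrite ler_wpM2l// mulr_ge0//; lra_from G q1 q32 B1.
Qed.

End Annulus.

End Puncture.

(** * Fully solid maps are coarse *)

Section CoarseFromSolid.
Context {R : realType}.
Implicit Types (A B C K q r s t e M : R).

Lemma ball_segment (E : normedModType R) (G : set E) z y s :
  `|z - y| < dcomp G z -> 0 <= s <= 1 -> G (z + s *: (y - z)).
Proof.
move=> zy /andP[s0 s1]; apply: (@dcomp_ball _ _ G z).
rewrite opprD addrA subrr add0r normrN normrZ ger0_norm// distrC.
by apply: le_lt_trans zy; rewrite ler_piMl.
Qed.

Lemma step_lt (E : normedModType R) (G : set E) e z y : e < 1 -> 0 < dcomp G z ->
  step (dcomp G) e z y -> `|z - y| < dcomp G z.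
Proof.
move=> e1 dz [h _]; apply: (le_lt_trans h); rewrite -[ltRHS]mul1r.
by rewrite ltr_pM2r.
Qed.

Lemma chain_arc_joined (E : normedModType R) (G : set E) e x y v N :
  open G -> ~` G !=set0 -> e < 1 -> chain G (dcomp G) e x y v N -> arc_joined G x y.
Proof.
move=> oG nG e1 [<- <- vG vs]; elim: N vG vs => [|N IHN] vG vs.
  by apply: arc_joined_refl; exact: vG.
apply: (@arc_joined_segment _ _ _ _ (v N)).
  by apply: IHN => i iN; [apply: vG|apply: vs]; exact: leqW.
move=> s; apply: ball_segment; apply: (step_lt e1); last exact: vs.
by apply: dcomp_gt0 => //; apply: vG.
Qed.

(** Makes a punctured domain a [domain], so that [fqc] applies to it. *)
Lemma log_chained_connected (E : normedModType R) (G : set E) e q B :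
  open G -> ~` G !=set0 -> e < 1 -> log_chained G (dcomp G) e q B -> connected G.
Proof.
move=> oG nG e1 LC U [b Ub] [V opV UV] [Z clZ UZ]; apply/seteqP; split.
  by move=> u; rewrite UV => -[].
move=> a Ga; have Gb : G b by move: Ub; rewrite UV => -[].
have [v [N [[v0 vN vG vs] _]]] := LC b a Gb Ga.
rewrite -vN; elim: N {vN} vG vs => [|N IHN] vG vs; first by rewrite v0.
have UN : U (v N) by apply: IHN => i iN; [apply: vG|apply: vs]; exact: leqW.
have GN : G (v N) by apply: vG.
have close : `|v N - v N.+1| < dcomp G (v N).
  by apply: (step_lt e1); [exact: dcomp_gt0|exact: vs].
pose sg s := v N + s *: (v N.+1 - v N).
have csg : continuous sg.
  move=> s; apply: cvgD; first exact: cvg_cst.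
  by apply: cvgZr_tmp.
pose S := [set sg s | s in `[0, 1]%classic].
have cS : connected S.
  apply: connected_continuous_connected; first exact: segment_connected.
  exact: continuous_subspaceT.
have SG : S `<=` G by move=> _ [s s01 <-]; exact: ball_segment.
have SN : S (v N) by exists 0; rewrite /sg ?scale0r ?addr0//= in_itv/= lexx ler01.
have SN1 : S (v N.+1).
  by exists 1; rewrite /sg ?scale1r 1?addrC ?subrK//= in_itv/= lexx ler01.
suff SU : S `&` U = S by move: SN1; rewrite -SU => -[].
apply: cS.
- by exists (v N).
- exists V => //; apply/seteqP; split => u [Su]; rewrite ?UV; first by case.
  by move=> Vu; split=> //; split=> //; exact: SG.
- exists Z => //; apply/seteqP; split => u [Su]; rewrite ?UZ; first by case.
  by move=> Vu; split=> //; split=> //; exact: SG.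
Qed.

(** Through this bound on the unit interval all later constants depend on [phi]. *)
Lemma halfline_homeo_bounded (phi : R -> R) : halfline_homeo phi ->
  exists M, forall t, 0 <= t -> t <= 1 -> phi t <= M.
Proof.
move=> [_ cphi _]; have c01 : {within `[0, 1], continuous phi}.
  by apply: continuous_subspaceW cphi => t; rewrite /= in_itv/= => /andP[].
have [c _ H] := EVT_max ler01 c01.
by exists (phi c) => t t0 t1; apply: H; rewrite in_itv/= t0.
Qed.

Lemma gsep_le_of_ratio (E : normedModType R) (d : E -> R) W p p2 : lip1 d ->
  0 < d p -> 0 < d p2 -> 0 <= W -> `|p - p2| <= W * d p -> `|p - p2| <= W * d p2 ->
  gsep d p p2 <= (2 * (W + 1)) ^+ 2.
Proof.
move=> lip dp dq W0 h1 h2; have l1 := lip p p2; have l2 := lip p2 p.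
rewrite distrC in l2.
have m1 : msep d p p2 <= 2 * (W + 1) * d p by rewrite /msep; lra.
have m2 : msep d p p2 <= 2 * (W + 1) * d p2 by rewrite /msep; lra.
rewrite /gsep ler_pdivrMr ?mulr_gt0// expr2.
have m0 := ltW (msep_gt0 dp dq).
apply: le_trans (ler_pM m0 m0 m1 m2) _.
by rewrite expr2 le_eqVlt; apply/orP; left; apply/eqP; ring.
Qed.

Lemma qh_dist_ratio (E : normedModType R) (G : set E) M p p2 :
  open G -> ~` G !=set0 -> G p -> arc_joined G p p2 -> qh_dist G p p2 <= M ->
  `|p - p2| <= expR M * dcomp G p.
Proof.
move=> oG nG Gp arc h; have dp := dcomp_gt0 oG Gp nG.
have := le_trans (qh_dist_ge oG nG arc) h.
have r0 : 0 <= `|p - p2| / dcomp G p by rewrite divr_ge0// ltW.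
rewrite -ler_expR lnK ?posrE; last by rewrite ltr_pwDl.
by move=> h2; rewrite -ler_pdivrMr//; lra.
Qed.

(** A step of size 1 / 2 has quasihyperbolic length at most 1, its image at most [M], and
    [qh_dist_ge] turns this into a distance of at most [expR M] times [dcomp G'] at either end. *)
Lemma solid_step_gsep (E E' : normedModType R) (G : set E) (G' : set E') phi h M :
  (forall t, 0 <= t -> t <= 1 -> phi t <= M) ->
  open G -> open G' -> ~` G !=set0 -> ~` G' !=set0 ->
  (forall u v, G' u -> G' v -> arc_joined G' u v) ->
  (forall u, G u -> G' (h u)) ->
  (forall u v, G u -> G v -> qh_dist G' (h u) (h v) <= phi (qh_dist G u v)) ->
  forall u v, G u -> G v -> step (dcomp G) (1 / 2) u v ->
    gsep (dcomp G') (h u) (h v) <= (2 * (expR M + 1)) ^+ 2.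
Proof.
move=> HM oG oG' nG nG' arcs hG hq u v Gu Gv st.
have Gu' := hG u Gu; have Gv' := hG v Gv.
have du := dcomp_gt0 oG' Gu' nG'; have dv := dcomp_gt0 oG' Gv' nG'.
have W0 : 0 <= expR M by exact: expR_ge0.
have bound a b : a != b -> G a -> G b -> step (dcomp G) (1 / 2) a b ->
    `|h a - h b| <= expR M * dcomp G' (h a).
  move=> ab Ga Gb [s _]; apply: qh_dist_ratio => //; [exact: hG|exact: arcs (hG _ Ga) (hG _ Gb)|].
  apply: (le_trans (hq _ _ Ga Gb)); apply: HM; first exact: qh_dist_ge0.
  by apply: qh_dist_le1 => //; move: s; lra.
have [->|uv] := eqVneq u v.
  have lipd' : lip1 (dcomp G') by exact: dcomp_lip1.
  by apply: gsep_le_of_ratio; rewrite ?subrr ?normr0 ?mulr_ge0// ltW.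
apply: gsep_le_of_ratio => //; first exact: dcomp_lip1.
  exact: bound.
by rewrite distrC; apply: bound; rewrite 1?eq_sym//; exact: step_sym.
Qed.

Lemma log_chainedW (E : normedModType R) (G : set E) (d : E -> R) e e' q B B' :
  (forall x, 0 <= d x) -> e <= e' -> B <= B' ->
  log_chained G d e q B -> log_chained G d e' q B'.
Proof.
move=> d0 ee BB LC x y Gx Gy; have [v [N [[v0 vN vG vs] hv]]] := LC x y Gx Gy.
exists v, N; split; last first.
  apply: (le_trans hv); apply: ler_wpM2r => //.
  by rewrite divr_ge0 ?sqr_ge0// mulr_ge0.
split=> // i iN; have [h1 h2] := vs i iN.
by split; [apply: (le_trans h1)|apply: (le_trans h2)]; apply: ler_wpM2r.
Qed.

Definition coarse_pair {E E' : normedModType R} (G : set E) (G' : set E') h q B k :=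
  [/\ open G /\ open G', ~` G !=set0 /\ ~` G' !=set0,
      log_chained G (dcomp G) (1 / 2) q B,
      coarse_map G (dcomp G) (dcomp G') h (1 / 2) B k &
      (forall u v, G u -> G v ->
         gsep (dcomp G') (h u) (h v) <= B * gsep (dcomp G) u v ^+ k)].

Lemma solid_coarse_pair (phi : R -> R) M q B :
  (forall t, 0 <= t -> t <= 1 -> phi t <= M) -> 1 < q -> 1 <= B ->
  exists B' k, 1 <= B' /\ forall (E E' : normedModType R) (G : set E) (G' : set E') h,
    open G -> open G' -> ~` G !=set0 -> ~` G' !=set0 ->
    log_chained G (dcomp G) (1 / 2) q B -> log_chained G' (dcomp G') (1 / 2) q B ->
    solid phi G G' h -> coarse_pair G G' h q B' (2 ^ k)%N.
Proof.
move=> HM q1 B1; pose B0 : R := (2 * (expR M + 1)) ^+ 2.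
have B00 : 0 <= B0 by exact: sqr_ge0.
pose B2 := B + B0; have B21 : 1 <= B2 by rewrite /B2; lra.
have [k k0 Hk] := @chain_image_power R (1 / 2) q B2 q1 B21.
(* Rounding the exponent up to a power of 2 lets [gauge] take roots by iterated square roots. *)
pose K := (2 ^ k)%N; have kK : (k <= K)%N by rewrite ltnW// ltn_expl.
pose B' := 4 * B2 ^+ K.
have B21K : 1 <= B2 ^+ K by exact: exprn_ege1.
have B2B' : B2 <= B'.
  have : B2 <= B2 ^+ K; last by rewrite /B'; lra.
  by rewrite -[leLHS]expr1 ler_weXn2l// expn_gt0.
exists B', k; split; first lra.
move=> E E' G G' h oG oG' nG nG' LC LC' [[hG hc [g [gc gh]]] sol].
have h12 : 1 / 2 < 1 :> R by lra.
have arcs u v : G u -> G v -> arc_joined G u v.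
  by move=> Gu Gv; have [w [N [c _]]] := LC u v Gu Gv; exact: (chain_arc_joined oG nG h12 c).
have arcs' u v : G' u -> G' v -> arc_joined G' u v.
  by move=> Gu Gv; have [w [N [c _]]] := LC' u v Gu Gv; exact: (chain_arc_joined oG' nG' h12 c).
have hG' u : G u -> G' (h u) by move=> Gu; rewrite -hG; exists u.
have gG u : G' u -> G (g u) by rewrite -hG => -[v Gv <-]; rewrite gh.
have hg u : G' u -> h (g u) = u by rewrite -hG => -[v Gv <-]; rewrite gh.
have dge z : 0 <= dcomp G z by exact: dcomp_ge0.
have dge' z : 0 <= dcomp G' z by exact: dcomp_ge0.
have pos u : G u -> 0 < dcomp G u by move=> ?; exact: dcomp_gt0.
have pos' u : G' u -> 0 < dcomp G' u by move=> ?; exact: dcomp_gt0.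
have st1 u v : G u -> G v -> step (dcomp G) (1 / 2) u v ->
    gsep (dcomp G') (h u) (h v) <= B0.
  by apply: solid_step_gsep HM _ _ _ _ _ _ _ u v => // u v Gu Gv; have [] := sol u v Gu Gv.
have st2 u v : G' u -> G' v -> step (dcomp G') (1 / 2) u v ->
    gsep (dcomp G) (g u) (g v) <= B0.
  apply: solid_step_gsep HM _ _ _ _ _ _ _ u v => // u v Gu Gv.
  by have [_] := sol (g u) (g v) (gG u Gu) (gG v Gv); rewrite !hg.
have BB2 : B <= B2 by rewrite /B2; lra.
have LC2 := log_chainedW dge (lexx (1 / 2)) BB2 LC.
have LC2' := log_chainedW dge' (lexx (1 / 2)) BB2 LC'.
have B02 : B0 <= B2 by rewrite /B2; lra_from B1.
have raise z : 1 <= z -> 4 * (B2 * z) ^+ k <= B' * z ^+ K.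
  move=> z1; rewrite /B' -mulrA -exprMn ler_wpM2l//; apply: ler_weXn2l => //.
  by rewrite -[leLHS]mulr1; apply: ler_pM.
have up u v : G u -> G v -> gsep (dcomp G') (h u) (h v) <= B' * gsep (dcomp G) u v ^+ K.
  move=> Gu Gv; apply: le_trans (Hk E E' G (dcomp G) (dcomp G') h LC2 _ _ u v Gu Gv) _.
  - by move=> w Gw; split; [exact: pos|exact: pos' (hG' w Gw)].
  - by move=> a b Ga Gb s; apply: le_trans (st1 a b Ga Gb s) B02.
  - by apply: raise; apply: gsep_ge1; exact: pos.
have down u v : G' u -> G' v -> gsep (dcomp G) (g u) (g v) <= B' * gsep (dcomp G') u v ^+ K.
  move=> Gu Gv; apply: le_trans (Hk E' E G' (dcomp G') (dcomp G) g LC2' _ _ u v Gu Gv) _.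
  - by move=> w Gw; split; [exact: pos'|exact: pos (gG w Gw)].
  - by move=> a b Ga Gb s; apply: le_trans (st2 a b Ga Gb s) B02.
  - by apply: raise; apply: gsep_ge1; exact: pos'.
split=> //.
- by apply: log_chainedW LC2.
- split=> // [u Gu|u v Gu Gv s|u v Gu Gv].
  + by split; [exact: pos|exact: pos' (hG' u Gu)].
  + by apply: le_trans (st1 u v Gu Gv s) _; exact: le_trans B2B'.
  + by have := down (h u) (h v) (hG' u Gu) (hG' v Gv); rewrite !gh.
Qed.

Lemma fqc_coarse_pairs (phi : R -> R) c : halfline_homeo phi ->
  exists q B k, [/\ 1 < q, 1 <= B &
    forall (E E' : normedModType R) (D : set E) (D' : set E') h,
      dim_ge2 E -> dim_ge2 E' -> domain D -> domain D' ->
      ~` D !=set0 -> ~` D' !=set0 -> uniform_domain c D -> uniform_domain c D' ->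
      fqc phi D D' h ->
      coarse_pair D D' h q B (2 ^ k)%N /\
      forall x, D x -> D `\` [set x] !=set0 ->
        coarse_pair (D `\` [set x]) (D' `\` [set h x]) h q B (2 ^ k)%N].
Proof.
move=> hphi; have [M HM] := halfline_homeo_bounded hphi.
have [q [B [q1 q32 B1 HU]]] := @uniform_log_chained R c (1 / 20) ltac:(lra) ltac:(lra).
(* The constant of [puncture_log_chained]; as [B <= B2], it serves the domains themselves as
   well. *)
pose B2 := 9 * (q * (q ^+ 65 * 2 * (B * 25))).
have BB2 : B <= B2.
  have q65 : 1 <= q ^+ 65 by apply: exprn_ege1; exact: ltW.
  have h1 : B <= q ^+ 65 * B by rewrite ler_peMl//; lra.
  have h2 : q ^+ 65 * B <= q * (q ^+ 65 * B) by rewrite ler_peMl//; lra.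
  by rewrite /B2; lra.
have B21 : 1 <= B2 by lra.
have [B' [k [B'1 HS]]] := solid_coarse_pair HM q1 B21.
exists q, B', k; split=> // E E' D D' h dim dim' domD [oD' _ _] nD nD' uD uD'.
have [oD _ _] := domD.
move=> [[hD hc [g [gc gh]]] hsub].
have LC := HU E D oD nD uD; have LC' := HU E' D' oD' nD' uD'.
have dge (E0 : normedModType R) (G : set E0) : ~` G !=set0 -> forall z, 0 <= dcomp G z.
  by move=> nG z; exact: dcomp_ge0.
have h20 : 1 / 20 <= 1 / 2 :> R by lra.
have h12 : 1 / 2 < 1 :> R by lra.
split.
  apply: HS => //; [exact: log_chainedW (dge _ _ nD) h20 BB2 LC|exact: log_chainedW (dge _ _ nD') h20 BB2 LC'|].
  by have := hsub D; rewrite hD; apply.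
move=> x Dx neG; have Dhx : D' (h x) by rewrite -hD; exists x.
have oG := puncture_open x oD; have oG' := puncture_open (h x) oD'.
have nG1 := nG D x; have nG1' := nG D' (h x).
have LCG := puncture_log_chained dim nD Dx oD q1 q32 B1 LC.
have LCG' := puncture_log_chained dim' nD' Dhx oD' q1 q32 B1 LC'.
apply: HS => //.
have -> : D' `\` [set h x] = h @` (D `\` [set x]).
  apply/seteqP; split=> y.
    rewrite -hD => -[[u Du <-] hux]; exists u => //; split=> // ux; apply: hux.
    by rewrite /= ux.
  move=> [u [Du ux] <-]; split; first by rewrite -hD; exists u.
  by move=> /= e; apply: ux; rewrite /= -(gh u Du) e gh.
apply: hsub; last by move=> u [].
split=> //; exact: log_chained_connected oG nG1 h12 LCG.
Qed.

End CoarseFromSolid.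

(** * Root points *)

Section Roots.
Context {R : realType}.
Implicit Types (A B C K c q r s t e M L T : R).

(* A root is a point that is fat and far from x, a, b on both sides at once,
   which is where the normalization of the map at infinity enters. *)
Definition root {E E' : normedModType R} (d : E -> R) (d' : E' -> R) h K x a b w :=
  [/\ `|x - a| <= K * d w, `|x - b| <= K * d w, `|x - w| <= K * d w &
   [/\ `|h x - h a| <= K * d' (h w), `|h x - h b| <= K * d' (h w) &
      `|h x - h w| <= K * d' (h w)]].

Lemma norm_le_dist (E : normedModType R) (p x : E) : `|p| <= `|p - x| + `|x|.
Proof. by rewrite -{1}(subrK x p); exact: ler_normD. Qed.

Lemma uniform_midpoint c (E : normedModType R) (D : set E) x p :
  open D -> ~` D !=set0 -> uniform_domain c D -> D x -> D p ->
  exists z l, [/\ D z, `|x - p| <= l, `|x - z| <= l / 2 &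
    l / 2 <= Num.max 1 c * dcomp D z].
Proof.
move=> oD nD uD Dx Dp.
have [l [sg [/andP[l0 ll] [s0 sl] Ds lip cig]]] := uniform_param oD nD uD Dx Dp.
have h0 : 0 <= l / 2 <= l by lra.
have l00 : 0 <= (0 : R) <= l by rewrite lexx.
have lll : 0 <= l <= l by rewrite l0 lexx.
exists (sg (l / 2)), l; split; first exact: Ds.
- by have := lip 0 l l00 lll; rewrite s0 sl sub0r normrN ger0_norm.
- by have := lip 0 (l / 2) l00 h0; rewrite s0 sub0r normrN ger0_norm//; lra.
- by have := cig _ h0; rewrite min_l//; lra.
Qed.

(** Join [a] to a very distant fat point [z]. The root is the vertex whose image is the peak of the
    image chain: the cones there make [h w] fat, hence far out; continuity of the inverse at
    infinity then makes [w] far out, and the cones in [D] make it fat. The distances depend on the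
    map and the points, [K] does not. *)
Lemma root_unbounded c q B k : 1 < q -> 1 <= B ->
  exists2 K, 1 <= K & forall (E E' : normedModType R) (D : set E) (D' : set E') h,
    open D -> ~` D !=set0 -> uniform_domain c D ->
    (forall r, exists p, D p /\ r < `|p|) ->
    (forall r, exists r', forall p, D p -> r' < `|p| -> r < `|h p|) ->
    (forall r, exists r', forall p, D p -> r' < `|h p| -> r < `|p|) ->
    forall x a b, D x -> let G := D `\` [set x] in let G' := D' `\` [set h x] in
    coarse_pair G G' h q B k -> G a -> G b ->
    exists2 w, G w & root (dcomp G) (dcomp G') h K x a b w.
Proof.
move=> q1 B1; have B0 : 0 <= B by lra.
have [C C1 HC] := @quasigeodesic_cones R (1 / 2) q B 1 ltac:(lra) q1 B0.
have BB0 : 0 <= B * B by rewrite mulr_ge0.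
have [C' C'1 HC'] := @quasigeodesic_cones R B q (B * B) k B0 q1 BB0.
pose c1 := Num.max 1 c; have c11 : 1 <= c1 by rewrite le_max lexx.
have [C2 C20 C2E] : exists2 C2 : R, 1 <= C2 & C2 = 4 * (c1 * C) + 2 * C.
  by eexists; last reflexivity; have : 0 <= c1 * C; [apply: mulr_ge0; lra_from c11 C1|lra_from C1].
exists (1 + C' + C2); first lra.
move=> E E' D D' h oD nD uD U1 U2 U3 x a b Dx G G' cp Ga Gb.
have [[oG oG'] [nG1 nG1'] LC cm _] := cp.
have dpos u : G u -> 0 < dcomp G u by move=> ?; exact: dcomp_gt0.
have dge z : 0 <= dcomp G z by exact: dcomp_ge0.
have lip : lip1 (dcomp G) by exact: dcomp_lip1.
have lip' : lip1 (dcomp G') by exact: dcomp_lip1.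
have r1 := normr_ge0 (x - a); have r2 := normr_ge0 (x - b).
have r1' := normr_ge0 (h x - h a); have r2' := normr_ge0 (h x - h b).
(* The thresholds are chosen backwards: [R2] for the norm of [w], [T3] for the fatness of [h w] that
   enforces it, and [T] for the distance from [x] to [z] that enforces [T3]. *)
pose R2 : R := C2 * (`|x - a| + `|x - b|) + `|x - a| + `|x|.
have [R' HR'] := U3 R2.
pose T3 : R := `|R'| + `|h x| + `|h x - h a| + `|h x - h b| + 1.
have [R4 HR4] := U2 (2 * C' * T3 + `|h a|).
pose T : R := `|R4| + `|x| + `|x - a| + 1.
have [z [Gz xz zfat]] : exists z, [/\ G z, T <= `|x - z| & `|x - z| <= c1 * dcomp G z].
  have [p [Dp hp]] := U1 (2 * (c1 * (T + dcomp D x)) + `|x|).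
  have [z [l [Dz h1 h2 h3]]] := uniform_midpoint oD nD uD Dx Dp.
  rewrite -/c1 in h3.
  have xp : 2 * (c1 * (T + dcomp D x)) <= l.
    by have := norm_le_dist p x; rewrite (distrC p); lra_from hp h1.
  have Tz : T <= `|x - z|.
    have : c1 * (T + dcomp D x) <= c1 * dcomp D z by lra_from h3 xp.
    rewrite ler_pM2l; last lra_from c11.
    by have := dcomp_lip z x nD; rewrite (distrC z); lra_from.
  have T0 : 0 < T.
    by rewrite /T; have := normr_ge0 R4; have := normr_ge0 x; lra_from r1.
  exists z; split=> //.
    by split=> // zx; move: Tz; rewrite /= zx subrr normr0; lra_from T0.
  have : `|x - z| / c1 <= dcomp G z; last by rewrite ler_pdivrMr 1?mulrC//; lra_from c11.
  have i0 : 0 < c1 by lra_from c11.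
  apply: dG_ge; first by rewrite ler_pdivrMr// mulrC; lra_from h2 h3.
  by rewrite ler_pdivrMr// distrC ler_peMr.
have [v [N [cv mv]]] := minimal_chain q1 LC Ga Gz.
have [v0 vN vG vs] := cv.
have [_ bet] := HC E _ v N lip (minimal_chain_quasigeodesic dpos cv mv).
have [[p [pN lc rc]] _] := HC' E' _ _ N lip' (image_quasigeodesic B0 cm cv mv).
have {lc} := lc p (leqnn p); have {rc} := rc p (leqnn p) pN.
rewrite /= v0 vN; set w := v p => rc lc.
have Gw : G w by exact: vG.
have dw := dpos w Gw; have dw' : 0 < dcomp G' (h w) by case: cm => ps _ _; case: (ps w Gw).
have Dz : D z by case: Gz.
have big : T3 <= dcomp G' (h w).
  have hz : 2 * C' * T3 + `|h a| < `|h z|.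
    apply: HR4 => //; have := ler_normB x z; have := ler_norm R4.
    by move: xz; rewrite /T; lra_from r1.
  have : 2 * C' * T3 <= 2 * C' * dcomp G' (h w).
    have := ler_distD (h w) (h a) (h z); have := norm_le_dist (h z) (h a).
    by rewrite (distrC (h z)); lra_from rc lc hz.
  by rewrite ler_pM2l//; lra_from C'1.
have T3b : `|R'| + `|h x| + `|h x - h a| + `|h x - h b| + 1 <= dcomp G' (h w) by exact: big.
have aw : `|a - w| <= C2 * dcomp G w.
  have bw := bet p pN; rewrite v0 vN in bw.
  have [h1|h1] := zbetween_min dw (dge a) (dge z) (le_trans ler01 C1) bw.
    move: h1; rewrite C2E /msep; have := dge a.
    by have : 0 <= c1 * C * dcomp G w; [rewrite !mulr_ge0//; lra_from c11 C1|lra_from dw].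
  have dz : dcomp G z <= 2 * C * dcomp G w.
    by move: h1; rewrite /msep; have := normr_ge0 (w - z); lra_from dw.
  have wz : `|w - z| <= 2 * C * dcomp G w by move: h1; rewrite /msep; have := dge z; lra_from dw.
  have : c1 * dcomp G z <= c1 * (2 * C * dcomp G w) by rewrite ler_wpM2l//; lra_from c11.
  have xaz : `|x - a| <= `|x - z|.
    by apply: le_trans xz; rewrite /T; have := normr_ge0 R4; have := normr_ge0 x; lra_from.
  have := ler_distD x a w; have := ler_distD z x w.
  by rewrite (distrC a x) (distrC z w) C2E; lra_from zfat wz xaz.
have far : R2 < `|w|.
  apply: HR' => //; first by case: Gw.
  have : dcomp G' (h w) <= `|h w - h x| by exact: dG_lex.
  by have := ler_normB (h w) (h x); have := ler_norm R'; lra_from r1' r2' T3b.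
have fat : `|x - a| + `|x - b| <= dcomp G w.
  have C2pos : 0 < C2 by lra_from C20.
  rewrite -(ler_pM2l C2pos).
  have := ler_distD a w x; have := norm_le_dist w x.
  by rewrite (distrC w a) (distrC a x); move: far; rewrite /R2; lra_from aw.
have P1 : 0 <= C' * dcomp G w by rewrite mulr_ge0//; lra_from C'1.
have P2 : 0 <= C2 * dcomp G w by rewrite mulr_ge0//; lra_from C20.
have P3 : 0 <= C' * dcomp G' (h w) by rewrite mulr_ge0 ?ltW//; lra_from C'1.
have P4 : 0 <= C2 * dcomp G' (h w) by rewrite mulr_ge0 ?ltW//; lra_from C20.
exists w => //; split; [lra_from r2 fat P1 P2|lra_from r1 fat P1 P2| |split].
- by have := ler_distD a x w; lra_from r2 aw fat P1.
- by have := normr_ge0 R'; have := normr_ge0 (h x); lra_from r2' T3b P3 P4.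
- by have := normr_ge0 R'; have := normr_ge0 (h x); lra_from r1' T3b P3 P4.
- have := ler_distD (h a) (h x) (h w).
  by have := normr_ge0 R'; have := normr_ge0 (h x); lra_from r2' lc T3b P4.
Qed.

End Roots.

(** * Roots in bounded domains *)

Section BoundedRoots.
Context {R : realType}.
Implicit Types (A B C K c q r s t e M L T : R).

Lemma gsep_ge_ratio (E : normedModType R) (d : E -> R) x y : 0 < d x -> 0 < d y ->
  d x <= gsep d x y * d y.
Proof.
move=> dx dy; rewrite /gsep (_ : _ * d y = msep d x y ^+ 2 / d x); last first.
  by field; rewrite !gt_eqF.
rewrite ler_pdivlMr// expr2.
have m : d x <= msep d x y by rewrite /msep; have := normr_ge0 (x - y); lra.
by apply: ler_pM => //; exact: ltW.
Qed.

Definition spread {E : normedModType R} (r : R) (u v w : E) :=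
  [/\ r <= `|u - v|, r <= `|u - w| & r <= `|v - w|].

(** For [s <= t] the distance X of the two points is at least [(t - s) * |u|] by norms alone, and X
    plus this number is at least [s * |u|]; add the two. *)
Lemma ray_gap (E : normedModType R) (u w : E) s t : `|u| = `|w| -> `|u| <= `|u - w| ->
  0 <= s -> 0 <= t -> Num.min s t * `|u| / 2 <= `|s *: u - t *: w|.
Proof.
move=> uw h s0 t0.
have gen (a b : R) (p q : E) : `|p| = `|q| -> `|p| <= `|p - q| -> 0 <= a -> a <= b ->
    a * `|p| / 2 <= `|a *: p - b *: q|.
  move=> pq hpq a0 ab; have n0 := normr_ge0 p.
  have h1 : (b - a) * `|p| <= `|a *: p - b *: q|.
    have := ler_dist_dist (b *: q) (a *: p); rewrite !normrZ -pq (ger0_norm a0) (ger0_norm (le_trans a0 ab)).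
    rewrite -mulrBl (distrC (b *: q)) => h1; apply: le_trans h1.
    by rewrite ler_norm.
  have h2 : a * `|p| <= `|a *: p - b *: q| + (b - a) * `|p|.
    have -> : (b - a) * `|p| = `|(b - a) *: q| by rewrite normrZ -pq ger0_norm//; lra.
    apply: (@le_trans _ _ `|a *: (p - q)|).
      by rewrite normrZ ger0_norm// ler_wpM2l.
    rewrite (_ : a *: (p - q) = a *: p - b *: q + (b - a) *: q) ?ler_normD//.
    by rewrite scalerBr scalerBl addrA subrK.
  lra.
have [st|ts] := leP s t; first exact: gen.
by rewrite uw distrC; apply: gen; rewrite 1?distrC -?uw// ltW.
Qed.

(** First exits of the rays from [z] along [e1], [- e1] and a vector equidistant from both. Three
    points are taken so that any choice of one from each pair selects at least two of them, as
    [center_image] needs. *)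
Lemma boundary_triple (E : normedModType R) (D : set E) z M :
  dim_ge2 E -> open D -> ~` D !=set0 -> D z -> (forall p, D p -> `|p| <= M) ->
  exists u v w, [/\ closure D u /\ ~ D u, closure D v /\ ~ D v, closure D w /\ ~ D w &
    spread (dcomp D z / 2) u v w].
Proof.
move=> dim oD nD Dz bD; have [e1 [e2 He]] := dim.
have e10 : e1 != 0.
  apply/eqP => e0; have [|/eqP] := He 1 0; first by rewrite e0 scaler0 scale0r addr0.
  by rewrite oner_eq0.
have ne : 0 < `|e1| by rewrite normr_gt0.
have [w0 [nw h1 h2]] := equidistant_ex dim e10.
have ex (v : E) : `|v| = `|e1| -> exists t, [/\ 0 < t, closure D (z + t *: v) /\ ~ D (z + t *: v) &
    dcomp D z <= t * `|e1|].
  move=> nv; pose s := (`|M| + `|z| + 1) / `|e1|.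
  have s0 : 0 <= s by rewrite divr_ge0// !addr_ge0.
  have out : ~ D (z + s *: v).
    move=> /bD; have := norm_le_dist (s *: v) (- z); rewrite opprK normrN (addrC _ z).
    rewrite normrZ nv ger0_norm// /s divfK ?gt_eqF//.
    by have := ler_norm M; lra.
  have [t [/andP[t0 _] _ nt ct]] := ray_exit oD Dz s0 out.
  exists t; split=> //; have := dcomp_le z nt.
  by rewrite opprD addrA subrr add0r normrN normrZ nv ger0_norm// ltW.
have [t1 [t10 b1 d1]] := ex e1 erefl.
have [t2 [t20 b2 d2]] := ex (- e1) (normrN e1).
have [t3 [t30 b3 d3]] := ex w0 nw.
have gap s t (u v : E) : 0 < s -> 0 < t -> dcomp D z <= s * `|e1| -> dcomp D z <= t * `|e1| ->
    `|u| = `|e1| -> `|v| = `|e1| -> `|e1| <= `|u - v| ->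
    dcomp D z / 2 <= `|z + s *: u - (z + t *: v)|.
  move=> s0 t0 ds dt nu nv uv; rewrite opprD addrACA subrr add0r.
  have := @ray_gap E u v s t; rewrite nu nv => /(_ erefl uv (ltW s0) (ltW t0)).
  by have [_|_] := leP s t; lra_from ds dt.
exists (z + t1 *: e1), (z + t2 *: - e1), (z + t3 *: w0); split => //; split.
- by apply: gap; rewrite ?normrN// opprK -mulr2n normrMn mulr2n lerDl.
- by apply: gap => //; rewrite distrC.
- by apply: gap; rewrite ?normrN// -opprD normrN addrC.
Qed.

(** The midpoint of the uniform arc between two points that almost realize the diameter. *)
Lemma fat_center c (E : normedModType R) (D : set E) M :
  open D -> ~` D !=set0 -> D !=set0 -> uniform_domain c D -> (forall p, D p -> `|p| <= M) ->
  exists z, D z /\ forall p, D p -> `|p - z| <= 5 * Num.max 1 c * dcomp D z.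
Proof.
move=> oD nD [x0 Dx0] uD bD; set c1 := Num.max 1 c.
have c11 : 1 <= c1 by rewrite le_max lexx.
pose S := [set r | exists p p', [/\ D p, D p' & r = `|p - p'|]].
have hS : has_sup S.
  split; first by exists `|x0 - x0|, x0, x0.
  by exists (M + M) => _ [p [p' [Dp Dp' ->]]]; rewrite (le_trans (ler_normB _ _))// lerD ?bD.
have Sub p p' : D p -> D p' -> `|p - p'| <= sup S.
  by move=> Dp Dp'; apply: ub_le_sup; [case: hS|exists p, p'].
have dx0 := dcomp_gt0 oD Dx0 nD.
have sup0 : 0 <= sup S by apply: le_trans (Sub x0 x0 Dx0 Dx0); rewrite subrr normr0.
have [e0|spos] := leP (sup S) 0.
  exists x0; split=> // p Dp; apply: (le_trans (Sub p x0 Dp Dx0)).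
  by apply: (le_trans e0); rewrite !mulr_ge0//; lra.
have sp : 0 < sup S / 10 by rewrite divr_gt0.
have [_ [p [p' [Dp Dp' ->]]] hp] := sup_adherent sp hS.
have [z [l [Dz h1 h2 h3]]] := uniform_midpoint oD nD uD Dp Dp'.
rewrite -/c1 in h3; exists z; split=> // a Da; apply: (le_trans (Sub a z Da Dz)).
lra.
Qed.

Definition bilipschitz_boundary {E E' : normedModType R} (D : set E) (D' : set E')
    (h : E -> E') L :=
  [/\ (forall u, closure D u -> ~ D u -> graph_limit D h u (h u)),
      (forall u v, closure D u -> ~ D u -> closure D v -> ~ D v ->
         `|u - v| <= L * `|h u - h v| /\ `|h u - h v| <= L * `|u - v|),
      (forall u, closure D u -> ~ D u -> ~ D' (h u)) &
      (forall u', closure D' u' -> ~ D' u' ->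
         exists u, [/\ closure D u, ~ D u & h u = u'])].

Lemma closure_dist (E : normedModType R) (D : set E) z T u :
  (forall p, D p -> `|p - z| <= T) -> closure D u -> `|u - z| <= T.
Proof.
move=> DT cu; rewrite leNgt; apply/negP => lt.
have e0 : 0 < `|u - z| - T by rewrite subr_gt0.
have [p [Dp /= up]] := cu _ (nbhsx_ballx u _ e0).
move: up; rewrite -ball_normE /= => up.
by have := ler_distD p u z; have := DT p Dp; lra.
Qed.

(** The ray from [h y] through [p] leaves [D'] beyond [p] at a boundary point [h u], whose distance
    to [h y] is at most [L] times that of [u] to [y]. *)
Lemma image_diameter (E E' : normedModType R) (D : set E) (D' : set E') h L T M' y :
  open D' -> 0 <= L -> bilipschitz_boundary D D' h L ->
  (forall p, D' p -> `|p| <= M') ->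
  (forall u, closure D u -> `|u - y| <= T) -> closure D y -> ~ D y ->
  forall p, D' p -> `|p - h y| <= L * T.
Proof.
move=> oD' L0 [_ lip ny ex] bD' hT cy nDy p Dp.
have [->|py] := eqVneq p (h y).
  by rewrite subrr normr0 mulr_ge0//; apply: le_trans (hT y cy).
have np : 0 < `|p - h y| by rewrite normr_gt0 subr_eq0.
pose s := (`|M'| + `|p| + 1) / `|p - h y|.
have s0 : 0 <= s by rewrite divr_ge0// ?addr_ge0.
have out : ~ D' (p + s *: (p - h y)).
  move=> /bD'; have := norm_le_dist (s *: (p - h y)) (- p).
  rewrite opprK normrN (addrC _ p) normrZ ger0_norm// /s divfK ?gt_eqF//.
  by have := ler_norm M'; lra.
have [t [/andP[t0 _] _ nt ct]] := ray_exit oD' Dp s0 out.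
have [u [cu nu hu]] := ex _ ct nt.
have [_ h1] := lip u y cu nu cy nDy.
have : `|h u - h y| = (1 + t) * `|p - h y|.
  rewrite hu addrAC -{1}[p - h y]scale1r -scalerDl normrZ ger0_norm//; lra.
have : L * `|u - y| <= L * T by rewrite ler_wpM2l// hT.
have : 0 <= t * `|p - h y| by rewrite mulr_ge0// ltW.
lra_from h1.
Qed.

(** The center lies between any two of three well separated boundary points, hence so does its
    image, which is then relatively close to one point of each pair and so to two of the three.
    These two are at least [dcomp D z / (2 * L)] apart, so [h z] is fat compared with [dcomp D z],
    which by [image_diameter] controls the diameter of [D']. *)
Lemma center_image c q B k L : 1 < q -> 1 <= B -> 1 <= L ->
  exists2 K, 1 <= K & forall (E E' : normedModType R) (D : set E) (D' : set E') h M M',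
    dim_ge2 E -> coarse_pair D D' h q B k ->
    (forall p, D p -> `|p| <= M) -> (forall p, D' p -> `|p| <= M') ->
    bilipschitz_boundary D D' h L ->
    forall z, D z -> (forall p, D p -> `|p - z| <= 5 * Num.max 1 c * dcomp D z) ->
    forall p, D' p -> `|p - h z| <= K * dcomp D' (h z).
Proof.
move=> q1 B1 L1; set c1 := Num.max 1 c; have c11 : 1 <= c1 by rewrite le_max lexx.
pose a0 := 5 * c1 + 1; have a01 : 1 <= a0 by rewrite /a0; lra.
have A0 : 0 <= 2 * a0 ^+ 2 by rewrite mulr_ge0// sqr_ge0.
have [A' A'1 HA] := @zbetween_map_lim R (1 / 2) q B k (2 * a0 ^+ 2) ltac:(lra) q1 B1 A0.
pose K := 2 * (L * (10 * c1)) * (8 * L * A'); exists (K + 1).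
  by rewrite lerDr /K !mulr_ge0//; lra_from L1 c11 A'1.
move=> E E' D D' h M M' dim cp bD bD' bl z Dz fatz p Dp.
have [[oD oD'] [nD nD'] LC cm _] := cp.
have [lim lipb ny ex] := bl.
have dge u : 0 <= dcomp D u by exact: dcomp_ge0.
have dge' u : 0 <= dcomp D' u by exact: dcomp_ge0.
have lipd : lip1 (dcomp D) by exact: dcomp_lip1.
have lipd' : lip1 (dcomp D') by exact: dcomp_lip1.
have dz := dcomp_gt0 oD Dz nD.
have dz' : 0 < dcomp D' (h z) by case: cm => ps _ _; case: (ps z Dz).
have [y1 [y2 [y3 [[cy1 n1] [cy2 n2] [cy3 n3] [s12 s13 s23]]]]] :=
  boundary_triple dim oD nD Dz bD.
have cz u : closure D u -> `|u - z| <= 5 * c1 * dcomp D z by exact: closure_dist.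
have betw u v : closure D u -> ~ D u -> closure D v -> ~ D v -> dcomp D z / 2 <= `|u - v| ->
    zbetween (dcomp D') A' (h u) (h z) (h v).
  move=> cu nu cv nv uv.
  apply: (HA E E' D (dcomp D) (dcomp D') h lipd lipd' dge dge' LC cm u (h u) z v (h v)) => //.
  - exact: lim.
  - exact: lim.
  - by rewrite /msep (dcomp_out nu) (dcomp_out nv); lra_from dz uv.
  have := cz u cu; have := cz v cv; rewrite /zbetween /msep (dcomp_out nu) (dcomp_out nv).
  rewrite (distrC z v) !addr0 => h1 h2.
  have m1 : `|u - z| + dcomp D z <= a0 * dcomp D z by rewrite /a0; lra_from h2.
  have m2 : `|v - z| + dcomp D z <= a0 * dcomp D z by rewrite /a0; lra_from h1.
  apply: le_trans (ler_pM _ _ m1 m2) _; rewrite ?addr_ge0//.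
  rewrite (_ : a0 * _ * _ = 2 * a0 ^+ 2 * dcomp D z * (dcomp D z / 2)); last by field.
  by rewrite ler_wpM2l// mulr_ge0// ltW.
have A'0 : 0 <= A' by lra_from A'1.
have pair u v : closure D u -> ~ D u -> closure D v -> ~ D v -> dcomp D z / 2 <= `|u - v| ->
    `|h u - h z| <= 2 * A' * dcomp D' (h z) -> `|h v - h z| <= 2 * A' * dcomp D' (h z) ->
    dcomp D z <= 8 * L * A' * dcomp D' (h z).
  move=> cu nu cv nv uv h1 h2; have [h3 _] := lipb u v cu nu cv nv.
  have : L * `|h u - h v| <= L * (4 * A' * dcomp D' (h z)).
    rewrite ler_wpM2l//; first lra_from L1.
    by have := ler_distD (h z) (h u) (h v); rewrite (distrC (h z)); lra_from h1 h2.
  lra_from uv h3.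
have close u v : closure D u -> ~ D u -> closure D v -> ~ D v -> dcomp D z / 2 <= `|u - v| ->
    `|h u - h z| <= 2 * A' * dcomp D' (h z) \/ `|h v - h z| <= 2 * A' * dcomp D' (h z).
  move=> cu nu cv nv uv; have b := betw u v cu nu cv nv uv.
  have [h1|h1] := zbetween_min dz' (dge' (h u)) (dge' (h v)) A'0 b; [left|right].
    by move: h1; rewrite /msep; have := dge' (h u); lra_from dz'.
  by move: h1; rewrite /msep (distrC (h z)); have := dge' (h v); lra_from dz'.
have fat : dcomp D z <= 8 * L * A' * dcomp D' (h z).
  have := close y1 y2 cy1 n1 cy2 n2 s12; have := close y1 y3 cy1 n1 cy3 n3 s13.
  have := close y2 y3 cy2 n2 cy3 n3 s23.
  move=> [g2|g3] [g1|g3'] [k1|k2].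
  - exact: (pair y1 y2).
  - exact: (pair y1 y2).
  - exact: (pair y2 y3).
  - exact: (pair y2 y3).
  - exact: (pair y1 y3).
  - exact: (pair y1 y3).
  - exact: (pair y1 y3).
  - exact: (pair y2 y3).
have L0 : 0 <= L by lra_from L1.
have hT u : closure D u -> `|u - y1| <= 10 * c1 * dcomp D z.
  move=> cu; have := ler_distD z u y1; rewrite (distrC z y1).
  by have := cz u cu; have := cz y1 cy1; lra_from.
have diam := image_diameter oD' L0 bl bD' hT cy1 n1.
have Dhz : D' (h z).
  by apply: contrapT => /dcomp_out e0; move: dz'; rewrite e0 ltxx.
have d1 := diam p Dp; have d2 := diam (h z) Dhz.
have : `|p - h z| <= 2 * (L * (10 * c1)) * dcomp D z.
  by have := ler_distD (h y1) p (h z); rewrite (distrC (h y1) (h z)); lra_from d1 d2.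
have LC0 : 0 <= 2 * (L * (10 * c1)) by rewrite !mulr_ge0//; lra_from c11.
move=> h1; apply: (le_trans h1); rewrite [leRHS]mulrDl mul1r.
apply: (@le_trans _ _ (K * dcomp D' (h z))); last by rewrite lerDl ltW.
rewrite (_ : K * _ = 2 * (L * (10 * c1)) * (8 * L * A' * dcomp D' (h z))); last by rewrite /K; ring.
exact: ler_wpM2l.
Qed.

(** The center [z] is a root unless [x] or its image is too close. Then a second point [p], less fat
    by the factor [Q], is used: if it were bad too, both would have bounded [gsep] to [x] and hence
    to each other, against the choice of [Q]. *)
Lemma root_bounded c q B k L : 1 < q -> 1 <= B -> 1 <= L ->
  exists2 K, 1 <= K & forall (E E' : normedModType R) (D : set E) (D' : set E') h M M',
    dim_ge2 E -> coarse_pair D D' h q B k -> D !=set0 -> uniform_domain c D ->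
    (forall p, D p -> D' (h p)) ->
    (forall p, D p -> `|p| <= M) -> (forall p, D' p -> `|p| <= M') ->
    bilipschitz_boundary D D' h L ->
    forall x a b, D x -> D a -> D b ->
    let G := D `\` [set x] in let G' := D' `\` [set h x] in
    exists2 w, G w & root (dcomp G) (dcomp G') h K x a b w.
Proof.
move=> q1 B1 L1; have [K K1 HK] := @center_image c q B k L q1 B1 L1.
set c1 := Num.max 1 c in HK *; have c11 : 1 <= c1 by rewrite le_max lexx.
(* A point within half of its distance to the complement from [x] has [gsep] at most 16 to it, and
   [B * 16 ^+ k] transfers this bound from the image; [B3] covers both. [Q] exceeds the bound
   [4 * B3 ^+ 2] from the triangle inequality. *)
pose B3 := 16 * (B * 16 ^+ k); pose Q := 8 * B3 ^+ 2.
have B31 : 1 <= B3.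
  rewrite /B3; have : 1 <= B * 16 ^+ k; last lra.
  by rewrite -[leLHS]mulr1; apply: ler_pM => //; rewrite exprn_ege1//; lra.
have Q1 : 8 <= Q.
  by rewrite /Q; have : 1 <= B3 ^+ 2; [exact: exprn_ege1|lra].
have [Q' Q'1 Q'E] : exists2 Q' : R, 1 <= Q' & Q' = B * (((5 * c1 + 2) * Q) ^+ 2) ^+ k.
  eexists; last reflexivity.
  rewrite -[leLHS]mulr1; apply: ler_pM => //; rewrite !exprn_ege1//.
  by rewrite -[leLHS]mulr1; apply: ler_pM => //; lra.
pose K0 := 20 * c1 * Q + 4 * K * Q'.
have K00 : 0 <= 20 * c1 * Q by apply: mulr_ge0; [apply: mulr_ge0|]; lra.
have K01 : 0 <= 4 * K * Q' by apply: mulr_ge0; [apply: mulr_ge0|]; lra_from K1 Q'1.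
exists (K0 + 1); first by rewrite lerDr addr_ge0.
move=> E E' D D' h M M' dim cp neD uD hD bD bD' bl x a b Dx Da Db G G'.
have [[oD oD'] [nD nD'] LC cm up] := cp.
have lipd : lip1 (dcomp D) by exact: dcomp_lip1.
have lipd' : lip1 (dcomp D') by exact: dcomp_lip1.
have pos u : D u -> 0 < dcomp D u by move=> ?; exact: dcomp_gt0.
have pos' u : D u -> 0 < dcomp D' (h u) by move=> /hD ?; exact: dcomp_gt0.
have [z [Dz fatz]] := fat_center oD nD neD uD bD.
have fatz' := HK E E' D D' h M M' dim cp bD bD' bl z Dz fatz.
have dz := pos z Dz; have dz' := pos' z Dz.
have [p [Dp pz]] : exists p, D p /\ dcomp D p = dcomp D z / Q.
  have [y [_ [_ [[cy ny] _ _ _]]]] := boundary_triple dim oD nD Dz bD.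
  pose f s := dcomp D (z + s *: (y - z)).
  have cf : {within `[0, 1], continuous f}.
    apply: continuous_subspaceT => s.
    apply: (@continuous_comp _ _ _ (fun s : R => z + s *: (y - z)) (dcomp D)).
      by apply: cvgD; [exact: cvg_cst|apply: cvgZr_tmp].
    exact: dcomp_continuous.
  have f0 : f 0 = dcomp D z by rewrite /f scale0r addr0.
  have f1 : f 1 = 0 by rewrite /f scale1r addrC subrK dcomp_out.
  have Qi : 0 <= dcomp D z / Q <= dcomp D z.
    have Q0 : 0 < Q by lra_from Q1.
    apply/andP; split; first by apply: divr_ge0; exact: ltW.
    by rewrite ler_pdivrMr// ler_peMr; [| exact: ltW|lra_from Q1].
  have [|s _ fs] := @IVT R f 0 1 (dcomp D z / Q) ler01 cf.
    by rewrite f0 f1 min_r ?max_l// ltW.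
  (* The segment from [z] to [y] may leave [D]; that this point is inside follows from its positive
     distance to the complement. *)
  exists (z + s *: (y - z)); split=> //.
  apply: contrapT => /dcomp_out; rewrite -/(f s) fs => e0.
  have : 0 < dcomp D z / Q by rewrite divr_gt0//; lra_from Q1.
  by rewrite e0 ltxx.
pose bad u := `|u - x| < dcomp D u / 2 \/ `|h u - h x| < dcomp D' (h u) / 2.
have bad_close u : D u -> bad u -> gsep (dcomp D) u x <= B3.
  have near16 (E0 : normedModType R) (d0 : E0 -> R) v v0 : lip1 d0 -> 0 < d0 v -> 0 < d0 v0 ->
      `|v - v0| < d0 v / 2 -> gsep d0 v v0 <= 16.
    move=> l0 dv dv0 lt; have := l0 v v0 => l1.
    have -> : 16 = (2 * (1 + 1)) ^+ 2 :> R by ring.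
    by apply: gsep_le_of_ratio => //; lra_from dv lt l1.
  move=> Du [s1|s1].
    apply: (le_trans (near16 _ _ _ _ lipd (pos u Du) (pos x Dx) s1)).
    rewrite /B3 ler_peMr// -[leLHS]mulr1; apply: ler_pM => //.
    by rewrite exprn_ege1//; lra_from.
  have [_ _ low] := cm; apply: (le_trans (low u x Du Dx)).
  apply: (@le_trans _ _ (B * 16 ^+ k)); last first.
    rewrite /B3 ler_peMl// ?mulr_ge0// ?exprn_ge0//; lra_from B1.
  rewrite ler_wpM2l//; first lra_from B1.
  have g0 := gsep_gt0 (pos' u Du) (pos' x Dx).
  rewrite lerXn2r ?nnegrE//; first exact: ltW.
  exact: near16 lipd' (pos' u Du) (pos' x Dx) s1.
have [w [Dw nbad wz wz']] : exists w, [/\ D w, ~ bad w, dcomp D z <= Q * dcomp D w &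
    dcomp D' (h z) <= Q' * dcomp D' (h w)].
  have [bz|nz] := pselect (bad z); last first.
    exists z; split=> //; [rewrite ler_peMl// ?ltW//|rewrite ler_peMl// ?ltW//]; lra_from Q1.
  have dp := pos p Dp; have dp' := pos' p Dp.
  have zp : dcomp D z = Q * dcomp D p by rewrite pz mulrC divfK// gt_eqF//; lra_from Q1.
  exists p; split=> //; last 2 first.
  - by rewrite zp.
  - apply: (le_trans (gsep_ge_ratio dz' dp')); apply: ler_wpM2r; first exact: ltW.
    apply: (le_trans (up z p Dz Dp)); rewrite Q'E ler_wpM2l//; first lra_from B1.
    have g0 := gsep_gt0 dz dp.
    rewrite lerXn2r ?nnegrE ?exprn_ge0//; [exact: ltW|by rewrite mulr_ge0//; lra_from c11 Q1|].
    have Q0 : 0 <= Q by lra_from Q1.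
    apply: (@gsep_le R E (dcomp D) z p (dcomp D z) Q dz dp Q0 dz).
    + by rewrite ler_peMl ?ltW//; lra_from Q1.
    + by rewrite zp.
    + have := fatz p Dp; rewrite -/c1 distrC /msep => h1.
      have : dcomp D p <= dcomp D z by rewrite zp ler_peMl// ?ltW//; lra_from Q1.
      lra_from h1.
  move=> bp; have g1 := bad_close z Dz bz; have g2 := bad_close p Dp bp.
  have dx := pos x Dx; have g3 := gsep_triangle dz dp dx.
  have g4 : gsep (dcomp D) z p <= 4 * B3 * B3.
    apply: (le_trans g3); apply: ler_pM.
    - by rewrite mulr_ge0// ltW// gsep_gt0.
    - by rewrite ltW// gsep_gt0.
    - by rewrite ler_wpM2l.
    - by rewrite gsepC.
  have := gsep_ge_ratio dz dp.
  have : gsep (dcomp D) z p * dcomp D p <= 4 * B3 * B3 * dcomp D p.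
    by apply: ler_wpM2r => //; exact: ltW.
  rewrite zp /Q expr2 => h1 h2.
  have h3 := le_trans h2 h1.
  have : 0 < B3 * B3 * dcomp D p by rewrite !mulr_gt0//; lra_from B1.
  lra_from h1 h2.
have dw := pos w Dw; have dw' := pos' w Dw.
have [n1 n2] : dcomp D w / 2 <= `|w - x| /\ dcomp D' (h w) / 2 <= `|h w - h x|.
  by split; rewrite leNgt; apply/negP => lt; apply: nbad; [left|right].
have gw : dcomp D w / 2 <= dcomp G w by apply: dG_ge => //; lra_from dw.
have gw' : dcomp D' (h w) / 2 <= dcomp G' (h w) by apply: dG_ge => //; lra_from dw'.
have Gw : G w by split=> // wx; move: n1; rewrite /= wx subrr normr0; have := pos x Dx; lra_from.
have src u : D u -> `|x - u| <= (K0 + 1) * dcomp G w.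
  move=> Du; have f1 := fatz x Dx; have f2 := fatz u Du; rewrite -/c1 in f1 f2.
  have s1 : `|x - u| <= 10 * c1 * dcomp D z.
    by have := ler_distD z x u; rewrite (distrC z u); lra_from f1 f2.
  have s2 : 10 * c1 * dcomp D z <= 10 * c1 * (Q * dcomp D w) by rewrite ler_wpM2l//; lra_from c11.
  have s3 : 20 * c1 * Q * (dcomp D w / 2) <= 20 * c1 * Q * dcomp G w by rewrite ler_wpM2l.
  have s4 : 0 <= (4 * K * Q' + 1) * dcomp G w by rewrite mulr_ge0//; lra_from K01 dw gw.
  rewrite /K0; lra_from s1 s2 s3 s4.
have img u : D u -> `|h x - h u| <= (K0 + 1) * dcomp G' (h w).
  move=> Du; have f1 := fatz' (h x) (hD x Dx); have f2 := fatz' (h u) (hD u Du).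
  have s1 : `|h x - h u| <= 2 * K * dcomp D' (h z).
    by have := ler_distD (h z) (h x) (h u); rewrite (distrC (h z) (h u)); lra_from f1 f2.
  have s2 : 2 * K * dcomp D' (h z) <= 2 * K * (Q' * dcomp D' (h w)) by rewrite ler_wpM2l//; lra_from K1.
  have s3 : 4 * K * Q' * (dcomp D' (h w) / 2) <= 4 * K * Q' * dcomp G' (h w) by rewrite ler_wpM2l.
  have s4 : 0 <= (20 * c1 * Q + 1) * dcomp G' (h w) by rewrite mulr_ge0//; lra_from K00 dw' gw'.
  rewrite /K0; lra_from s1 s2 s3 s4.
by exists w => //; split; [exact: src|exact: src|exact: src|split; exact: img].
Qed.

End BoundedRoots.

(** * The gauge *)

Section Gauge.
Context {R : realType}.
Implicit Types (s t C : R) (j n k : nat).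

Definition root2 j : R -> R := iter j Num.sqrt.

Lemma root2_ge0 j t : 0 <= t -> 0 <= root2 j t.
Proof. by case: j => // j _; exact: sqrtr_ge0. Qed.

Lemma root2K j t : 0 <= t -> root2 j (t ^+ (2 ^ j)) = t.
Proof.
move=> t0; elim: j => [|j IHj] //.
by rewrite /root2 iterSr expnSr exprM sqrtr_sqr ger0_norm ?exprn_ge0.
Qed.

Lemma root2X j t : 0 <= t -> root2 j t ^+ (2 ^ j) = t.
Proof.
move=> t0; elim: j => [|j IHj] //; rewrite expnS exprM /root2 iterS.
by rewrite sqr_sqrtr// root2_ge0.
Qed.

Lemma le_root2 j s t : s <= t -> root2 j s <= root2 j t.
Proof. by elim: j => [|j IHj] //= st; rewrite ler_wsqrtr// IHj. Qed.

Lemma continuous_root2 j : continuous (root2 j).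
Proof.
elim: j => [|j IHj] t; first exact: cvg_id.
by apply: (continuous_comp (IHj t)); exact: sqrt_continuous.
Qed.

(** For nonnegative [t] and with n = 2^j this is [(C * t)] to the power 1 / n up to [t = 1], and the
    n-th root of [C] times t^n beyond: a power quasisymmetry. *)
Definition gauge j C t := root2 j (C * Num.max t (t ^+ (2 ^ (j + j)))).

Lemma continuous_gauge j C : continuous (gauge j C).
Proof.
have cm : continuous (fun t => Num.max t (t ^+ (2 ^ (j + j)))).
  apply: (@max_fun_continuous _ R R id (fun t => t ^+ _)) => t; first exact: cvg_id.
  exact: exprn_continuous.
move=> t; rewrite /gauge; apply: (@continuous_comp _ _ _ (fun t => C * Num.max t (t ^+ (2 ^ (j + j))))).
  by apply: cvgMr; exact: cm.
exact: continuous_root2.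
Qed.

Lemma halfline_gauge j C : 1 <= C -> halfline_homeo (gauge j C).
Proof.
move=> C1; set n := (2 ^ (j + j))%N; have C0 : C != 0 by rewrite gt_eqF//; lra.
have m0 t : 0 <= t -> 0 <= Num.max t (t ^+ n) by move=> t0; rewrite le_max t0.
have e0 t : 0 <= t -> 0 <= gauge j C t.
  by move=> t0; apply: root2_ge0; rewrite mulr_ge0 ?m0//; lra.
(* The inverse of a maximum of increasing functions is the minimum of their inverses. *)
pose v s := s ^+ (2 ^ j) / C; pose g s := Num.min (v s) (root2 (j + j) (v s)).
have v0 s : 0 <= s -> 0 <= v s by move=> s0; rewrite divr_ge0 ?exprn_ge0//; lra.
have g0 s : 0 <= s -> 0 <= g s by move=> s0; rewrite le_min v0// root2_ge0// v0.
have eK t : 0 <= t -> g (gauge j C t) = t.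
  move=> t0; rewrite /g /v /gauge root2X; last by rewrite mulr_ge0 ?m0//; lra.
  rewrite mulrC mulKf//; have [nt|tn] := leP (t ^+ n) t.
    by rewrite min_l// -{1}(root2K (j + j) t0) le_root2.
  by rewrite root2K// min_r// ltW.
have gK s : 0 <= s -> gauge j C (g s) = s.
  move=> s0; rewrite /gauge -/n (_ : Num.max _ _ = v s).
    by rewrite /v mulrC divfK// root2K.
  have w := root2X (j + j) (v0 s s0); rewrite -/n in w.
  rewrite /g; have [le|le] := leP (v s) (root2 (j + j) (v s)).
    by rewrite max_l// -{2}w; apply: lerXn2r; rewrite ?nnegrE ?root2_ge0 ?v0.
  by rewrite w max_r// ltW.
split.
- apply/seteqP; split; first by move=> _ [t /= t0 <-]; exact: e0.
  by move=> s /= s0; exists (g s); [exact: g0|exact: gK].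
- exact/continuous_subspaceT/continuous_gauge.
- exists g; split; last by move=> t; exact: eK.
  apply/continuous_subspaceT; have cv : continuous v.
    by move=> t; apply: cvgMl; exact: exprn_continuous.
  apply: (@min_fun_continuous _ R R v (fun s => root2 _ (v s))) => // t.
  apply: (continuous_comp (cv t)).
  exact: continuous_root2.
Qed.

Lemma le_gauge j C t t' : 0 <= t' ->
  t' ^+ (2 ^ j) <= C * Num.max t (t ^+ (2 ^ j * 2 ^ j)) -> t' <= gauge j C t.
Proof.
by move=> t0; rewrite /gauge expnD -{2}(root2K j t0); exact: le_root2.
Qed.

End Gauge.

(** * Extension to the closure *)

Section ExtendedMaps.
Context {R : realType} {E E' : normedModType R}.
Implicit Types (D : set E) (h : E -> E') (e r L : R).
Implicit Types (F : one_point_ext E -> one_point_ext E') (X : set (one_point_ext E)).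

Lemma eq_coarse_pair D (D' : set E') h h1 q B k : (forall x, D x -> h x = h1 x) ->
  coarse_pair D D' h q B k -> coarse_pair D D' h1 q B k.
Proof.
move=> eh [oo nn LC [ps st low] up]; split=> //; last first.
  by move=> u v Du Dv; rewrite -!eh//; exact: up.
split=> [u Du|u v Du Dv|u v Du Dv]; rewrite -!eh//; [exact: ps|exact: st|exact: low].
Qed.

Lemma ext_continuous_fin X F (A : set E) h : {within X, continuous F} ->
  (forall x, A x -> X (fin x) /\ F (fin x) = fin (h x)) -> {within A, continuous h}.
Proof.
move=> /subspace_continuousP cF AX; apply/subspace_continuousP => x Ax.
have [Xx Fx] := AX x Ax => B nB.
have : nbhs (F (fin x)) (fin @` B).
  by rewrite Fx; apply: filterS nB => y By; exists y.
move=> /(cF _ Xx) nX; rewrite /= in nX.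
have nX' : \forall u \near x, X (fin u) -> (fin @` B) (F (fin u)) by exact: nX.
apply: filterS nX' => u H Au; have [Xu Fu] := AX u Au.
by have [y By] := H Xu; rewrite Fu => -[yu]; change (B (h u)); rewrite -yu.
Qed.

Lemma within_graph_limit (A D : set E) (h : E -> E') x : {within A, continuous h} ->
  D `<=` A -> A x -> closure D x -> graph_limit D h x (h x).
Proof.
move=> /subspace_continuousP ch DA Ax cx e e0.
have nB : nbhs (h x) (ball (h x) e) by exact: nbhsx_ballx.
have nA : \forall u \near x, A u -> ball (h x) e (h u) by exact: ch _ Ax _ nB.
have [u [Du [/= hu xu]]] := cx _ (filterI nA (nbhsx_ballx x e e0)).
exists u; split=> //; rewrite distrC; first by move: xu; rewrite -ball_normE.
by have := hu (DA u Du); rewrite -ball_normE.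
Qed.

Lemma nbhs_infty (V : normedModType R) r :
  nbhs (infty : one_point_ext V) (fin @` [set p : V | r < `|p|] `|` [set infty]).
Proof.
exists [set p : V | `|p| <= r]; last first.
  by move=> _ [[p /= np <-]|->]; [left; exists p => //=; rewrite ltNge; apply/negP|right].
split.
  by apply: (@closed_comp _ _ (Num.norm : V -> R) [set t | t <= r]) => [? _|];
    [exact: norm_continuous|exact: closed_le].
exists r; split; first exact: num_real.
by move=> M rM p /= pr; apply: (le_trans pr); exact: ltW.
Qed.

Lemma nbhs_infty_norm (V : normedModType R) (U : set (one_point_ext V)) :
  nbhs (infty : one_point_ext V) U -> exists r, forall p, r < `|p| -> U (fin p).
Proof.
move=> [C [_ /pinfty_ex_gt0[r _ Cr]] CU]; exists r => p rp; apply: CU; left; exists p => //= Cp.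
by move: (Cr p Cp); rewrite /= leNgt rp.
Qed.

Lemma closure_infty (V : normedModType R) (D : set V) :
  ext_closure D infty <-> forall r, exists p, D p /\ r < `|p|.
Proof.
split=> [cD r|H U /nbhs_infty_norm[r rU]].
  have [_ [[p Dp <-] [[p1 /= rp [e]]|//]]] := cD _ (nbhs_infty V r).
  by exists p; rewrite -e in Dp *.
by have [p [Dp rp]] := H r; exists (fin p); split; [exists p|exact: rU].
Qed.

Lemma continuous_at_infty X F D h : {within X, continuous F} -> X infty -> F infty = infty ->
  (forall p, D p -> X (fin p) /\ F (fin p) = fin (h p)) ->
  forall r, exists r', forall p, D p -> r' < `|p| -> r < `|h p|.
Proof.
move=> /subspace_continuousP cF Xi Fi DX r.
have nB := nbhs_infty E' r; rewrite -Fi in nB.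
have {}nB : \forall u \near (infty : one_point_ext E), X u ->
  (fin @` [set p : E' | r < `|p|] `|` [set F infty]) (F u) by exact: cF _ Xi _ nB.
have [r' H] := nbhs_infty_norm nB; exists r' => p Dp rp.
have [Xp Fp] := DX p Dp; have := H p rp Xp.
by rewrite Fi Fp => -[[y ry [<-]]|].
Qed.

End ExtendedMaps.

Section MapsOfClosures.
Context {R : realType} {E E' : normedModType R}.
Variables (L : R) (phi : R -> R) (D : set E) (D' : set E')
  (f : one_point_ext E -> one_point_ext E').
Hypotheses (L1 : 1 <= L) (oD : open D) (qf : QC L phi D D' f).

(** By [hfin], the default 0 is never taken on the closure of [D]: [f] may take the value infinity
    only at infinity there. *)
Let h x := if f (fin x) is Some y then y else 0.

Let hfin x : closure D x -> f (fin x) = fin (h x).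
Proof.
case: qf => _ [h0 [h0f _]] [[h1 [h1f _]] _] cx; rewrite /h.
have [Dx|nDx] := pselect (D x); first by rewrite h0f//; exists x.
by rewrite h1f//; apply/ext_boundary_fin.
Qed.

Let infty_boundary : ext_closure D infty -> f infty = infty.
Proof.
by case: qf => _ _ [_ H] cD; apply: H; split=> // /interior_subset[].
Qed.

Let cl x : closure D x -> ext_closure D (fin x).
Proof. by move=> ?; apply/ext_closure_fin. Qed.

Let hD x : D x -> D' (h x).
Proof.
case: qf => _ [h0 [h0f [[<- _ _] _]]] _ Dx; exists x => //.
by rewrite /h h0f//; exists x.
Qed.

Let hD_surj y : D' y -> exists2 x, D x & h x = y.
Proof.
case: qf => _ [h0 [h0f [[<- _ _] _]]] _ [x Dx <-]; exists x => //.
by rewrite /h h0f//; exists x.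
Qed.

Let g : exists g1 : E' -> E,
  [/\ forall x, closure D x -> g1 (h x) = x, {within h @` closure D, continuous g1} &
   ext_closure D infty -> forall r, exists r', forall p, D p -> r' < `|h p| -> r < `|p| ].
Proof.
have [[fcl _ [g [cg gK]]] _ _] := qf.
pose g1 y := if g (fin y) is Some x then x else 0; exists g1.
have g1K x : closure D x -> g1 (h x) = x.
  by move=> cx; rewrite /g1 -hfin// gK//; exact: cl.
split=> //.
- apply: ext_continuous_fin cg _ => _ [x cx <-]; rewrite g1K//.
  rewrite -hfin// gK; last exact: cl.
  by split=> //; rewrite -fcl; exists (fin x) => //; exact: cl.
- move=> ci r; have fi := infty_boundary ci.
  have ci' : ext_closure D' infty by rewrite -fcl; exists infty.
  have gi : g infty = infty by rewrite -{1}fi gK.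
  have [|r' H] := @continuous_at_infty R E' E _ _ D' g1 cg ci' gi _ r.
    move=> _ /hD_surj[x /subset_closure cx <-]; rewrite -hfin// gK ?g1K//; last exact: cl.
    by split=> //; rewrite -fcl; exists (fin x) => //; exact: cl.
  exists r' => p Dp rp; rewrite -(g1K p) ?H//; first exact: hD.
  exact: subset_closure.
Qed.

Let h_continuous : {within closure D, continuous h}.
Proof.
case: qf => -[_ cf _] _ _; apply: ext_continuous_fin cf _ => x cx.
by split; [exact: cl|exact: hfin].
Qed.

Let boundary_out u : closure D u -> ~ D u -> ~ D' (h u).
Proof.
move=> cu nu /hD_surj[x Dx xu]; apply: nu; have [g1 [gK _ _]] := g.
by rewrite -(gK u cu) -xu gK//; exact: subset_closure.
Qed.

Let boundary_surj y : closure D' y -> ~ D' y -> exists u, [/\ closure D u, ~ D u & h u = y].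
Proof.
move=> cy ny; have [[fcl _ _] _ _] := qf.
have : ext_closure D' (fin y) by apply/ext_closure_fin.
rewrite -fcl => -[[u|] cu]; last by rewrite infty_boundary.
have {}cu : closure D u by apply/ext_closure_fin.
rewrite (hfin cu) => -[uy]; exists u; split=> // Du.
by apply: ny; rewrite -uy; exact: hD.
Qed.

Let image_infty : ext_closure D' infty -> ext_closure D infty.
Proof.
have [[fcl _ _] _ _] := qf; rewrite -fcl => -[[u|//] cu].
by rewrite (_ : Some u = fin u)// hfin//; apply/ext_closure_fin.
Qed.

Let bounded_of (V : normedModType R) (G : set V) : ~ ext_closure G infty ->
  exists M, forall p, G p -> `|p| <= M.
Proof.
move=> nG; apply: contrapT => /forallNP H; apply: nG; apply/closure_infty => r.
have /existsNP[p /not_implyP[Gp /negP]] := H r; rewrite -ltNge => rp.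
by exists p.
Qed.

(** The dichotomy separates the two normalizations. If infinity is in the closure, it is a fixed
    boundary point, and continuity of [f] and of its inverse there gives the two growth conditions;
    otherwise both domains are bounded and the bilipschitz bound takes over. *)
Lemma QC_restriction : exists h : E -> E', [/\
  forall x, closure D x -> f (fin x) = fin (h x),
  homeo_on (closure D) (h @` closure D) h,
  (forall x, D x -> D' (h x)),
  exists2 h0, fqc phi D D' h0 & forall x, D x -> h0 x = h x &
  (exists M, [/\ forall p, D p -> `|p| <= M, forall p, D' p -> `|p| <= M &
     bilipschitz_boundary D D' h L]) \/
  [/\ forall r, exists p, D p /\ r < `|p|,
      forall r, exists r', forall p, D p -> r' < `|p| -> r < `|h p| &
      forall r, exists r', forall p, D p -> r' < `|h p| -> r < `|p|]].
Proof.
have [g1 [gK cg unb]] := g; exists h; split=> //.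
- by split=> //; exists g1.
- case: qf => _ [h0 [h0f fq]] _; exists h0 => // x Dx.
  by rewrite /h h0f//; exists x.
have [ci|bi] := pselect (ext_closure D infty); [right|left].
  split; [exact/closure_infty| |exact: unb].
  case: qf => -[_ cf _] _ _.
  apply: continuous_at_infty cf ci (infty_boundary ci) _ => p /subset_closure cp.
  by rewrite hfin//; split=> //; exact: cl.
have [M1 H1] := bounded_of bi.
have [M2 H2] := bounded_of (fun ci => bi (image_infty ci)).
exists (Num.max M1 M2); split=> [p /H1|p /H2|]; [by rewrite le_max => ->|by rewrite le_max orbC => ->|].
split=> //.
  by move=> u cu nu; apply: (within_graph_limit h_continuous) => //; exact: subset_closure.
move=> u v cu nu cv nv; have [_ _ [[h1 [h1f [_ bl]]] _]] := qf.
have bu : ext_boundary D (fin u) by apply/ext_boundary_fin.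
have bv : ext_boundary D (fin v) by apply/ext_boundary_fin.
have [-> ->] : h u = h1 u /\ h v = h1 v.
  have := h1f _ bu; have := h1f _ bv; rewrite !hfin//.
  by move=> [->] [->].
have [h2 h3] := bl u v bu bv; split=> //.
by rewrite mulrC -ler_pdivrMr// (lt_le_trans ltr01 L1).
Qed.

End MapsOfClosures.

Section InteriorRatio.
Context {R : realType}.

Lemma rootW (E E' : normedModType R) (d : E -> R) (d' : E' -> R) h K K' x a b w :
  0 <= d w -> 0 <= d' (h w) -> K <= K' -> root d d' h K x a b w -> root d d' h K' x a b w.
Proof.
move=> d0 d0' KK; have := ler_wpM2r d0 KK; have := ler_wpM2r d0' KK => l' l.
move=> [h1 h2 h3 [h4 h5 h6]].
by split; [exact: le_trans h1 l|exact: le_trans h2 l|exact: le_trans h3 l|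
  split; [exact: le_trans h4 l'|exact: le_trans h5 l'|exact: le_trans h6 l']].
Qed.

Lemma interior_ratio c L phi : 1 <= L -> halfline_homeo phi ->
  exists j C, 1 <= C /\
    forall (E E' : normedModType R) (D : set E) (D' : set E') f,
      dim_ge2 E -> dim_ge2 E' -> domain D -> ~` D !=set0 -> domain D' -> ~` D' !=set0 ->
      uniform_domain c D -> uniform_domain c D' -> QC L phi D D' f ->
      exists h : E -> E', [/\ forall x, closure D x -> f (fin x) = fin (h x),
        homeo_on (closure D) (h @` closure D) h &
        forall x a b, D x -> D a -> D b -> x != a -> x != b ->
          let t := `|x - a| / `|x - b| in
          (`|h x - h a| / `|h x - h b|) ^+ (2 ^ j) <=
            C * Num.max t (t ^+ (2 ^ j * 2 ^ j))].
Proof.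
move=> L1 hphi; have [q [B [j [q1 B1 Hfqc]]]] := fqc_coarse_pairs c hphi.
have [K1 K11 HK1] := @root_unbounded R c q B (2 ^ j) q1 B1.
have [K2 K21 HK2] := @root_bounded R c q B (2 ^ j) L q1 B1 L1.
have K0 : 1 <= Num.max K1 K2 by rewrite le_max K11.
have [C C1 HC] := @punctured_ratio R (1 / 2) q B (2 ^ j) _ ltac:(lra) q1 B1 K0.
exists j, C; split=> // E E' D D' f dim dim' dD nD dD' nD' uD uD' qf.
have [oD _ neD] := dD.
have [h [hf hom hD [h0 fq h0h] cases]] := QC_restriction L1 oD qf.
have [cp cpx] := Hfqc E E' D D' h0 dim dim' dD dD' nD nD' uD uD' fq.
exists h; split=> // x a b Dx Da Db xa xb /=.
pose G := D `\` [set x]; pose G' := D' `\` [set h x].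
have Ga : G a by split=> //= ax; rewrite ax eqxx in xa.
have Gb : G b by split=> //= bx; rewrite bx eqxx in xb.
have cpG : coarse_pair G G' h q B (2 ^ j)%N.
  apply: (@eq_coarse_pair _ _ _ _ _ h0); first by move=> u [Du _]; exact: h0h.
  by rewrite /G' -h0h//; apply: cpx => //; exists a.
have [_ [nG nG'] LC cm up] := cpG.
have [w Gw rw] : exists2 w, G w & root (dcomp G) (dcomp G') h (Num.max K1 K2) x a b w.
  have [[M [bD bD' bl]]|[U1 U2 U3]] := cases.
    have cpD : coarse_pair D D' h q B (2 ^ j)%N by exact: eq_coarse_pair cp.
    have [w Gw rw] := HK2 E E' D D' h M M dim cpD neD uD hD bD bD' bl x a b Dx Da Db.
    exists w => //; apply: rootW rw; rewrite ?dcomp_ge0//.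
    by rewrite le_max lexx orbT.
  have [w Gw rw] := HK1 E E' D D' h oD nD uD U1 U2 U3 x a b Dx cpG Ga Gb.
  exists w => //; apply: rootW rw; rewrite ?dcomp_ge0//.
  by rewrite le_max lexx.
have [r1 r2 r3 [r4 r5 r6]] := rw.
apply: (HC E E' G (dcomp G) (dcomp G') h _ _ _ _ LC cm up x (h x) a b w) => //.
- exact: dcomp_lip1.
- exact: dcomp_lip1.
- by move=> z; exact: dcomp_ge0.
- by move=> z; exact: dcomp_ge0.
- have [_ ch _] := hom; apply: (within_graph_limit ch).
  + by move=> u [Du _]; exact: subset_closure.
  + exact: subset_closure.
  (* The puncture [x] must be a limit of points of [G]: a small multiple of the nonzero vector [e1]
     moves it within [D] and [U]. *)
  move=> U nU; have [e1 [e2 He]] := dim.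
  have e10 : e1 != 0.
    apply/eqP => e0; have [|/eqP] := He 1 0; first by rewrite e0 scaler0 scale0r addr0.
    by rewrite oner_eq0.
  have : nbhs x (D `&` U) by apply: filterI => //; exact: open_nbhs_nbhs.
  move=> /nbhs_ballP[e /= e0 eDU]; have ne : 0 < `|e1| by rewrite normr_gt0.
  have [Dy Uy] : (D `&` U) (x + (e / 2 / `|e1|) *: e1).
    apply: eDU; rewrite -ball_normE /= opprD addrA subrr add0r normrN normrZ.
    by rewrite ger0_norm ?divfK ?gt_eqF// ?divr_ge0//; lra_from e0.
  exists (x + (e / 2 / `|e1|) *: e1); split=> //; split=> //= /eqP.
  rewrite -subr_eq0 addrAC subrr add0r scaler_eq0 (negPf e10) orbF.
  by rewrite gt_eqF// !divr_gt0.
- by apply: dcomp_out => -[_]; apply.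
- by apply: dcomp_out => -[_]; apply.
Qed.

End InteriorRatio.

Lemma closure_quasisymmetric (R : realType) (E E' : normedModType R) (D : set E) (h : E -> E')
    (eta : R -> R) : continuous eta ->
  homeo_on (closure D) (h @` closure D) h ->
  (forall x a b, D x -> D a -> D b -> x != a -> x != b ->
     `|h x - h a| / `|h x - h b| <= eta (`|x - a| / `|x - b|)) ->
  quasisymmetric eta (closure D) h.
Proof.
move=> ceta hom H; split=> // x a b cx ca cb xa xb ab.
have [_ ch [g [_ gK]]] := hom.
(* Injectivity on the closure keeps the limit denominator away from 0, so that the ratios converge
   along sequences from [D]. *)
have hxb : h x != h b by apply: contra xb => /eqP e; rewrite -(gK x cx) -(gK b cb) e.
have seqs y : closure D y -> exists u : nat -> E, [/\ forall n, D (u n), u @ \oo --> y &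
    (h \o u) @ \oo --> h y].
  move=> cy; have lim := within_graph_limit ch (@subset_closure _ D) cy cy.
  have /choice[u Hu] : forall n : nat, exists v, [/\ D v, `|v - y| < n.+1%:R^-1 &
      `|h v - h y| < n.+1%:R^-1] by move=> n; apply: lim; rewrite invr_gt0.
  have small e : 0 < e -> \forall n \near \oo, n.+1%:R^-1 < e :> R.
    by move=> e0; exact: near_infty_natSinv_lt (PosNum e0).
  exists u; split=> [n||]; first by have [] := Hu n.
    apply/cvgrPdist_lt => e /small; apply: filterS => n.
    by apply: lt_trans; rewrite distrC; have [] := Hu n.
  apply/cvgrPdist_lt => e /small; apply: filterS => n.
  by apply: lt_trans; rewrite distrC; have [] := Hu n.
have [xs [Dxs cxs chxs]] := seqs x cx; have [sa [Das cas chas]] := seqs a ca.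
have [bs [Dbs cbs chbs]] := seqs b cb.
rewrite !(distrC _ (h x)) !(distrC _ x).
apply: (@ler_cvg_to _ \oo _ _ (fun n => `|h (xs n) - h (sa n)| / `|h (xs n) - h (bs n)|)
  (fun n => eta (`|xs n - sa n| / `|xs n - bs n|))).
- apply: cvgM; first by apply: cvg_norm; exact: cvgB.
  by apply: cvgV; [rewrite normr_eq0 subr_eq0|apply: cvg_norm; exact: cvgB].
- apply: continuous_cvg; first exact: ceta.
  apply: cvgM; first by apply: cvg_norm; exact: cvgB.
  by apply: cvgV; [rewrite normr_eq0 subr_eq0|apply: cvg_norm; exact: cvgB].
have dist (u v : nat -> E) (p p' : E) : u @ \oo --> p -> v @ \oo --> p' ->
    p != p' -> \forall n \near \oo, u n != v n.
  move=> cu cv pp; have n0 : 0 < `|p - p'| by rewrite normr_gt0 subr_eq0.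
  have /cvgrPdist_lt near0 : (fun n => u n - v n) @ \oo --> p - p' by exact: cvgB.
  apply: filterS (near0 _ n0) => n.
  by apply: contraTneq => /= ->; rewrite subrr subr0 ltxx.
apply: filterS2 (dist _ _ _ _ cxs cas xa) (dist _ _ _ _ cxs cbs xb) => n.
by move=> ? ?; exact: H.
Qed.

Theorem theorem1p2 (R : realType) (c L : R) (phi : R -> R)
    (hL : 1 <= L) (hphi : halfline_homeo phi)
    (hphi_ge : forall t : R, 0 <= t -> t <= phi t) :
  exists eta : R -> R, halfline_homeo eta /\
    forall (E E' : completeNormedModType R) (D : set E) (D' : set E')
           (f : one_point_ext E -> one_point_ext E'),
      dim_ge2 E -> dim_ge2 E' ->
      domain D -> D <> setT -> domain D' -> D' <> setT ->
      uniform_domain c D -> uniform_domain c D' ->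
      QC L phi D D' f ->
      ext_quasisymmetric eta (ext_closure D) f.
Proof.
have [j [C [C1 HC]]] := interior_ratio c hL hphi.
exists (gauge j C); split; first exact: halfline_gauge.
move=> E E' D D' f dim dim' dD nD dD' nD' uD uD' qf.
have proper (V : normedModType R) (G : set V) : G <> setT -> ~` G !=set0.
  by move=> nG; apply/set0P; apply: contra_notN nG => /eqP e; rewrite -(setCK G) e setC0.
have [h [hf hom ratio]] := HC E E' D D' f dim dim' dD (proper _ _ nD) dD' (proper _ _ nD')
  uD uD' qf.
exists h; rewrite (_ : fin @^-1` _ = closure D); last first.
  by apply/seteqP; split=> x /ext_closure_fin.
split; first by move=> x /ext_closure_fin; exact: hf.
apply: closure_quasisymmetric => //; first exact: continuous_gauge.
move=> x a b Dx Da Db xa xb; apply: le_gauge; first by rewrite divr_ge0.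
exact: ratio.
Qed.
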